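(* Let $k=0$ and $\ell\in\{1,2\}$. Let $\lambda$ be a simple eigenvalue and $(\lambda,\boldsymbol\sigma,\boldsymbol u)\in\mathbb R\times\mathbb H_0\times\mathbf Q$ a solution of the continuous eigenvalue problem with $\|\boldsymbol u\|_{0,\Omega}=1$, and let $(\lambda_h,\boldsymbol\sigma_h,\boldsymbol u_h)\in\mathbb R\times\mathbb H_{0,h}\times\mathbf Q_h$ be its finite element approximation, i.e. a solution of the discrete eigenvalue problem with $\|\boldsymbol u_h\|_{0,\Omega}=1$ and $\lambda_h\to\lambda$ as $h\to0$. Then there is a constant $C>0$, independent of $h$ and of the discrete solution, such that $$\eta^2:=\sum_{T\in\mathcal T_h}\eta_T^2\le C\left(\|\boldsymbol u-\boldsymbol u_h\|_{0,\Omega}^2+\|\boldsymbol\sigma-\boldsymbol\sigma_h\|_{0,\Omega}^2+\text{h.o.t.}\right),$$ where the high order term is $\text{h.o.t.}=\|\Theta_h\boldsymbol u-\boldsymbol u\|_{0,\Omega}^2$.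
   Context: Let $\Omega\subset\mathbb{R}^2$ be a bounded connected polygonal Lipschitz domain and $\mu>0$ a constant. $\|\cdot\|_{0,D}$ denotes the $\mathrm L^2(D)$ norm and $(\cdot,\cdot)_{0,\Omega}$ the $\mathrm{L}^2(\Omega)$ inner product. For $2\times2$ tensors $\boldsymbol\tau:\boldsymbol\sigma=\sum_{i,j}\tau_{ij}\sigma_{ij}$, $\mathbb{J}=\begin{pmatrix}0&1\\-1&0\end{pmatrix}$, $\boldsymbol\tau^r:=\boldsymbol\tau-\frac12(\boldsymbol\tau:\mathbb{J})\mathbb{J}$. For a tensor field, $\mathbf{curl}(\boldsymbol\tau)$ is the vector with $i$-th entry $\partial_1\tau_{i2}-\partial_2\tau_{i1}$ and $\mathbf{div}(\boldsymbol\tau)$ is the row-wise divergence; for a vector field $\boldsymbol\varphi$, $\underline{\mathbf{curl}}(\boldsymbol\varphi)$ is the tensor with $i$-th row $(-\partial_2\varphi_i,\partial_1\varphi_i)$. $\mathbb{H}(\mathbf{curl},\Omega)=\{\boldsymbol\tau\in \mathrm{L}^2(\Omega)^{2\times2}:\mathbf{curl}(\boldsymbol\tau)\in \mathrm{L}^2(\Omega)^2\}$; $\mathbb{H}_0:=\{\boldsymbol\tau\in\mathbb{H}(\mathbf{curl},\Omega):\int_\Omega\boldsymbol\tau:\mathbb{J}=0\}$; $\mathbf{Q}:=\mathrm{L}^2(\Omega)^2$; $a(\boldsymbol\xi,\boldsymbol\tau):=\frac1\mu\int_\Omega\boldsymbol\xi^r:\boldsymbol\tau^r$; $b(\boldsymbol\xi,\boldsymbol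 v):=\int_\Omega\boldsymbol v\cdot\mathbf{curl}(\boldsymbol\xi)$. Continuous eigenvalue problem: find $\lambda\in\mathbb R$ and $\boldsymbol 0\ne(\boldsymbol\sigma,\boldsymbol u)\in\mathbb H_0\times\mathbf Q$ with $a(\boldsymbol\sigma,\boldsymbol\tau)+b(\boldsymbol\tau,\boldsymbol u)=0$ for all $\boldsymbol\tau\in\mathbb H_0$ and $b(\boldsymbol\sigma,\boldsymbol v)=-\lambda(\boldsymbol u,\boldsymbol v)_{0,\Omega}$ for all $\boldsymbol v\in\mathbf Q$. Let $\{\mathcal T_h\}_{h>0}$ be a (shape-)regular family of triangulations of $\Omega$, $h_T$ the diameter of $T$, $h_e$ the length of an edge $e$, $h=\max_T h_T$. With $k=0$: the first-type local Nédelec space is $\mathbb{NED}^{(1)}_0(T)=\mathrm P_0(T)^2\oplus\mathrm P_0(T)(x_2,-x_1)^{\mathtt t}$, the second-type one is $\mathbb{NED}^{(2)}_1(T)=\mathrm P_1(T)^2$; the global spaces consist of the $\boldsymbol\tau\in\mathbb{H}(\mathbf{curl},\Omega)$ each of whose rows restricted to every $T$ lies in the local space. $\mathbb{H}_{0,h}$ is the subspace of those $\boldsymbol\tau_h$ in $\mathbb{NED}^{(1)}_0(\mathcal T_h)$ (if $\ell=1$) or $\mathbb{NED}^{(2)}_1(\mathcal T_h)$ (if $\ell=2$) with $\int_\Omega\boldsymbol\tau_h:\mathbb J=0$; $\mathbf Q_h$ is the space of piecewise constant vector fields. Discrete eigenvalue problem: find $\lambda_h$ and $\boldsymbol 0\ne(\boldsymbol\sigma_h,\boldsymbol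 u_h)\in\mathbb H_{0,h}\times\mathbf Q_h$ with $a(\boldsymbol\sigma_h,\boldsymbol\tau_h)+b(\boldsymbol\tau_h,\boldsymbol u_h)=0$ for all $\boldsymbol\tau_h\in\mathbb H_{0,h}$ and $b(\boldsymbol\sigma_h,\boldsymbol v_h)=-\lambda_h(\boldsymbol u_h,\boldsymbol v_h)_{0,\Omega}$ for all $\boldsymbol v_h\in\mathbf Q_h$. Postprocessing operator: $\mathbf Y_h:=\{\boldsymbol v\in\mathrm H^1(\Omega)^2:\boldsymbol v|_T\in\mathrm P_1(T)^2\ \forall T\in\mathcal T_h\}$; for a vertex $z$ let $\omega_z$ be the union of the triangles containing $z$; $\Theta_h:\mathbf Q\to\mathbf Y_h$ is determined by the vertex values $\Theta_h\boldsymbol v(z):=\sum_{T\subset\omega_z}\frac{1}{|\omega_z|}\int_T\boldsymbol v\,dx$. Estimator: $\mathcal E(T)$ is the set of edges of $T$, $\mathcal E_h(\Omega)$ the set of interior edges, $\mathcal E_h(\partial\Omega)$ the set of boundary edges; for each edge $e$ a unit normal $\boldsymbol n_e$ is fixed, and for $e=\partial T\cap\partial T'$ the normal jump is $[\![\boldsymbol\tau]\!]:=(\boldsymbol\tau|_T-\boldsymbol\tau|_{T'})|_e\boldsymbol n_e$. The local indicator is $$\eta_T^2:=\|\Theta_h\boldsymbol u_h-\boldsymbol u_h\|_{0,T}^2+h_T^2\Big\|\underline{\mathbf{curl}}(\boldsymbol u_h)-\tfrac1\mu\boldsymbol\sigma_h^r\Big\|_{0,T}^2+h_T^2\Big\|\mathbf{div}\Big(\tfrac1\mu\boldsymbol\sigma_h^r\Big)\Big\|_{0,T}^2+\sum_{e\in\mathcal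 E(T)\cap\mathcal E_h(\Omega)}h_e\Big\|\Big[\!\Big[\tfrac1\mu\boldsymbol\sigma_h^r\Big]\!\Big]\Big\|_{0,e}^2+\sum_{e\in\mathcal E(T)\cap\mathcal E_h(\partial\Omega)}h_e\Big\|\tfrac1\mu\boldsymbol\sigma_h^r\boldsymbol n_e\Big\|_{0,e}^2,$$ with $\underline{\mathbf{curl}}(\boldsymbol u_h)$ and $\mathbf{div}$ taken elementwise. *)

(* Defs.v *)
From HB Require Import structures.
From mathcomp Require Import all_boot all_order all_algebra.
From mathcomp Require Import all_classical all_reals all_analysis.

Set Implicit Arguments.
Unset Strict Implicit.
Unset Printing Implicit Defensive.

Import Order.TTheory GRing.Theory Num.Theory numFieldNormedType.Exports.

Local Open Scope classical_set_scope.
Local Open Scope ring_scope.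

Notation plane R := (R * R)%type.
Notation vfield R := (R * R -> 'cV[R]_2).
Notation tfield R := (R * R -> 'M[R]_2).
(* Two end points; the order is irrelevant, see [same_edge]. *)
Notation edge R := ((R * R) * (R * R))%type.
Notation triangle R := ((R * R) * (R * R) * (R * R))%type.

Section Plane.
Context {R : realType}.
Implicit Types (D Omega : set (plane R)) (x y p : plane R) (T : triangle R)
  (e : edge R).

(* The norm of the library on [R * R] is the max norm, hence this distance. *)
Definition edist x y : R := Num.sqrt ((x.1 - y.1) ^+ 2 + (x.2 - y.2) ^+ 2).

Definition disc x (r : R) : set (plane R) := [set y | edist x y <= r].

Definition diam D : R := sup [set edist x y | x in D & y in D].

Definition boundary D : set (plane R) := closure D `\` D°.

Definition segment e : set (plane R) :=
  [set (1 - t) *: e.1 + t *: e.2 | t in `[0, 1]].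

(* Near each boundary point, in orthonormal coordinates centred at that point,
   [Omega] is the set of the points above the graph of a Lipschitz function. *)
Definition lipschitz_boundary Omega : Prop :=
  forall p, boundary Omega p ->
  exists (n : plane R) (g : R -> R) (L : R),
    [/\ n.1 ^+ 2 + n.2 ^+ 2 = 1,
        L.-lipschitz g
      & \forall x \near p,
          Omega x <->
          g ((x.1 - p.1) * n.2 - (x.2 - p.2) * n.1)
            < (x.1 - p.1) * n.1 + (x.2 - p.2) * n.2].

Definition polygonal Omega : Prop :=
  exists s : seq (edge R), boundary Omega = \bigcup_(e in [set` s]) segment e.

Definition polygonal_lipschitz_domain Omega : Prop :=
  [/\ open Omega, Omega !=set0, connected Omega, bounded_set Omega
    & lipschitz_boundary Omega /\ polygonal Omega].

Definition leb2 := (@lebesgue_measure R \x @lebesgue_measure R)%E.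

Definition area D : R := fine (leb2 D).

End Plane.

Section Tensors.
Context {R : realType}.

Definition dot m n (A B : 'M[R]_(m, n)) : R :=
  \sum_(i < m) \sum_(j < n) A i j * B i j.

Definition Jmx : 'M[R]_2 :=
  \matrix_(i < 2, j < 2) ((i < j)%N%:R - (j < i)%N%:R).

Definition rpart (A : 'M[R]_2) : 'M[R]_2 := A - (dot A Jmx / 2) *: Jmx.

End Tensors.

Section Fields.
Context {R : realType}.
Implicit Types (D Omega : set (plane R)) (x : plane R).

(* Fields on [Omega] are represented by functions on the plane whose values
   outside [Omega] are irrelevant. *)
Definition L2 D m n (F : plane R -> 'M[R]_(m, n)) : Prop :=
  forall i j, measurable_fun D (fun x => F x i j) /\
    (@leb2 R).-integrable D (fun x => (F x i j ^+ 2)%:E).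

Definition L2dot D m n (F G : plane R -> 'M[R]_(m, n)) : R :=
  \int[@leb2 R]_(x in D) dot (F x) (G x).

Definition L2norm D m n (F : plane R -> 'M[R]_(m, n)) : R :=
  Num.sqrt (L2dot D F F).

Definition eq_ae D m n (F G : plane R -> 'M[R]_(m, n)) : Prop :=
  F = G %[ae @leb2 R in D].

Definition evec (j : 'I_2) : plane R := ((j == 0)%:R, (j == 1)%:R).

Definition partial (j : 'I_2) (f : plane R -> R) : plane R -> R :=
  'D_(evec j) f.

Definition smooth (f : plane R -> R) : Prop :=
  forall s : seq 'I_2,
    continuous (foldr partial f s) /\
    forall x j, derivable (foldr partial f s) x (evec j).

Definition test_function Omega (f : plane R -> R) : Prop :=
  smooth f /\
  exists K, [/\ compact K, K `<=` Omega & forall x, ~ K x -> f x = 0].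

Definition weak_partial Omega (j : 'I_2) (f g : plane R -> R) : Prop :=
  forall phi, test_function Omega phi ->
    \int[@leb2 R]_(x in Omega) (f x * partial j phi x)
    = - \int[@leb2 R]_(x in Omega) (g x * phi x).

Definition H1 Omega (v : vfield R) : Prop :=
  L2 Omega v /\
  exists G : tfield R, L2 Omega G /\
    forall i j, weak_partial Omega j (fun x => v x i 0) (fun x => G x i j).

(* [c] represents the distribution
   [d_1 tau_{i2} - d_2 tau_{i1}], [i = 1, 2] (indices start from 0 below). *)
Definition weak_curl Omega (tau : tfield R) (c : vfield R) : Prop :=
  forall phi, test_function Omega phi -> forall i,
    \int[@leb2 R]_(x in Omega) (c x i 0 * phi x)
    = - \int[@leb2 R]_(x in Omega)
          (tau x i 1 * partial 0 phi x - tau x i 0 * partial 1 phi x).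

Definition Hcurl Omega (tau : tfield R) : Prop :=
  L2 Omega tau /\ exists c : vfield R, L2 Omega c /\ weak_curl Omega tau c.

Definition mean_skew_free Omega (tau : tfield R) : Prop :=
  \int[@leb2 R]_(x in Omega) dot (tau x) Jmx = 0.

Definition H0 Omega : set (tfield R) :=
  [set tau | Hcurl Omega tau /\ mean_skew_free Omega tau].

Definition Q Omega : set (vfield R) := [set v | L2 Omega v].

Definition aform Omega (mu : R) (xi tau : tfield R) : R :=
  mu^-1 * L2dot Omega (fun x => rpart (xi x)) (fun x => rpart (tau x)).

(* [b(xi, v)] is [L2dot Omega v c] for any square integrable representative
   [c] of the weak curl of [xi]; representatives agree almost everywhere. *)
Definition eigensolution Omega (mu : R) (HH : set (tfield R))
    (QQ : set (vfield R)) (lam : R) (sigma : tfield R) (u : vfield R) : Prop :=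
  [/\ HH sigma, QQ u,
      ~ (eq_ae Omega sigma (cst 0) /\ eq_ae Omega u (cst 0)),
      forall tau c, HH tau -> L2 Omega c -> weak_curl Omega tau c ->
        aform Omega mu sigma tau + L2dot Omega u c = 0
    & forall v c, QQ v -> L2 Omega c -> weak_curl Omega sigma c ->
        L2dot Omega v c = - lam * L2dot Omega u v].

Definition simple_eigenvalue Omega (mu lam : R) : Prop :=
  (exists sigma u, eigensolution Omega mu (H0 Omega) (Q Omega) lam sigma u) /\
  forall sigma u sigma' u',
    eigensolution Omega mu (H0 Omega) (Q Omega) lam sigma u ->
    eigensolution Omega mu (H0 Omega) (Q Omega) lam sigma' u' ->
    exists a : R, eq_ae Omega sigma' (fun x => a *: sigma x) /\
                  eq_ae Omega u' (fun x => a *: u x).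

Definition ecurl (v : vfield R) : tfield R := fun x =>
  \matrix_(i < 2, j < 2)
    if j == 0 then - partial 1 (fun y => v y i 0) x
    else partial 0 (fun y => v y i 0) x.

Definition ediv (tau : tfield R) : vfield R := fun x =>
  \col_(i < 2) \sum_(j < 2) partial j (fun y => tau y i j) x.

End Fields.

Section Meshes.
Context {R : realType}.
Implicit Types (Omega : set (plane R)) (x z : plane R) (e : edge R)
  (T : triangle R) (M : seq (triangle R)).

Definition vertices T : seq (plane R) := [:: T.1.1; T.1.2; T.2].

Definition edges T : seq (edge R) :=
  [:: (T.1.1, T.1.2); (T.1.2, T.2); (T.2, T.1.1)].

Definition same_edge e e' : bool := (e == e') || (e == (e'.2, e'.1)).

Definition has_edge T e : bool := has (same_edge e) (edges T).

Definition tri T : set (plane R) :=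
  [set x | exists a b c : R, [/\ 0 <= a, 0 <= b, 0 <= c, a + b + c = 1
    & x = a *: T.1.1 + b *: T.1.2 + c *: T.2]].

Definition nondegenerate T : Prop :=
  (T.1.2.1 - T.1.1.1) * (T.2.2 - T.1.1.2)
    - (T.1.2.2 - T.1.1.2) * (T.2.1 - T.1.1.1) != 0.

Definition conforming T T' : Prop :=
  [\/ tri T `&` tri T' = set0,
      exists z, [/\ z \in vertices T, z \in vertices T'
                  & tri T `&` tri T' = [set z]]
    | exists e, [/\ has_edge T e, has_edge T' e
                  & tri T `&` tri T' = segment e]].

Definition triangulation Omega M : Prop :=
  [/\ uniq M,
      {in M, forall T, nondegenerate T},
      {in M &, forall T T', T != T' -> conforming T T'}
    & \bigcup_(T in [set` M]) tri T = closure Omega].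

Definition meshsize M : R := \big[Num.max/0]_(T <- M) diam (tri T).

(* The mesh size ranges over a set [hs] of positive reals that accumulates at
   [0]. *)
Definition regular_family Omega (hs : set R) (Th : R -> seq (triangle R))
    : Prop :=
  [/\ forall h, hs h -> 0 < h,
      closure hs 0,
      forall h, hs h -> triangulation Omega (Th h) /\ meshsize (Th h) = h
    & exists kappa : R, forall h, hs h -> {in Th h, forall T,
        exists z r, [/\ 0 < r, disc z r `<=` tri T
                      & diam (tri T) <= kappa * r]}].

Definition P0 (p : plane R -> R) : Prop := exists c, forall x, p x = c.

Definition P1 (p : plane R -> R) : Prop :=
  exists c a b, forall x, p x = c + a * x.1 + b * x.2.

Definition NED1_0 (q : plane R -> 'rV[R]_2) : Prop :=
  exists (a : 'rV[R]_2) (b : R), forall x,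
    q x = a + b *: \row_(j < 2) (if j == 0 then x.2 else - x.1).

Definition NED2_1 (q : plane R -> 'rV[R]_2) : Prop :=
  forall j, P1 (fun x => q x 0 j).

Definition NED (ell : nat) (q : plane R -> 'rV[R]_2) : Prop :=
  if ell == 1%N then NED1_0 q else NED2_1 q.

(* Discrete fields are taken with the representative that is polynomial on
   each open triangle; values on the skeleton of the mesh are irrelevant. *)
Definition NEDh Omega M ell : set (tfield R) :=
  [set tau | Hcurl Omega tau /\
    {in M, forall T, forall i, exists2 q, NED ell q &
      forall x, (tri T)° x -> row i (tau x) = q x}].

Definition H0h Omega M ell : set (tfield R) :=
  [set tau | NEDh Omega M ell tau /\ mean_skew_free Omega tau].

Definition Qh Omega M : set (vfield R) :=
  [set v | Q Omega v /\
    {in M, forall T, forall i, exists2 p, P0 p &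
      forall x, (tri T)° x -> v x i 0 = p x}].

(* Here the representative is affine on closed triangles, so that it has
   values at the vertices. *)
Definition Yh Omega M : set (vfield R) :=
  [set v | H1 Omega v /\
    {in M, forall T, forall i, exists2 p, P1 p &
      forall x, tri T x -> v x i 0 = p x}].

Definition patch M z : seq (triangle R) := [seq T <- M | z \in tri T].

Definition patch_set M z : set (plane R) :=
  \bigcup_(T in [set` patch M z]) tri T.

Definition postprocessing Omega M (Theta : vfield R -> vfield R) : Prop :=
  forall v, Q Omega v ->
    Yh Omega M (Theta v) /\
    {in M, forall T, {in vertices T, forall z, forall i,
      Theta v z i 0
      = \sum_(T' <- patch M z) (area (patch_set M z))^-1
          * \int[@leb2 R]_(x in (tri T')°) v x i 0}}.

Definition edge_length e : R := edist e.1 e.2.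

(* The sign depends on the order of the end points, but only norms of
   expressions linear in the normal are used. *)
Definition unit_normal e : 'cV[R]_2 :=
  (edge_length e)^-1 *:
    \col_(i < 2) (if i == 0 then e.2.2 - e.1.2 else e.1.1 - e.2.1).

(* Norm of [L^2(e)] with respect to arc length. *)
Definition edge_norm e (F : vfield R) : R :=
  Num.sqrt (edge_length e * \int[@lebesgue_measure R]_(t in `[0, 1])
    dot (F ((1 - t) *: e.1 + t *: e.2)) (F ((1 - t) *: e.1 + t *: e.2))).

(* Extension of [F|_T] from the open to the closed triangle. *)
Definition trace T (F : tfield R) : tfield R := fun x =>
  \matrix_(i < 2, j < 2) lim (F y i j @[y --> within (tri T)° (nbhs x)]).

Definition neighbours M T e : seq (triangle R) :=
  [seq T' <- M | (T' != T) && has_edge T' e].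

Definition interior_edge M T e : bool := neighbours M T e != [::].

Definition boundary_edge Omega e : Prop := segment e `<=` boundary Omega.

(* In a triangulation an interior edge [e] of [T] has exactly one neighbour
   across it. *)
Definition normal_jump M T e (F : tfield R) : vfield R := fun x =>
  (trace T F x - trace (head T (neighbours M T e)) F x) *m unit_normal e.

Definition etaT_sqr Omega (mu : R) M (Theta : vfield R -> vfield R)
    (sigmah : tfield R) (uh : vfield R) T : R :=
  let K := (tri T)° in
  let hT := diam (tri T) in
  let s := fun x => mu^-1 *: rpart (sigmah x) in
  L2norm K (fun x => Theta uh x - uh x) ^+ 2
  + hT ^+ 2 * L2norm K (fun x => ecurl uh x - s x) ^+ 2
  + hT ^+ 2 * L2norm K (ediv s) ^+ 2
  + \sum_(e <- edges T | interior_edge M T e)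
      edge_length e * edge_norm e (normal_jump M T e s) ^+ 2
  + \sum_(e <- edges T | `[< boundary_edge Omega e >])
      edge_length e * edge_norm e (fun x => trace T s x *m unit_normal e) ^+ 2.

Definition eta_sqr Omega (mu : R) M (Theta : vfield R -> vfield R)
    (sigmah : tfield R) (uh : vfield R) : R :=
  \sum_(T <- M) etaT_sqr Omega mu M Theta sigmah uh T.

End Meshes.

(* Main.v *)
(* Write [s = mu^-1 sigma^r] and [s_h = mu^-1 sigma_h^r]. Multiples of [J] have
   zero curl and zero symmetric part, so the first eigenvalue equation holds for
   all [tau] with square integrable curl, without the constraint on the mean:
   [s = curl u] and [div s = 0] weakly, with zero normal trace. Subtracting the
   discrete quantities, which are affine on each triangle, each residual of the
   estimator acts on compactly supported test fields through [s - s_h] and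
   [u - u_h], as in Verfuerth's bubble function argument. Here the test fields are
   built from the radial bump [(1 - |x - m|^2 / r^2)_+^k], supported in a disc
   inscribed in the triangle for [curl u_h - s_h] and [div s_h], and in a disc
   centred at the midpoint of the edge for the normal jumps: by shape regularity
   these discs are comparable to the triangle, and all inverse estimates reduce
   to explicit inequalities for affine functions on discs and half discs. For the
   divergence and the jumps the test fields are gradients, so that [u] drops out;
   at a boundary edge the gradient may be cut off along the edge, which lies
   outside of [Omega]. The first term of the indicator is bounded through
   [Theta_h u_h - Theta_h u] and [Theta_h u - u], the averaging operator [Theta_h]
   being stable in [L^2] on every mesh. *)
Require Import Defs.
From HB Require Import structures.
From mathcomp Require Import all_boot all_order all_algebra.
From mathcomp Require Import all_classical all_reals all_analysis.
From mathcomp Require Import ring lra measurable_realfun.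

Import Order.TTheory GRing.Theory Num.Theory numFieldNormedType.Exports.

Local Open Scope classical_set_scope.
Local Open Scope ring_scope.

Set Implicit Arguments.
Unset Strict Implicit.
Unset Printing Implicit Defensive.

(** * Integration on the plane *)

(* The measurable structure of [leb2] is the one carried by this product. *)
Notation plane_m R := (measurableTypeR R * measurableTypeR R)%type.

(** Apart from the averaging term, every quantity in the estimator is affine on a triangle or an
    edge, so each inverse estimate concerns finitely many coefficients, measured on a disc of radius
    [r] by [size2]. A residual is tested with itself times a bump; the equation turns the result
    into integrals of [s - s_h] and [u - u_h], and after Cauchy-Schwarz one factor of the residual
    cancels. Radial bumps replace barycentric bubbles because they need no reference triangle and
    have explicit derivatives. Their cube is the least power whose gradient is again C1, so that
    gradients are themselves admissible test fields. The obstacle is the edge terms: neither line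
    integrals nor traces of the exact field are ever formed. The line integral of the jump is
    rewritten as the integral of a nonnegative function over a half disc. The discontinuity across
    the line is treated with a smoothed Heaviside function, whose derivative is harmless when the
    normal component of the field is bounded by a multiple of the distance from the line. *)

Definition mu2 (R : realType) : {measure set (plane_m R) -> \bar R} := @leb2 R.

Section MeasurePlane.
Context {R : realType}.
Implicit Types (A D U : set (R * R)) (f g : R * R -> R).

Lemma nbhs_ball_sub (x : R * R) A : nbhs x A ->
  exists2 e : R, 0 < e & forall y, `|y.1 - x.1| < e -> `|y.2 - x.2| < e -> A y.
Proof.
move=> /nbhs_ballP[e /= e0 sA]; exists e => // y y1 y2; apply: sA.
by split => /=; rewrite /ball /= distrC.
Qed.

(** The sigma-algebra is generated by products of Borel sets, not by the topology. An open set is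
    the countable union of the squares with rational centre and half-side [1/(n+1)] that it
    contains. *)
Lemma open_measurable2 A : open A -> @measurable _ (plane_m R) A.
Proof.
move=> oA.
pose B (q : rat * rat * nat) : set (R * R) :=
  `](ratr q.1.1 - q.2.+1%:R^-1), (ratr q.1.1 + q.2.+1%:R^-1)[ `*`
  `](ratr q.1.2 - q.2.+1%:R^-1), (ratr q.1.2 + q.2.+1%:R^-1)[.
pose F q := if `[< B q `<=` A >] then B q else set0.
have -> : A = \bigcup_q F q.
  apply/seteqP; split=> [x Ax|x [q _]]; last first.
    by rewrite /F; case: asboolP => // + Bx; exact.
  have [e e0 sA] := nbhs_ball_sub (open_nbhs_nbhs (conj oA Ax)).
  have [n] : exists n : nat, n.+1%:R^-1 < e / 2.
    have /ltr_add_invr[k] : 0 < e / 2 by rewrite divr_gt0.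
    by rewrite add0r => ?; exists k.
  (* A rational centre within [d] of [x] gives a square that contains [x] and stays within [2 d < e]
     of it. *)
  set d := n.+1%:R^-1 => de.
  have d0 : 0 < d by rewrite invr_gt0.
  have [q1] := @rat_in_itvoo R (x.1 - d) (x.1 + d) ltac:(lra).
  have [q2] := @rat_in_itvoo R (x.2 - d) (x.2 + d) ltac:(lra).
  rewrite !in_itv /= => /andP[h1 h2] /andP[h3 h4].
  exists (q1, q2, n) => //; rewrite /F.
  case: asboolP => [_|]; first by split => /=; rewrite in_itv /= -/d; apply/andP; split; lra.
  case=> y [] /=; rewrite !in_itv /= -/d => /andP[k1 k2] /andP[k3 k4].
  by apply: sA; rewrite ltr_norml; apply/andP; split; lra.
apply: countable_bigcupT_measurable; first exact: countableP.
move=> q; rewrite /F; case: ifP => // _.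
by apply: measurableX; exact: measurable_itv.
Qed.

Lemma continuous_measurable2 f : continuous f -> measurable_fun [set: plane_m R] f.
Proof.
move=> /continuousP cf; apply: (measurability _ (RGenOpens.measurableE R)).
move=> _ [_ [a [b ->] <-]]; rewrite setTI; apply: open_measurable2.
exact/cf/interval_open.
Qed.

End MeasurePlane.

(** * Integrable and square integrable functions on a measure space *)

Section Integration.
Context d (T : measurableType d) {R : realType}.
Variable mu : {measure set T -> \bar R}.
Implicit Types (D E : set T) (f g : T -> R) (k K A : R).

Definition integrableR D f := mu.-integrable D (EFin \o f).

Definition square_integrable D f :=
  measurable_fun D f /\ mu.-integrable D (fun x => (f x ^+ 2)%:E).

Lemma integrable_bounded D f K : measurable D -> (mu D < +oo)%E ->
  measurable_fun D f -> (forall x, D x -> `|f x| <= K) -> integrableR D f.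
Proof.
move=> mD Doo mf fK; apply: measurable_bounded_integrable => //.
exists K; split; first exact: num_real.
by move=> L KL x Dx; apply: (le_trans (fK x Dx)); exact: ltW.
Qed.

Lemma square_integrable_bounded D f K : measurable D -> (mu D < +oo)%E ->
  measurable_fun D f -> (forall x, D x -> `|f x| <= K) -> square_integrable D f.
Proof.
move=> mD Doo mf fK; split=> //.
apply: (@integrable_bounded D (fun x => f x ^+ 2) (K ^+ 2)) => //.
  exact: measurable_funX.
move=> x Dx; rewrite normrX ler_pXn2r ?nnegrE//; [exact: fK|exact: le_trans (normr_ge0 _) (fK x Dx)].
Qed.

Lemma integrableRM D f g : measurable D ->
  square_integrable D f -> square_integrable D g ->
  integrableR D (fun x => f x * g x).
Proof.
move=> mD [mf f2] [mg g2].
have h : mu.-integrable D (fun x => (f x ^+ 2)%:E + (g x ^+ 2)%:E)%E.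
  exact: integrableD.
refine (@le_integrable _ _ _ mu D mD (EFin \o (fun x => f x * g x)) _ _ _ h).
  by apply/measurable_EFinP; exact: measurable_funM.
move=> x Dx /=; rewrite lee_fin [leRHS]ger0_norm ?addr_ge0 ?sqr_ge0//.
have := sqr_ge0 (f x + g x); have := sqr_ge0 (f x - g x) => h1 h2.
by rewrite ler_norml; apply/andP; split; nra.
Qed.

Lemma integrableRD D f g : measurable D -> integrableR D f -> integrableR D g ->
  integrableR D (fun x => f x + g x).
Proof. by move=> mD hf hg; exact (@integrableD _ _ _ mu D mD _ _ hf hg). Qed.

Lemma integrableRB D f g : measurable D -> integrableR D f -> integrableR D g ->
  integrableR D (fun x => f x - g x).
Proof. by move=> mD hf hg; exact (@integrableB _ _ _ mu D mD _ _ hf hg). Qed.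

Lemma integrableRZ D f k : measurable D -> integrableR D f ->
  integrableR D (fun x => k * f x).
Proof. by move=> mD hf; exact (@integrableZl _ _ _ mu D mD k _ hf). Qed.

Lemma integrableRS D E f : measurable D -> measurable E -> D `<=` E ->
  integrableR E f -> integrableR D f.
Proof. by move=> mD mE DE hf; exact: integrableS DE hf. Qed.

Lemma square_integrableS D E f : measurable D -> measurable E -> D `<=` E ->
  square_integrable E f -> square_integrable D f.
Proof.
move=> mD mE DE [mf hf]; split; first exact: measurable_funS DE mf.
exact: integrableS DE hf.
Qed.

Lemma square_integrableZ D f k : measurable D -> square_integrable D f ->
  square_integrable D (fun x => k * f x).
Proof.
move=> mD [mf hf]; split; first exact: measurable_funM.
have -> : (fun x => ((k * f x) ^+ 2)%:E) = (fun x => (k ^+ 2)%:E * (f x ^+ 2)%:E)%E.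
  by apply/funext => x; rewrite exprMn EFinM.
exact: integrableZl.
Qed.

Lemma square_integrableD D f g : measurable D ->
  square_integrable D f -> square_integrable D g ->
  square_integrable D (fun x => f x + g x).
Proof.
move=> mD hf hg; split; first exact: (measurable_funD hf.1 hg.1).
have h : integrableR D (fun x => f x ^+ 2 + 2 * (f x * g x) + g x ^+ 2).
  apply: integrableRD => //; last exact: hg.2.
  apply: integrableRD => //; first exact: hf.2.
  by apply: integrableRZ => //; exact: integrableRM.
rewrite (_ : (fun x => _) = EFin \o (fun x => f x ^+ 2 + 2 * (f x * g x) + g x ^+ 2)) //.
by apply/funext => x /=; congr EFin; ring.
Qed.

Lemma square_integrableB D f g : measurable D ->
  square_integrable D f -> square_integrable D g ->
  square_integrable D (fun x => f x - g x).
Proof.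
move=> mD hf hg; have := square_integrableD mD hf (square_integrableZ (-1) mD hg).
by under eq_fun do rewrite mulN1r.
Qed.

Lemma Rintegral0_out D E f : D `<=` E -> (forall x, E x -> ~ D x -> f x = 0) ->
  \int[mu]_(x in E) f x = \int[mu]_(x in D) f x.
Proof.
move=> DE f0; rewrite Rintegral_mkcond [RHS]Rintegral_mkcond.
congr Rintegral; apply/funext => x; rewrite /patch.
have [Dx|nD] := pselect (D x).
  by rewrite !mem_set//; exact: DE.
rewrite [in RHS]memNset//; case: ifPn => // /set_mem Ex; exact: f0.
Qed.

Lemma Rintegral0 D f : (forall x, D x -> f x = 0) -> \int[mu]_(x in D) f x = 0.
Proof.
move=> f0; rewrite (@eq_Rintegral _ _ _ _ _ (fun=> 0)); last by move=> x /set_mem /f0.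
by rewrite /Rintegral integral0.
Qed.

Lemma ge0_subset_Rintegral D E f : measurable D -> measurable E -> D `<=` E ->
  integrableR E f -> (forall x, E x -> 0 <= f x) ->
  \int[mu]_(x in D) f x <= \int[mu]_(x in E) f x.
Proof.
move=> mD mE DE hf f0; rewrite /Rintegral fine_le//.
- by apply: integrable_fin_num => //; exact: (integrableRS mD mE DE hf).
- exact: integrable_fin_num.
- apply: ge0_subset_integral => //; first by case/integrableP: hf.
Qed.

Lemma Cauchy_Schwarz D f g : measurable D ->
  square_integrable D f -> square_integrable D g ->
  (\int[mu]_(x in D) (f x * g x)) ^+ 2
  <= (\int[mu]_(x in D) f x ^+ 2) * (\int[mu]_(x in D) g x ^+ 2).
Proof.
move=> mD hf hg; have hfg := integrableRM mD hf hg.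
set a := \int[mu]_(x in D) f x ^+ 2; set b := \int[mu]_(x in D) g x ^+ 2.
set c := \int[mu]_(x in D) (f x * g x).
have a0 : 0 <= a by apply: Rintegral_ge0 => x _; exact: sqr_ge0.
have b0 : 0 <= b by apply: Rintegral_ge0 => x _; exact: sqr_ge0.
have q s t : 0 <= s ^+ 2 * a + 2 * s * t * c + t ^+ 2 * b.
  have -> : s ^+ 2 * a + 2 * s * t * c + t ^+ 2 * b =
      \int[mu]_(x in D) (s * f x + t * g x) ^+ 2.
    transitivity (\int[mu]_(x in D)
      (s ^+ 2 * f x ^+ 2 + 2 * s * t * (f x * g x) + t ^+ 2 * g x ^+ 2)).
      rewrite RintegralD//; last 2 first.
      - apply: integrableRD => //; apply: integrableRZ => //; exact: hf.2.
      - apply: integrableRZ => //; exact: hg.2.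
      rewrite RintegralD//; last 2 first.
      - apply: integrableRZ => //; exact: hf.2.
      - exact: integrableRZ.
      rewrite !RintegralZl//; try exact: hg.2; try exact: hf.2.
    by apply: eq_Rintegral => x _; ring.
  by apply: Rintegral_ge0 => x _; exact: sqr_ge0.
have [a_0|a_0] := eqVneq a 0.
  have [->|c_0] := eqVneq c 0; first by rewrite a_0 mul0r expr0n.
  (* With [a = 0] and [c != 0] the nonnegative form would take the value [- 1] at this point. *)
  have := q (- (b + 1) / (2 * c)) 1.
  rewrite a_0 mulr0 add0r mulr1 expr1n mul1r.
  have -> : 2 * (- (b + 1) / (2 * c)) * c = - (b + 1).
    by field; rewrite c_0.
  lra.
have ap : 0 < a by rewrite lt_neqAle eq_sym a_0.
(* Proportional to the minimiser of the form; the value there is [a (a b - c^2)]. *)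
have := q (- c) a.
have -> : (- c) ^+ 2 * a + 2 * - c * a * c + a ^+ 2 * b = a * (a * b - c ^+ 2) by ring.
by rewrite pmulr_rge0// subr_ge0.
Qed.

Lemma Cauchy_Schwarz_bounded D f g (K A : R) : measurable D ->
  square_integrable D f -> measurable_fun D g ->
  (forall x, D x -> `|g x| <= K) -> (mu D <= A%:E)%E ->
  (\int[mu]_(x in D) (f x * g x)) ^+ 2
  <= K ^+ 2 * A * \int[mu]_(x in D) f x ^+ 2.
Proof.
move=> mD hf mg gK DA.
have Doo : (mu D < +oo)%E by apply: le_lt_trans DA (ltry _).
have hg := square_integrable_bounded mD Doo mg gK.
apply: (le_trans (Cauchy_Schwarz mD hf hg)); rewrite mulrC.
apply: ler_wpM2r; first by apply: Rintegral_ge0 => x _; exact: sqr_ge0.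
have [[x0 Dx0]|D0] := pselect (D !=set0); last first.
  have A0 : 0 <= A by rewrite -lee_fin; apply: le_trans DA.
  rewrite Rintegral0; first by apply: mulr_ge0 => //; exact: sqr_ge0.
  by move=> x Dx; exfalso; apply: D0; exists x.
apply: (@le_trans _ _ (\int[mu]_(x in D) (K ^+ 2))).
  apply: le_Rintegral => //; first exact: hg.2.
    by apply: (@integrable_bounded _ _ `|K ^+ 2|).
  move=> x Dx; rewrite -(real_normK (num_real (g x))) ler_pXn2r ?nnegrE//; [exact: gK|exact: le_trans (normr_ge0 _) (gK x Dx)].
rewrite Rintegral_cst//; apply: ler_wpM2l; first exact: sqr_ge0.
by rewrite -lee_fin fineK// ge0_fin_numE.
Qed.

End Integration.

(** * Integrals over squares of the plane *)

Section PlaneIntegration.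
Context {R : realType}.
Implicit Types (D : set (plane_m R)) (f : plane_m R -> R) (p : R * R) (r k : R).
Local Notation mu := (mu2 R).

Definition box (p : R * R) (r : R) : set (plane_m R) :=
  `[p.1 - r, p.1 + r] `*` `[p.2 - r, p.2 + r].

Lemma measurable_box p r : @measurable _ (plane_m R) (box p r).
Proof. by apply: measurableX; exact: measurable_itv. Qed.

Lemma leb2_box p (r : R) : 0 <= r -> mu (box p r) = (4 * r ^+ 2)%:E.
Proof.
move=> r0; rewrite [LHS](product_measure1E lebesgue_measure lebesgue_measure);
  try exact: measurable_itv.
rewrite /= !lebesgue_measure_itv /= !lte_fin.
have [->|rn0] := eqVneq r 0.
  by rewrite !subr0 !addr0 !ltxx mule0 expr0n mulr0.
have rp : 0 < r by rewrite lt_neqAle eq_sym rn0.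
rewrite !ifT; [|lra|lra]; rewrite -!EFinB.
by rewrite -EFinM; congr EFin; ring.
Qed.

(** Lower bounds on discs and half discs come from a single square on which the integrand is large,
    so the area of a disc is never computed. *)
Lemma Rintegral_lower_box D f p r k : measurable D -> integrableR mu D f ->
  (forall x, D x -> 0 <= f x) -> 0 <= r -> box p r `<=` D ->
  (forall x, box p r x -> k <= f x) -> k * (4 * r ^+ 2) <= \int[mu]_(x in D) f x.
Proof.
move=> mD hf f0 r0 BD fk; have mB := measurable_box p r.
have := ge0_subset_Rintegral mB mD BD hf f0. apply: le_trans.
have -> : k * (4 * r ^+ 2) = \int[mu]_(x in box p r) k.
  by rewrite Rintegral_cst// [mu _]leb2_box.
apply: le_Rintegral => //; last exact: (integrableRS mB mD BD hf).
apply: (@integrable_bounded _ _ _ mu _ _ `|k|) => //.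
by rewrite leb2_box// ltry.
Qed.

End PlaneIntegration.

(** * Sums over disjoint families and removal of null sets *)

Section Disjoint.
Context d (T : measurableType d) {R : realType}.
Variable mu : {measure set T -> \bar R}.
Implicit Types (D E : set T) (f g : T -> R).

Lemma sum_Rintegral_le (I : eqType) (s : seq I) (F : I -> set T) E f :
  measurable E -> uniq s ->
  {in s, forall i, measurable (F i)} -> {in s, forall i, F i `<=` E} ->
  {in s &, forall i j, i != j -> F i `&` F j = set0} ->
  integrableR mu E f -> (forall x, E x -> 0 <= f x) ->
  \sum_(i <- s) \int[mu]_(x in F i) f x <= \int[mu]_(x in E) f x.
Proof.
elim: s E => [|i s IH] E mE us mF FE dF hf f0.
  by rewrite big_nil; exact: Rintegral_ge0.
move: us => /= /andP[nis us].
have mi : measurable (F i) by apply: mF; rewrite mem_head.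
have iE : F i `<=` E by apply: FE; rewrite mem_head.
have mE' : measurable (E `\` F i) by exact: measurableD.
have EE : E = F i `|` (E `\` F i) by rewrite setDUK.
rewrite big_cons [in leRHS]EE Rintegral_setU//; last 2 first.
- by rewrite -EE.
- by apply/disj_setPS => x [Fx [_ /(_ Fx)]].
rewrite lerD2l; apply: IH => //.
- by move=> j js; apply: mF; rewrite inE js orbT.
- move=> j js x Fx; split; first by apply: (FE j) => //; rewrite inE js orbT.
  move=> Fix; have ij : i != j by apply: contraNneq nis => ->.
  have := dF i j (mem_head _ _) _ ij; rewrite inE js orbT => /(_ isT).
  by move=> /seteqP[/(_ x) + _]; apply.
- by move=> j k js ks; apply: dF; rewrite inE ?js ?ks orbT.
- by apply: (integrableRS _ mE) => //; exact: subDsetl.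
- by move=> x [/f0].
Qed.

Lemma sum_fine_measure_le (I : eqType) (s : seq I) (F : I -> set T) E :
  measurable E -> uniq s -> (mu E < +oo)%E ->
  {in s, forall i, measurable (F i)} -> {in s, forall i, F i `<=` E} ->
  {in s &, forall i j, i != j -> F i `&` F j = set0} ->
  \sum_(i <- s) fine (mu (F i)) <= fine (mu E).
Proof.
move=> mE us Eoo mF FE dF.
have := @sum_Rintegral_le I s F E (fun=> 1) mE us mF FE dF.
rewrite Rintegral_cst// mul1r big_seq_cond.
under eq_bigr => i /andP[/mF mi _] do rewrite Rintegral_cst// mul1r.
rewrite -big_seq_cond => h; apply: h => //.
by apply: (@integrable_bounded _ _ _ mu E (fun=> 1) 1) => // x _; rewrite normr1.
Qed.

Lemma Rintegral_setD_null D N f : measurable D -> measurable N -> mu N = 0%E ->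
  integrableR mu D f ->
  \int[mu]_(x in D) f x = \int[mu]_(x in D `\` N) f x.
Proof.
by move=> mD mN N0 hf; rewrite /Rintegral (negligible_integral mN).
Qed.

End Disjoint.

Section PlaneNull.
Context {R : realType}.
Implicit Types (D : set (plane_m R)) (p : R * R).

Lemma leb2_sub_box D p (r : R) : measurable D -> 0 <= r -> D `<=` box p r ->
  (mu2 R D <= (4 * r ^+ 2)%:E)%E.
Proof.
move=> mD r0 DB; rewrite -(leb2_box p r0); apply: le_measure => //;
  rewrite inE //; exact: measurable_box.
Qed.

Lemma closed_measurable2 (A : set (R * R)) : closed A -> @measurable _ (plane_m R) A.
Proof. by move=> /closed_openC/open_measurable2/measurableC; rewrite setCK. Qed.

Lemma leb2_line (n : R * R) (c : R) : n != 0 ->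
  mu2 R [set x | n.1 * x.1 + n.2 * x.2 = c] = 0%E.
Proof.
move=> n0; have [n2|n2] := eqVneq n.2 0.
  have n1 : n.1 != 0.
    by apply: contra_neq n0 => n1; rewrite [n]surjective_pairing n1 n2.
  have -> : [set x | n.1 * x.1 + n.2 * x.2 = c] = [set c / n.1] `*` [set: R].
    apply/seteqP; split=> x /=; rewrite n2 mul0r addr0.
      by move=> <-; split=> //=; field.
    by move=> [-> _]; field.
  rewrite [LHS](product_measure1E lebesgue_measure lebesgue_measure)//;
    try exact: measurable_set1.
  (* A vertical line is a null set times a set of infinite measure, and [0 * +oo = 0]. In the
     remaining case every vertical section is one point. *)
  rewrite [X in (X * _)%E](_ : _ = 0%E) ?mul0e//; exact: lebesgue_measure_set1.
rewrite /mu2 /leb2 /= /product_measure1 /=.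
apply: integral0_eq => x _ /=.
have -> : xsection [set x | n.1 * x.1 + n.2 * x.2 = c] x = [set (c - n.1 * x) / n.2].
  apply/seteqP; split=> y; rewrite /xsection /= inE /=.
    by move=> <-; field.
  by move=> ->; field.
exact: lebesgue_measure_set1.
Qed.

End PlaneNull.

(** * Integration by parts *)

Section C1.
Context {R : realType}.
Implicit Types (f g : R * R -> R) (df dg : 'I_2 -> R * R -> R) (x : R * R).

(** The partial derivatives are carried as data: the product and chain rules then produce explicit
    formulas, which [C1_ext] lets one normalise by [ring]. *)
Definition C1 f df :=
  [/\ continuous f, forall j, continuous (df j)
    & forall j x, is_derive x (evec j : R * R) f (df j x)].

(** Directional derivatives depend only on the difference quotients, so they pass between the plane
    and its sections, on which the one-variable theory applies. *)
Lemma is_derive_eq_quotient (V1 V2 : normedModType R) (f1 : V1 -> R) (f2 : V2 -> R)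
    (x1 v1 : V1) (x2 v2 : V2) (d : R) :
  f1 x1 = f2 x2 -> (forall h : R, f1 (h *: v1 + x1) = f2 (h *: v2 + x2)) ->
  is_derive x1 v1 f1 d -> is_derive x2 v2 f2 d.
Proof.
move=> e0 e [D1 <-].
have E : (fun h : R => h^-1 *: ((f1 \o shift x1) (h *: v1) - f1 x1)) =
         (fun h : R => h^-1 *: ((f2 \o shift x2) (h *: v2) - f2 x2)).
  by apply/funext => h /=; rewrite /shift /= e e0.
by split; rewrite /derivable /derive -?E.
Qed.

Lemma is_derive_section f (df : R) x (v : R * R) :
  is_derive x v f df <-> is_derive (0 : R) 1 (fun h : R => f (h *: v + x)) df.
Proof.
by split; apply: is_derive_eq_quotient => [|h] /=;
  rewrite ?scale0r ?add0r// addr0 [_ *: 1]mulr1.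
Qed.

Lemma is_derive_comp2 (p : R -> R) (dp : R) f (df : R) x (v : R * R) :
  is_derive (f x) (1 : R) p dp -> is_derive x v f df ->
  is_derive x v (p \o f) (dp * df).
Proof.
move=> hp /is_derive_section hf; apply/is_derive_section.
have := @is_derive1_comp R p (fun h : R => f (h *: v + x)) 0 dp df.
by rewrite scale0r add0r => /(_ hp hf).
Qed.

Lemma C1_ext f df dg : C1 f df -> (forall j x, df j x = dg j x) -> C1 f dg.
Proof.
move=> h e; suff -> : dg = df by [].
by apply/funext => j; apply/funext => x; rewrite e.
Qed.

Lemma C1_cst (c : R) : C1 (fun=> c) (fun _ _ => 0).
Proof. by split=> [|j|j x]; [exact: cst_continuous|exact: cst_continuous|exact: is_derive_cst]. Qed.

Lemma C1D f df g dg : C1 f df -> C1 g dg ->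
  C1 (fun x => f x + g x) (fun j x => df j x + dg j x).
Proof.
move=> [cf cdf hf] [cg cdg hg]; split=> [x|j x|j x].
- by apply: continuousD; [exact: cf|exact: cg].
- by apply: continuousD; [exact: cdf|exact: cdg].
- exact: is_deriveD.
Qed.

Lemma C1M f df g dg : C1 f df -> C1 g dg ->
  C1 (fun x => f x * g x) (fun j x => df j x * g x + f x * dg j x).
Proof.
move=> [cf cdf hf] [cg cdg hg]; split=> [x|j x|j x].
- by apply: continuousM; [exact: cf|exact: cg].
- apply: (@continuousD _ _ _ (fun x => df j x * g x) (fun x => f x * dg j x)).
  + by apply: continuousM; [exact: cdf|exact: cg].
  + by apply: continuousM; [exact: cf|exact: cdg].
- apply: (is_derive_eq (is_deriveM (hf j x) (hg j x))).
  by rewrite addrC; congr (_ + _); rewrite [LHS]mulrC.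
Qed.

Lemma C1_comp (p dp : R -> R) f df : continuous dp ->
  (forall y : R, is_derive y (1 : R) p (dp y)) -> C1 f df ->
  C1 (fun x => p (f x)) (fun j x => dp (f x) * df j x).
Proof.
move=> cdp hp [cf cdf hf].
have cp : continuous p.
  by move=> y; apply: differentiable_continuous; apply/derivable1_diffP; case: (hp y).
split=> [x|j x|j x].
- by apply: continuous_comp; [exact: cf|exact: cp].
- apply: (@continuousM _ _ (fun x => dp (f x)) (df j)).
    by apply: continuous_comp; [exact: cf|exact: cdp].
  exact: cdf.
- exact: is_derive_comp2.
Qed.

Lemma fst_continuous2 : continuous (fst : R * R -> R).
Proof. by move=> x; exact: cvg_fst. Qed.

Lemma snd_continuous2 : continuous (snd : R * R -> R).
Proof. by move=> x; exact: cvg_snd. Qed.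

Lemma C1_fst : C1 fst (fun j _ => (j == 0)%:R).
Proof.
split=> [|j|j x]; [exact: fst_continuous2|exact: cst_continuous|].
apply/is_derive_section => /=.
apply: (is_derive_eq (_ : is_derive _ _ ((fun h : R => h * (j == 0)%:R) + cst x.1) _)).
by rewrite /GRing.scale /=; ring.
Qed.

Lemma C1_snd : C1 snd (fun j _ => (j == 1)%:R).
Proof.
split=> [|j|j x]; [exact: snd_continuous2|exact: cst_continuous|].
apply/is_derive_section => /=.
apply: (is_derive_eq (_ : is_derive _ _ ((fun h : R => h * (j == 1)%:R) + cst x.2) _)).
by rewrite /GRing.scale /=; ring.
Qed.

End C1.

(** * Integration by parts for compactly supported functions *)

Section IntegrationByParts.
Context {R : realType}.
Implicit Types (f g : R * R -> R) (df dg : 'I_2 -> R * R -> R) (x : R * R).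
Local Notation mu := (mu2 R).

Lemma closed_box (p : R * R) (r : R) : closed (box p r : set (R * R)).
Proof.
apply: closedI; apply: preimage_closed; try exact: itv_closed.
- by move=> x _; exact: fst_continuous2.
- by move=> x _; exact: snd_continuous2.
Qed.

Lemma boxP (p x : R * R) (r : R) :
  box p r x <-> `|x.1 - p.1| <= r /\ `|x.2 - p.2| <= r.
Proof.
rewrite /box /= !in_itv /= !ler_norml.
by split=> -[] /andP[h1 h2] /andP[h3 h4]; split; apply/andP; split; lra.
Qed.

Lemma box0P (x : R * R) (r : R) : box 0 r x <-> `|x.1| <= r /\ `|x.2| <= r.
Proof. by rewrite boxP (_ : (0 : R * R).1 = 0)// (_ : (0 : R * R).2 = 0)// !subr0. Qed.

Lemma near_box_compl (N : R) x : ~ box 0 N x -> \forall y \near x, ~ box 0 N y.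
Proof.
move=> nb; apply: open_nbhs_nbhs; split => //.
exact/closed_openC/closed_box.
Qed.

Lemma C1_supp (N : R) f df : C1 f df -> (forall x, ~ box 0 N x -> f x = 0) ->
  forall j x, ~ box 0 N x -> df j x = 0.
Proof.
move=> [_ _ hf] f0 j x nb.
have h0 : is_derive x (evec j : R * R) f 0.
  apply: (@near_eq_is_derive R (R * R)%type R (fun=> 0)).
  by near=> y; rewrite f0//; near: y; exact: near_box_compl.
by rewrite -(@derive_val _ _ _ _ _ _ _ (hf j x)) (@derive_val _ _ _ _ _ _ _ h0).
Unshelve. all: by end_near. Qed.

Lemma continuous_supp_bounded (N : R) f : continuous f ->
  (forall x, ~ box 0 N x -> f x = 0) -> exists2 K : R, 0 <= K & forall x, `|f x| <= K.
Proof.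
move=> cf f0.
have cB : compact (box 0 N : set (R * R)) by apply: compact_setX; exact: segment_compact.
have [K [_ hK]] := compact_bounded (continuous_compact (continuous_subspaceT cf) cB).
exists (`|K| + 1) => // x; have [Bx|nB] := pselect (box 0 N x).
  apply: (hK (`|K| + 1)); first by have := ler_norm K; lra.
  by exists x.
by rewrite f0// normr0.
Qed.

Lemma integrable_continuous_supp (N : R) f : continuous f ->
  (forall x, ~ box 0 N x -> f x = 0) -> integrableR mu setT f.
Proof.
move=> cf f0; have [K K0 fK] := continuous_supp_bounded cf f0.
have h : mu.-integrable (box 0 N) (EFin \o f).
  apply: (@integrable_bounded _ _ _ mu _ _ K) => //; first exact: measurable_box.
  - have [N0|N0] := leP 0 N; first by rewrite leb2_box// ltry.
    rewrite (_ : box 0 N = set0) ?measure0//.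
    apply/seteqP; split=> // x [/=]; rewrite in_itv /= => /andP[h1 h2]; lra.
  - by apply: measurable_funS (continuous_measurable2 cf).
move: h; rewrite integrable_mkcond; last exact: measurable_box.
rewrite /integrableR; congr (_ .-integrable _ _); apply/funext => x.
rewrite /patch /=; case: ifPn => // /negP nB; rewrite f0// => Bx.
by apply: nB; apply/mem_set.
Qed.

Lemma integral_derivative_supp (N : R) (G dG : R -> R) :
  continuous dG -> (forall s : R, is_derive s (1 : R) G (dG s)) ->
  (forall s, N < `|s| -> G s = 0 /\ dG s = 0) ->
  (\int[@lebesgue_measure R]_s (dG s)%:E = 0)%E.
Proof.
(* The end points lie strictly beyond [N], which may be negative. *)
move=> cdG hG G0; pose M : R := `|N| + 1; pose I : set R := `[- M, M]%classic.
have MN : N < M by rewrite /M; have := ler_norm N; lra.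
have M0 : 0 < M by rewrite /M; have := normr_ge0 N; lra.
have cG : continuous G.
  by move=> y; apply: differentiable_continuous; apply/derivable1_diffP; case: (hG y).
have -> : (\int[@lebesgue_measure R]_s (dG s)%:E =
           \int[@lebesgue_measure R]_(s in I) (dG s)%:E)%E.
  rewrite [in RHS]integral_mkcond; apply: eq_integral => s _.
  rewrite /patch; case: ifPn => // /negP nM; congr EFin.
  apply: (G0 s _).2; rewrite ltNge; apply/negP => sN; apply: nM; apply/mem_set.
  by move: sN; rewrite /I /= in_itv /= ler_norml => /andP[h1 h2]; apply/andP; split; lra.
rewrite /I (@continuous_FTC2 R dG G).
- rewrite (G0 M _).1 ?(G0 (- M) _).1 ?normrN ?gtr0_norm//.
  by rewrite sube0.
- lra.
- exact: continuous_subspaceT.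
- split.
  + by move=> s _; case: (hG s).
  + by apply: cvg_at_right_filter; exact: cG.
  + by apply: cvg_at_left_filter; exact: cG.
- by move=> s _; rewrite derive1E; exact: derive_val.
Qed.

(** Fubini with the inner integral along direction [j], which vanishes by the fundamental theorem of
    calculus. Applied to products, this gives every integration by parts below. *)
Lemma integral_C1_supp (N : R) f df : C1 f df ->
  (forall x, ~ box 0 N x -> f x = 0) ->
  forall j, \int[mu]_x df j x = 0.
Proof.
move=> Cf f0 j; have [cf cdf hf] := Cf; have df0 := C1_supp Cf f0.
have hi i := integrable_continuous_supp (cdf i) (df0 i).
have out (x : R * R) : N < `|x.1| \/ N < `|x.2| -> ~ box 0 N x.
  by move=> h /box0P[h1 h2]; case: h; rewrite ltNge ?h1 ?h2.
rewrite /Rintegral; suff -> : (\int[mu]_x (df j x)%:E = 0)%E by [].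
have [->|->] : j = 0 \/ j = 1.
  by case: j => -[|[|//]] ij; [left|right]; apply/val_inj.
- rewrite -[LHS](@integral21_prod_meas1 _ _ _ _ R lebesgue_measure lebesgue_measure _ (hi 0)).
  apply: integral0_eq => y _.
  apply: (@integral_derivative_supp N (fun s => f (s, y)) (fun s => df 0 (s, y))).
  + move=> s; apply: (@continuous_comp _ _ _ (fun s => (s, y)) (df 0)).
      exact: (@cvg_pair _ _ _ _ (nbhs s) (nbhs y) _ _ _ id (fun=> y) cvg_id (cvg_cst y)).
    exact: cdf.
  + move=> s; apply: (is_derive_eq_quotient _ _ (hf 0 (s, y))) => // h /=.
    by congr f; congr pair => /=; rewrite /= /GRing.scale /= ?mulr0 ?add0r.
  + by move=> s Ns; split; [apply: f0|apply: df0]; apply: out; left.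
- rewrite -[LHS](@integral12_prod_meas1 _ _ _ _ R lebesgue_measure lebesgue_measure _ (hi 1)).
  apply: integral0_eq => y _.
  apply: (@integral_derivative_supp N (fun s => f (y, s)) (fun s => df 1 (y, s))).
  + move=> s; apply: (@continuous_comp _ _ _ (fun s => (y, s)) (df 1)).
      exact: (@cvg_pair _ _ _ _ (nbhs y) (nbhs s) _ _ _ (fun=> y) id (cvg_cst y) cvg_id).
    exact: cdf.
  + move=> s; apply: (is_derive_eq_quotient _ _ (hf 1 (y, s))) => // h /=.
    by congr f; congr pair => /=; rewrite /= /GRing.scale /= ?mulr0 ?add0r.
  + by move=> s Ns; split; [apply: f0|apply: df0]; apply: out; right.
Qed.

End IntegrationByParts.

(** * Powers of the positive part *)

Section PositivePower.
Context {R : realType}.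

Implicit Types y z : R.

(** For [n = 0] this is the constant 1, hence the successors in the lemmas on vanishing;
    differentiability at 0 takes an exponent of at least 2. *)
Definition pospow (n : nat) (y : R) : R := Num.max y 0 ^+ n.

Lemma pospow_ge0 n y : 0 <= pospow n y.
Proof. by rewrite exprn_ge0// le_max lexx orbT. Qed.

Lemma pospow_pos n y : 0 <= y -> pospow n y = y ^+ n.
Proof. by move=> y0; rewrite /pospow max_l. Qed.

Lemma pospow_neg n y : y <= 0 -> pospow n.+1 y = 0.
Proof. by move=> y0; rewrite /pospow max_r// expr0n. Qed.

Lemma continuous_pospow n : continuous (pospow n).
Proof.
move=> y; apply: (@continuous_comp _ _ _ (fun y : R => Num.max y 0) (fun z => z ^+ n)).
  have -> : (fun y : R => Num.max y 0) = (fun y => 2^-1 * (y + `|y|)).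
    apply/funext => z /=; have [z0|z0] := leP 0 z.
      by rewrite ger0_norm//; field.
    by rewrite ltr0_norm// subrr mulr0.
  apply: cvgM; first exact: cvg_cst.
  by apply: cvgD; [exact: cvg_id|exact: norm_continuous].
exact: exprn_continuous.
Qed.

Lemma is_derive_pospow n (y : R) :
  is_derive y (1 : R) (pospow n.+2) (n.+2%:R * pospow n.+1 y).
Proof.
have [y0|y0|->] := ltrgtP y 0.
- rewrite pospow_neg ?ltW// mulr0.
  apply: (@near_eq_is_derive R R R (fun=> 0)).
  near=> z; rewrite pospow_neg//; apply: ltW; near: z; exact: lt_nbhsl.
- rewrite pospow_pos ?ltW//.
  apply: (@near_eq_is_derive R R R (fun z => z ^+ n.+2)).
    near=> z; rewrite pospow_pos//; apply: ltW; near: z; exact: lt_nbhsr.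
  have -> : (fun z : R => z ^+ n.+2) = (id : R -> R) ^+ n.+2.
    by apply/funext => z; rewrite exprfctE.
  apply: is_derive_eq.
  by rewrite /= [LHS]mulr1.
(* At 0 the difference quotient of [pospow n.+2] is exactly [pospow n.+1 h], which tends to 0. *)
- have lim0 : (fun h : R => h^-1 *: ((pospow n.+2 \o shift 0) (h *: (1 : R)) - pospow n.+2 0))
      @ 0^' --> (0 : R).
    apply: (@cvg_trans _ (pospow n.+1 @ 0^')); last first.
      have := @continuous_pospow n.+1 0; rewrite /continuous_at pospow_neg// => c0.
      exact: cvg_within_filter.
    apply: near_eq_cvg; near=> h.
    have h0 : h != 0 by near: h; exact: nbhs_dnbhs_neq.
    rewrite /= /shift /= addr0 [h *: _]mulr1 (@pospow_neg n.+1 0)// subr0.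
    have [hn|hp] := leP h 0; first by rewrite !pospow_neg// scaler0.
    by rewrite !pospow_pos ?ltW// [in RHS]exprS /GRing.scale /= mulrA mulVf// mul1r.
  rewrite pospow_neg// mulr0; split.
    by apply/cvg_ex; exists 0.
  exact: cvg_lim.
Unshelve. all: by end_near. Qed.

End PositivePower.

(** * The divergence theorem on a half plane *)

Section HalfPlane.
Context {R : realType}.
Implicit Types (f g : R * R -> R) (df dg : 'I_2 -> R * R -> R) (x m n p : R * R).
Local Notation mu := (mu2 R).

(** Here [c] is the value at the base point [m] and [p] the gradient. For a unit vector [n],
    [affine 0 n m] is the signed distance to the line through [m] normal to [n]. *)
Definition affine (c : R) p m x : R := c + p.1 * (x.1 - m.1) + p.2 * (x.2 - m.2).

Definition coord p (j : 'I_2) : R := if j == 0 then p.1 else p.2.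

Lemma C1_affine c p m : C1 (affine c p m) (fun j _ => coord p j).
Proof.
have h := C1D (C1D (C1_cst c) (C1M (C1_cst p.1) (C1D C1_fst (C1_cst (- m.1)))))
  (C1M (C1_cst p.2) (C1D C1_snd (C1_cst (- m.2)))).
apply: (C1_ext h) => j x; rewrite /coord.
by case: j => -[|[|//]] ij /=; ring.
Qed.

Lemma continuous_affine c p m : continuous (affine c p m).
Proof. by case: (C1_affine c p m). Qed.

Lemma measurable_affine_gt0 c p m :
  @measurable _ (plane_m R) [set x | 0 < affine c p m x].
Proof.
apply: open_measurable2.
exact: (proj1 (continuousP _) (@continuous_affine c p m) [set y : R | 0 < y] (@open_gt R 0)).
Qed.

(* A smooth approximation of the Heaviside function with derivative [dstep]. *)
Definition step (e y : R) := pospow 2 y / (pospow 2 y + e).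
Definition dstep (e y : R) := 2 * pospow 1 y * e / (pospow 2 y + e) ^+ 2.

Implicit Types e y : R.

Lemma step_den e y : 0 < e -> 0 < pospow 2 y + e.
Proof. by move=> e0; rewrite ltr_wpDl// pospow_ge0. Qed.

Lemma continuous_dstep e : 0 < e -> continuous (dstep e).
Proof.
move=> e0 y; apply: cvgM.
  apply: cvgM; last exact: cvg_cst.
  by apply: cvgM; [exact: cvg_cst|exact: continuous_pospow].
apply: cvgV; first by rewrite expf_neq0// gt_eqF// step_den.
rewrite expr2; under eq_fun do rewrite expr2.
by apply: cvgM; (apply: cvgD; [exact: continuous_pospow|exact: cvg_cst]).
Qed.

Lemma is_derive_step e y : 0 < e -> is_derive y (1 : R) (step e) (dstep e y).
Proof.
move=> e0; have d0 : pospow 2 y + e != 0 by rewrite gt_eqF// step_den.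
have h2 := @is_derive_pospow R 0 y.
have h3 : is_derive y (1 : R) (fun z => pospow 2 z + e) (2%:R * pospow 1 y + 0).
  exact: (is_deriveD h2 (is_derive_cst e y 1)).
have h4 := @is_deriveV R (fun z => pospow 2 z + e) y _ 1 d0 h3.
apply: (is_derive_eq (is_deriveM h2 h4)).
by rewrite /dstep /GRing.scale /=; field.
Qed.

Lemma stepN e y : y <= 0 -> step e y = 0.
Proof. by move=> y0; rewrite /step pospow_neg// mul0r. Qed.

Lemma dstepN e y : y <= 0 -> dstep e y = 0.
Proof. by move=> y0; rewrite /dstep (@pospow_neg _ 0)// mulr0 !mul0r. Qed.

Lemma step_bounds e y : 0 < e -> 0 <= step e y <= 1.
Proof.
move=> e0; apply/andP; split.
  by rewrite divr_ge0 ?pospow_ge0// ltW// step_den.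
by rewrite /step ler_pdivrMr ?step_den// mul1r lerDl ltW.
Qed.

(** The derivative itself is of order [1 / sqrt e] near 0; the factor [y] makes the bound uniform in
    [e], by [2 y^2 e <= (y^2 + e)^2]. *)
Lemma dstep_bound e y : 0 < e -> `|dstep e y * y| <= 1.
Proof.
move=> e0; have [y0|y0] := leP y 0; first by rewrite dstepN// mul0r normr0.
have d := step_den y e0.
rewrite /dstep !(pospow_pos _ (ltW y0)) in d *.
have -> : 2 * y ^+ 1 * e / (y ^+ 2 + e) ^+ 2 * y = 2 * y ^+ 2 * e / (y ^+ 2 + e) ^+ 2.
  by field; rewrite gt_eqF.
rewrite ger0_norm; last by rewrite divr_ge0 ?sqr_ge0// !mulr_ge0 ?sqr_ge0// ltW.
rewrite ler_pdivrMr ?exprn_gt0// mul1r; have := sqr_ge0 (y ^+ 2 + e); nra.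
Qed.

Lemma cvg_step y : 0 < y -> step k.+1%:R^-1 y @[k --> \oo] --> (1 : R).
Proof.
move=> y0; rewrite /step (pospow_pos _ (ltW y0)).
have y2 : y ^+ 2 != 0 by rewrite expf_neq0// gt_eqF.
rewrite -[X in _ --> X](divff y2).
apply: cvgM; first exact: cvg_cst.
apply: cvgV => //; rewrite -[X in _ --> X]addr0.
by apply: cvgD; [exact: cvg_cst|exact: cvg_harmonic].
Qed.

Lemma cvg_dstep y : dstep k.+1%:R^-1 y @[k --> \oo] --> (0 : R).
Proof.
have [y0|y0] := leP y 0.
  by under eq_fun do rewrite dstepN//; exact: cvg_cst.
rewrite /dstep !(pospow_pos _ (ltW y0)).
have y2 : (y ^+ 2 + 0) ^+ 2 != 0 by rewrite addr0 !expf_neq0// gt_eqF.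
rewrite (_ : 0 = 2 * y ^+ 1 * 0 / (y ^+ 2 + 0) ^+ 2); last by rewrite mulr0 mul0r.
apply: cvgM; first by apply: cvgM; [exact: cvg_cst|exact: cvg_harmonic].
apply: cvgV => //.
rewrite expr2; under eq_fun do rewrite expr2.
by apply: cvgM; (apply: cvgD; [exact: cvg_cst|exact: cvg_harmonic]).
Qed.

(* The discontinuity of the Heaviside function of the half plane does not
   contribute because the field is tangential to the line. *)
Lemma integral_half_plane (N K : R) n m (V : 'I_2 -> R * R -> R)
    (dV : 'I_2 -> 'I_2 -> R * R -> R) :
  (forall i, C1 (V i) (dV i)) -> (forall i x, ~ box 0 N x -> V i x = 0) ->
  (forall x, `|n.1 * V 0 x + n.2 * V 1 x| <= K * `|affine 0 n m x|) ->
  \int[mu]_(x in [set x | 0 < affine 0 n m x]) (dV 0 0 x + dV 1 1 x) = 0.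
Proof.
move=> CV V0 Vn; pose l := affine 0 n m.
pose e k : R := k.+1%:R^-1; have e0 k : 0 < e k by rewrite invr_gt0.
pose D x := dV 0 0 x + dV 1 1 x.
pose E x := n.1 * V 0 x + n.2 * V 1 x.
(* This is the divergence of the field [V] multiplied by [step (e k) (l x)]. *)
pose G k x := step (e k) (l x) * D x + dstep (e k) (l x) * E x.
have dV0 i j x : ~ box 0 N x -> dV i j x = 0.
  exact: (C1_supp (CV i) (V0 i) j).
have cD : continuous D.
  move=> x; apply: (@continuousD _ _ _ (dV 0 0) (dV 1 1)).
  - by have [_ c _] := CV 0; exact: c.
  - by have [_ c _] := CV 1; exact: c.
have D0 x : ~ box 0 N x -> D x = 0 by move=> nb; rewrite /D !dV0// addr0.
have E0 x : ~ box 0 N x -> E x = 0 by move=> nb; rewrite /E !V0// !mulr0 addr0.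
have CW k i := C1M (C1_comp (continuous_dstep (e0 k)) (fun y => is_derive_step y (e0 k))
  (C1_affine 0 n m)) (CV i).
have CG k := C1D (CW k 0) (CW k 1).
have intG k : \int[mu]_(x in box 0 N) G k x = 0.
  have W0 i x : ~ box 0 N x -> step (e k) (l x) * V i x = 0.
    by move=> nb; rewrite V0// mulr0.
  have h i j := integral_C1_supp (CW k i) (W0 i) j.
  have hi i j := integrable_continuous_supp
    (let: And3 _ c _ := CW k i in c j) (C1_supp (CW k i) (W0 i) j).
  rewrite -(@Rintegral0_out _ _ _ _ _ setT)//; last first.
    by move=> x _ nb; rewrite /G D0// E0// !mulr0 addr0.
  transitivity (0 + 0 : R); last by rewrite addr0.
  rewrite -[X in X + _](h 0 0) -[X in _ + X](h 1 1) -RintegralD//;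
    [|exact: hi|exact: hi].
  apply: eq_Rintegral => x _; rewrite /G /D /E /coord /=; ring.
have [B B0 hB] := continuous_supp_bounded cD D0.
pose F x : R := if 0 < l x then D x else 0.
have mbox : measurable (box 0 N : set (plane_m R)) by exact: measurable_box.
have boxoo : (mu (box 0%R N) < +oo)%E.
  have [N0|N0] := leP 0 N; first by rewrite leb2_box// ltry.
  rewrite (_ : box 0 N = set0) ?measure0//.
  apply/seteqP; split=> // x /box0P[x1 _]; have := normr_ge0 (x.1 : R); lra.
have GF x : G k x @[k --> \oo] --> F x.
  rewrite /F; case: ltP => lx; last first.
    rewrite /G; under eq_fun do rewrite stepN// dstepN// !mul0r addr0.
    exact: cvg_cst.
  rewrite -[X in _ --> X]addr0 -[X in _ --> X + _]mul1r -[X in _ --> _ + X](mul0r (E x)).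
  apply: cvgD; apply: cvgM; try exact: cvg_cst; [exact: cvg_step|exact: cvg_dstep].
(* Domination uniform in [k]: by hypothesis the factor [E] is at most [|K| |l|], and [dstep_bound]
   controls the product of [dstep] with [l]. *)
have GB k x : `|G k x| <= B + `|K|.
  apply: (le_trans (ler_normD _ _)); apply: lerD; rewrite normrM.
    have /andP[s0 s1] := step_bounds (l x) (e0 k).
    by rewrite ger0_norm// -[leRHS]mul1r ler_pM.
  apply: le_trans (_ : `|dstep (e k) (l x)| * (`|K| * `|l x|) <= _).
    rewrite ler_wpM2l//; apply: (le_trans (Vn x)).
    by rewrite ler_wpM2r// ler_norm.
  rewrite mulrCA -normrM -[leRHS]mulr1 ler_wpM2l//; exact: dstep_bound.
have mG k : measurable_fun [set: plane_m R] (G k).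
  apply: (@measurable_funD _ _ _ _ (fun x => step (e k) (l x) * D x)).
    apply: continuous_measurable2 => x.
    apply: (@continuousM _ _ (fun x => step (e k) (l x)) D); last exact: cD.
    by have [c _ _] := C1_comp (continuous_dstep (e0 k))
      (fun y => is_derive_step y (e0 k)) (C1_affine 0 n m); exact: c.
  apply: continuous_measurable2 => x.
  apply: (@continuousM _ _ (fun x => dstep (e k) (l x)) E).
    apply: (@continuous_comp _ _ _ l (dstep (e k))); first exact: continuous_affine.
    exact: continuous_dstep.
  apply: (@continuousD _ _ _ (fun x => n.1 * V 0 x) (fun x => n.2 * V 1 x)).
  - by apply: cvgM; [exact: cvg_cst|have [c _ _] := CV 0; exact: c].
  - by apply: cvgM; [exact: cvg_cst|have [c _ _] := CV 1; exact: c].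
have mH : measurable [set x : plane_m R | 0 < l x] by exact: measurable_affine_gt0.
have mF : measurable_fun [set: plane_m R] F.
  have -> : F = D \_ [set x | 0 < l x].
    apply/funext => x; rewrite /F /patch; case: ifPn => lx.
      by rewrite mem_set.
    by rewrite memNset//; exact/negP.
  apply/(measurable_restrictT _ mH)/measurable_funTS.
  exact: (continuous_measurable2 cD).
have DC := @dominated_convergence _ _ _ mu (box 0 N) mbox (fun k x => (G k x)%:E)
  (fun x => (F x)%:E) (fun=> (B + `|K|)%:E).
have {DC} [||||| _ _] := DC.
- by move=> k; apply/measurable_EFinP; exact: measurable_funTS.
- by apply/measurable_EFinP; exact: measurable_funTS.
- by apply: aeW => x _; apply/fine_cvgP; split; [by apply: nearW|exact: GF].
- apply: (@integrable_bounded _ _ _ mu _ (fun=> B + `|K|) (B + `|K|)) => // x _.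
  by rewrite ger0_norm// addr_ge0.
- by apply: aeW => x k _; rewrite lee_fin; exact: GB.
have -> : (fun k => \int[mu]_(x in box 0%R N) (G k x)%:E)%E = fun=> 0%E.
  apply/funext => k; have := intG k; rewrite /Rintegral => h.
  rewrite -[LHS]fineK ?h//; apply: integrable_fin_num => //.
  apply: (@integrable_bounded _ _ _ mu _ (G k) (B + `|K|)) => //.
  exact: measurable_funTS.
move=> h0.
have I0 : (\int[mu]_(x in box 0%R N) (F x)%:E = 0)%E.
  by apply/esym; rewrite -(cvg_lim (@ereal_hausdorff R) h0) lim_cst.
transitivity (\int[mu]_(x in box 0 N) F x); last by rewrite /Rintegral I0.
rewrite -(@Rintegral0_out _ _ _ _ (box 0 N : set (plane_m R)) setT)//; last first.
  by move=> x _ nb; rewrite /F D0// if_same.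
rewrite Rintegral_mkcond; congr Rintegral; apply/funext => x.
rewrite /F /patch; case: ifPn => [/set_mem/= ->//|/negP lx].
by rewrite ifF//; apply/negP => l0; apply: lx; apply/mem_set.
Qed.

End HalfPlane.

(** * Radial bump functions *)

Section Bump.
Context {R : realType}.
Implicit Types (x m n p g : R * R) (c r : R).
Local Notation mu := (mu2 R).

Lemma normr_le_sqr (a r : R) : 0 <= r -> (`|a| <= r) = (a ^+ 2 <= r ^+ 2).
Proof.
by move=> r0; rewrite -(real_normK (num_real a)) ler_pXn2r// nnegrE.
Qed.

Definition sqdist x m : R := (x.1 - m.1) ^+ 2 + (x.2 - m.2) ^+ 2.

Definition quad m r x : R := 1 - sqdist x m / r ^+ 2.

Definition dquad m r (j : 'I_2) x : R := - (2 / r ^+ 2) * coord (x - m) j.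

Definition bump m r (k : nat) x : R := pospow k (quad m r x).

Lemma C1_quad m r : C1 (quad m r) (dquad m r).
Proof.
have h1 := C1D C1_fst (C1_cst (- m.1)); have h2 := C1D C1_snd (C1_cst (- m.2)).
have h := C1D (C1_cst 1) (C1M (C1D (C1M h1 h1) (C1M h2 h2)) (C1_cst (- r ^- 2))).
have -> : quad m r = fun x => 1 + ((x.1 - m.1) * (x.1 - m.1) + (x.2 - m.2) * (x.2 - m.2)) * - r ^- 2.
  by apply/funext => x; rewrite /quad /sqdist; ring.
apply: (C1_ext h) => j x; rewrite /dquad /coord.
by case: j => -[|[|//]] ij /=; ring.
Qed.

Lemma C1_dquad m r j : C1 (dquad m r j) (fun i _ => - (2 / r ^+ 2) * (i == j)%:R).
Proof.
have h1 := C1M (C1_cst (- (2 / r ^+ 2))) (C1D C1_fst (C1_cst (- m.1))).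
have h2 := C1M (C1_cst (- (2 / r ^+ 2))) (C1D C1_snd (C1_cst (- m.2))).
have [->|->] : j = 0 \/ j = 1.
  by case: j => -[|[|//]] ij; [left|right]; apply/val_inj.
- by apply: (C1_ext h1) => i x; ring.
- by apply: (C1_ext h2) => i x; ring.
Qed.

Lemma C1_bump m r k : C1 (bump m r k.+2)
  (fun j x => k.+2%:R * bump m r k.+1 x * dquad m r j x).
Proof.
apply: (@C1_comp R (pospow k.+2) (fun y => k.+2%:R * pospow k.+1 y)) (C1_quad m r).
  by move=> y; apply: cvgM; [exact: cvg_cst|exact: continuous_pospow].
by move=> y; exact: is_derive_pospow.
Qed.

Lemma quad_le1 m r x : quad m r x <= 1.
Proof. by rewrite /quad gerBl divr_ge0 ?sqr_ge0// addr_ge0 ?sqr_ge0. Qed.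

Lemma bump_ge0 m r k x : 0 <= bump m r k x.
Proof. exact: pospow_ge0. Qed.

Lemma bump_le1 m r k x : bump m r k x <= 1.
Proof.
rewrite exprn_ile1// ?le_max ?lexx ?orbT// ge_max ler01 andbT.
exact: quad_le1.
Qed.

Lemma bump_out m r k x : quad m r x <= 0 -> bump m r k.+1 x = 0.
Proof. exact: pospow_neg. Qed.

(** The open disc, written as the set where [quad] is positive, so that bumps and their derivatives
    vanish off it by [pospow_neg]. *)
Definition odisc m r : set (plane_m R) := [set x | 0 < quad m r x].

Lemma odiscP m r x : 0 < r -> odisc m r x <-> sqdist x m < r ^+ 2.
Proof.
move=> r0; rewrite /odisc /= /quad subr_gt0 ltr_pdivrMr ?exprn_gt0// mul1r.
by [].
Qed.

Lemma odisc_bound m r x : 0 < r -> odisc m r x -> `|x.1 - m.1| <= r /\ `|x.2 - m.2| <= r.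
Proof.
move=> r0 /(odiscP _ _ r0); rewrite /sqdist => h.
have h1 := sqr_ge0 (x.1 - m.1); have h2 := sqr_ge0 (x.2 - m.2).
by split; rewrite normr_le_sqr ?(ltW r0)//; lra.
Qed.

Lemma open_odisc m r : open (odisc m r : set (R * R)).
Proof.
have [c _ _] := C1_quad m r.
exact: (proj1 (continuousP _) c [set y : R | 0 < y] (@open_gt R 0)).
Qed.

Lemma measurable_odisc m r : measurable (odisc m r).
Proof. exact: (open_measurable2 (@open_odisc m r)). Qed.

Lemma odisc_leb2 m r : 0 < r -> (mu (odisc m r) <= (4 * r ^+ 2)%:E)%E.
Proof.
move=> r0; apply: (@leb2_sub_box _ _ m); [exact: measurable_odisc|exact: ltW|].
by move=> x /(odisc_bound r0) h; apply/boxP.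
Qed.

Lemma quad_out_box m r x : 0 < r ->
  ~ box 0 (`|m.1| + `|m.2| + r) x -> quad m r x < 0.
Proof.
move=> r0 nb; rewrite /quad subr_lt0 ltr_pdivlMr ?exprn_gt0// mul1r /sqdist.
have h1 := sqr_ge0 (x.1 - m.1); have h2 := sqr_ge0 (x.2 - m.2).
rewrite ltNge; apply/negP => h; apply: nb; apply/box0P.
have k1 : `|x.1 - m.1| <= r.
  by rewrite normr_le_sqr ?(ltW r0)//; lra.
have k2 : `|x.2 - m.2| <= r.
  by rewrite normr_le_sqr ?(ltW r0)//; lra.
have := ler_normD (x.1 - m.1) m.1; have := ler_normD (x.2 - m.2) m.2.
rewrite !subrK; have := normr_ge0 m.1; have := normr_ge0 m.2; split; lra.
Qed.

Lemma dquad_bound m r x j : 0 < r -> odisc m r x -> dquad m r j x ^+ 2 <= 4 / r ^+ 2.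
Proof.
move=> r0 /(odiscP _ _ r0); rewrite /sqdist => h.
have h1 := sqr_ge0 (x.1 - m.1); have h2 := sqr_ge0 (x.2 - m.2).
have hc : coord (x - m) j ^+ 2 <= r ^+ 2 by rewrite /coord; case: ifP => _ /=; lra.
rewrite /dquad exprMn sqrrN expr_div_n.
have -> : 4 / r ^+ 2 = 2 ^+ 2 / r ^+ 2 ^+ 2 * r ^+ 2 :> R by field; rewrite gt_eqF.
by apply: ler_wpM2l hc; apply: divr_ge0; exact: sqr_ge0.
Qed.

(** Comparable to the mean square of the affine function [c + g . (x - m)] over the disc of radius
    [r] centred at [m]. *)
Definition size2 c g r : R := c ^+ 2 + r ^+ 2 * (g.1 ^+ 2 + g.2 ^+ 2).

Lemma size2_ge0 c g r : 0 <= size2 c g r.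
Proof. by apply: addr_ge0; rewrite ?sqr_ge0//; apply: mulr_ge0; rewrite ?sqr_ge0// addr_ge0// sqr_ge0. Qed.

Lemma affine_bound c g m r x : 0 < r -> `|x.1 - m.1| <= r -> `|x.2 - m.2| <= r ->
  affine c g m x ^+ 2 <= 3 * size2 c g r.
Proof.
move=> r0 k1 k2; rewrite /affine /size2.
have h1 : (x.1 - m.1) ^+ 2 <= r ^+ 2.
  by rewrite -normr_le_sqr// ltW.
have h2 : (x.2 - m.2) ^+ 2 <= r ^+ 2.
  by rewrite -normr_le_sqr// ltW.
set X := x.1 - m.1 in h1 *; set Y := x.2 - m.2 in h2 *.
have e1 : g.1 ^+ 2 * X ^+ 2 <= g.1 ^+ 2 * r ^+ 2 by rewrite ler_wpM2l ?sqr_ge0.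
have e2 : g.2 ^+ 2 * Y ^+ 2 <= g.2 ^+ 2 * r ^+ 2 by rewrite ler_wpM2l ?sqr_ge0.
have := sqr_ge0 (c - g.1 * X); have := sqr_ge0 (c - g.2 * Y).
have := sqr_ge0 (g.1 * X - g.2 * Y).
nra.
Qed.

(** An affine function times the cube of the radial profile. The exponent 3 leaves the gradient with
    factors of exponent at least 2, hence C1. *)
Definition wave m r c g x := bump m r 3 x * affine c g m x.
Definition dwave m r c g (j : 'I_2) x :=
  3 * bump m r 2 x * dquad m r j x * affine c g m x + bump m r 3 x * coord g j.
Definition ddwave m r c g (j i : 'I_2) x :=
  6 * bump m r 1 x * dquad m r i x * dquad m r j x * affine c g m x
  + 3 * bump m r 2 x * (- (2 / r ^+ 2) * (i == j)%:R) * affine c g m x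
  + 3 * bump m r 2 x * (dquad m r j x * coord g i + dquad m r i x * coord g j).

Lemma C1_wave m r c g : C1 (wave m r c g) (dwave m r c g).
Proof.
by apply: (C1_ext (C1M (C1_bump m r 1) (C1_affine c g m))) => j x.
Qed.

Lemma C1_dwave m r c g j : C1 (dwave m r c g j) (ddwave m r c g j).
Proof.
have h := C1D (C1M (C1M (C1M (C1_cst 3) (C1_bump m r 0)) (C1_dquad m r j)) (C1_affine c g m))
  (C1M (C1_bump m r 1) (C1_cst (coord g j))).
by apply: (C1_ext h) => i x; rewrite /ddwave; ring.
Qed.

Lemma ddwave_sym m r c g j i x : ddwave m r c g j i x = ddwave m r c g i j x.
Proof. by rewrite /ddwave (eq_sym i j); ring. Qed.

Lemma wave_out m r c g x : quad m r x <= 0 -> wave m r c g x = 0.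
Proof. by move=> h; rewrite /wave bump_out// mul0r. Qed.

Lemma dwave_out m r c g j x : quad m r x <= 0 -> dwave m r c g j x = 0.
Proof. by move=> h; rewrite /dwave !bump_out// mulr0 !mul0r addr0. Qed.

Lemma wave_bound m r c g x : 0 < r -> odisc m r x ->
  wave m r c g x ^+ 2 <= 3 * size2 c g r.
Proof.
move=> r0 Ux; have [h1 h2] := odisc_bound r0 Ux.
have := affine_bound c g r0 h1 h2; set A := affine _ _ _ _ => hA.
rewrite /wave exprMn; have b0 := bump_ge0 m r 3 x; have b1 := bump_le1 m r 3 x.
have b2 : bump m r 3 x ^+ 2 <= 1 by rewrite exprn_ile1.
rewrite -/A; apply: le_trans hA; rewrite -[leRHS]mul1r.
by apply: ler_wpM2r => //; exact: sqr_ge0.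
Qed.

(* Locked, because the conversion tests run by [//] unfold the numeral. *)
Definition dwave_cst : R := locked 218.

(** Lets the constants 12 and 48 of the terms without derivatives be absorbed into [dwave_cst] and
    [4 * dwave_cst]. *)
Lemma dwave_cst_ge12 : 12 <= dwave_cst.
Proof. by rewrite /dwave_cst -lock; lra. Qed.

Lemma dwave_cst_gt0 : 0 < dwave_cst.
Proof. exact: lt_le_trans dwave_cst_ge12. Qed.

(** The constant is [2 * (9 * 12 + 1)]: 12 is the product of 4 from [dquad_bound] and 3 from
    [affine_bound], 9 is the square of the exponent, and 2 comes from splitting the square of a
    sum. *)
Lemma dwave_bound m r c g j x : 0 < r -> odisc m r x ->
  dwave m r c g j x ^+ 2 <= dwave_cst * size2 c g r / r ^+ 2.
Proof.
rewrite /dwave_cst -lock => r0 Ux; have [h1 h2] := odisc_bound r0 Ux.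
have := affine_bound c g r0 h1 h2; rewrite /dwave; set A := affine _ _ _ _ => hA.
have r2 : 0 < r ^+ 2 by rewrite exprn_gt0.
have hq : dquad m r j x ^+ 2 * r ^+ 2 <= 4.
  by rewrite -ler_pdivlMr//; exact: dquad_bound.
rewrite ler_pdivlMr//; set S := size2 c g r in hA *.
have hg : r ^+ 2 * coord g j ^+ 2 <= S.
  rewrite /S /size2 /coord; case: ifP => _.
    by have := sqr_ge0 c; have := mulr_ge0 (ltW r2) (sqr_ge0 g.2); nra.
  by have := sqr_ge0 c; have := mulr_ge0 (ltW r2) (sqr_ge0 g.1); nra.
have b2 : bump m r 2 x ^+ 2 <= 1 by rewrite exprn_ile1 ?bump_ge0 ?bump_le1.
have b3 : bump m r 3 x ^+ 2 <= 1 by rewrite exprn_ile1 ?bump_ge0 ?bump_le1.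
set B2 := bump m r 2 x in b2 *; set B3 := bump m r 3 x in b3 *.
set q := dquad m r j x in hq *; set gj := coord g j in hg *.
have S0 : 0 <= S by exact: size2_ge0.
have qr0 : 0 <= q ^+ 2 * r ^+ 2 by apply: mulr_ge0; exact: sqr_ge0.
have A0 := sqr_ge0 A; have B20 := sqr_ge0 B2; have B30 := sqr_ge0 B3.
have k1 : (q ^+ 2 * r ^+ 2) * A ^+ 2 <= 4 * (3 * S) by apply: ler_pM.
have k2 : B2 ^+ 2 * ((q ^+ 2 * r ^+ 2) * A ^+ 2) <= 1 * (4 * (3 * S)).
  by apply: ler_pM => //; apply: mulr_ge0.
have k3 : B3 ^+ 2 * (r ^+ 2 * gj ^+ 2) <= 1 * S.
  by apply: ler_pM => //; apply: mulr_ge0 (sqr_ge0 _) (sqr_ge0 _).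
have : (3 * B2 * q * A + B3 * gj) ^+ 2 <= 2 * (9 * (B2 ^+ 2 * (q ^+ 2 * A ^+ 2)) + B3 ^+ 2 * gj ^+ 2).
  have := sqr_ge0 (3 * B2 * q * A - B3 * gj); nra.
move=> /(ler_wpM2r (ltW r2)) h; apply: (le_trans h); nra.
Qed.

End Bump.

(** * Squares on which affine functions are large *)

Section LowerBounds.
Context {R : realType}.
Implicit Types (x m n p g : R * R) (c r : R).

Lemma exists_sign (a : R) : exists2 e : R, e ^+ 2 = 1 & 0 <= e * a.
Proof.
have [a0|a0] := leP 0 a; first by exists 1; rewrite ?expr1n// mul1r.
by exists (- 1); rewrite ?sqrrN ?expr1n// mulN1r oppr_ge0 ltW.
Qed.

(* In a suitable quadrant the three terms of the affine function have the same
   sign, hence its square dominates the sum of their squares. *)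
Lemma affine_lower_box c g m r : 0 < r -> exists p, forall x, box p (r / 8) x ->
  2^-1 <= quad m r x /\ size2 c g r / 16 <= affine c g m x ^+ 2.
Proof.
move=> r0; have [s s1 sc] := exists_sign c.
have [e1 e11 eg1] := exists_sign (s * g.1).
have [e2 e21 eg2] := exists_sign (s * g.2).
(* On the square of half-side [r / 8] around this point both signed offsets from [m] lie between
   [r / 4] and [r / 2], so the squared distance to [m] is at most [r^2 / 2]. *)
exists (m.1 + 3 * r / 8 * e1, m.2 + 3 * r / 8 * e2) => x /boxP[/= h1 h2].
pose X := e1 * (x.1 - m.1); pose Y := e2 * (x.2 - m.2).
have bnd (e a b : R) : e ^+ 2 = 1 -> `|a - (b + 3 * r / 8 * e)| <= r / 8 ->
    r / 4 <= e * (a - b) <= r / 2.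
  move=> ee h.
  have : `|e * (a - (b + 3 * r / 8 * e))| <= r / 8.
    rewrite normrM (_ : `|e| = 1) ?mul1r//; apply/eqP.
    by rewrite -(@eqrXn2 _ 2)// expr1n real_normK ?num_real// ee.
  have -> : e * (a - (b + 3 * r / 8 * e)) = e * (a - b) - 3 * r / 8 * e ^+ 2 by ring.
  by rewrite ee ler_norml => /andP[k1 k2]; apply/andP; split; lra.
have /andP[X1 X2] : r / 4 <= X <= r / 2 by exact: bnd.
have /andP[Y1 Y2] : r / 4 <= Y <= r / 2 by exact: bnd.
have XX : (x.1 - m.1) ^+ 2 = X ^+ 2 by rewrite /X exprMn e11 mul1r.
have YY : (x.2 - m.2) ^+ 2 = Y ^+ 2 by rewrite /Y exprMn e21 mul1r.
have r2 : 0 < r ^+ 2 by rewrite exprn_gt0.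
split.
  rewrite /quad /sqdist XX YY lerBrDr -lerBrDl ler_pdivrMr//; nra.
pose a := s * c; pose a1 := e1 * (s * g.1); pose a2 := e2 * (s * g.2).
have sqa : a ^+ 2 = c ^+ 2 by rewrite /a exprMn s1 mul1r.
have sqa1 : a1 ^+ 2 = g.1 ^+ 2 by rewrite /a1 !exprMn e11 s1 !mul1r.
have sqa2 : a2 ^+ 2 = g.2 ^+ 2 by rewrite /a2 !exprMn e21 s1 !mul1r.
have -> : affine c g m x ^+ 2 = (a + a1 * X + a2 * Y) ^+ 2.
  have -> : a + a1 * X + a2 * Y = s * (c + e1 ^+ 2 * g.1 * (x.1 - m.1) + e2 ^+ 2 * g.2 * (x.2 - m.2)).
    by rewrite /a /a1 /a2 /X /Y; ring.
  by rewrite exprMn s1 mul1r e11 e21 !mul1r.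
rewrite /size2 -sqa -sqa1 -sqa2.
have a0 : 0 <= a by []. have a10 : 0 <= a1 by []. have a20 : 0 <= a2 by [].
have q1 : a1 * (r / 4) <= a1 * X by rewrite ler_wpM2l.
have q2 : a2 * (r / 4) <= a2 * Y by rewrite ler_wpM2l.
have b1 : 0 <= a1 * (r / 4) by rewrite mulr_ge0// divr_ge0// ltW.
have b2 : 0 <= a2 * (r / 4) by rewrite mulr_ge0// divr_ge0// ltW.
(* The cross terms are nonnegative, so this square is at least [a^2 + (r/4)^2 (a1^2 + a2^2)]; hence
   the factor 1/16. *)
apply: (@le_trans _ _ ((a + a1 * (r / 4) + a2 * (r / 4)) ^+ 2)); last first.
  by rewrite ler_pXn2r// ?nnegrE; lra.
have := mulr_ge0 a0 b1; have := mulr_ge0 a0 b2; have := mulr_ge0 b1 b2.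
have := sqr_ge0 a; nra.
Qed.

(** The gradient [g] is tangential, so in the frame of [n] and its rotation the function depends on
    the tangential coordinate alone. The sign of that coordinate can be chosen to suit [j0] and
    [j1], while the normal one is kept positive. *)
Lemma affine_lower_box_half (j0 j1 : R) n m r : 0 < r -> n.1 ^+ 2 + n.2 ^+ 2 = 1 ->
  let g := (j1 * - n.2, j1 * n.1) in
  exists p, forall x, box p (r / 16) x ->
  [/\ 2^-1 <= quad m r x, r / 4 <= affine 0 n m x
    & size2 j0 g r / 16 <= affine j0 g m x ^+ 2].
Proof.
move=> r0 n1 g; have [s s1 sj] := exists_sign (j0 * j1).
(* Offset [3 r / 8] in both directions of the frame; half-side [r / 16] moves either coordinate by
   at most [r / 8], which again gives the range from [r / 4] to [r / 2]. *)
exists (m.1 + 3 * r / 8 * (s * - n.2 + n.1), m.2 + 3 * r / 8 * (s * n.1 + n.2)).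
move=> x /boxP[/= h1 h2].
set d1 := x.1 - _ in h1; set d2 := x.2 - _ in h2.
have n11 : `|n.1| <= 1 by rewrite normr_le_sqr// expr1n; have := sqr_ge0 n.2; lra.
have n21 : `|n.2| <= 1 by rewrite normr_le_sqr// expr1n; have := sqr_ge0 n.1; lra.
have bnd (a b : R) : `|a| <= 1 -> `|b| <= 1 -> `|a * d1 + b * d2| <= r / 8.
  move=> ha hb; apply: (le_trans (ler_normD _ _)); rewrite !normrM.
  have : `|a| * `|d1| <= 1 * (r / 16) by rewrite ler_pM.
  have : `|b| * `|d2| <= 1 * (r / 16) by rewrite ler_pM.
  lra.
pose l := n.1 * (x.1 - m.1) + n.2 * (x.2 - m.2).
pose t := - n.2 * (x.1 - m.1) + n.1 * (x.2 - m.2).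
have lE : l = 3 * r / 8 + (n.1 * d1 + n.2 * d2).
  have -> : 3 * r / 8 = 3 * r / 8 * (n.1 ^+ 2 + n.2 ^+ 2) by rewrite n1 mulr1.
  rewrite /l /d1 /d2; ring.
have tE : s * t = 3 * r / 8 + s * (- n.2 * d1 + n.1 * d2).
  have -> : 3 * r / 8 = 3 * r / 8 * (s ^+ 2 * (n.1 ^+ 2 + n.2 ^+ 2)) by rewrite n1 s1 !mulr1.
  rewrite /t /d1 /d2; ring.
have s_1 : `|s| = 1.
  by apply/eqP; rewrite -(@eqrXn2 _ 2)// expr1n real_normK ?num_real// s1.
have := bnd n.1 n.2 n11 n21; rewrite ler_norml => /andP[l1 l2].
have := bnd (- n.2) n.1; rewrite normrN => /(_ n21 n11) tb.
have : `|s * (- n.2 * d1 + n.1 * d2)| <= r / 8 by rewrite normrM s_1 mul1r.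
rewrite ler_norml => /andP[t1 t2].
have r2 : 0 < r ^+ 2 by rewrite exprn_gt0.
have tt : t ^+ 2 = (s * t) ^+ 2 by rewrite exprMn s1 mul1r.
have st1 : r / 4 <= s * t by lra.
have st2 : s * t <= r / 2 by lra.
split.
- rewrite /quad lerBrDr -lerBrDl ler_pdivrMr//.
  have -> : sqdist x m = l ^+ 2 + t ^+ 2.
    transitivity (sqdist x m * (n.1 ^+ 2 + n.2 ^+ 2)); first by rewrite n1 mulr1.
    rewrite /sqdist /l /t; ring.
  rewrite tt; nra.
- rewrite /affine add0r -/l; lra.
- have -> : affine j0 g m x = j0 + j1 * t by rewrite /affine /g /t /=; ring.
  have -> : size2 j0 g r = j0 ^+ 2 + r ^+ 2 * j1 ^+ 2.
    by rewrite /size2 /g /= !exprMn sqrrN -mulrDr [n.2 ^+ 2 + _]addrC n1 mulr1.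
  have c0 : 0 <= j0 * j1 * t.
    have -> : j0 * j1 * t = (s * (j0 * j1)) * (s * t) by rewrite mulrACA -expr2 s1 mul1r.
    by apply: mulr_ge0 => //; apply: le_trans st1; rewrite divr_ge0// ltW.
  have k : r ^+ 2 / 16 * j1 ^+ 2 <= (s * t) ^+ 2 * j1 ^+ 2.
    apply: ler_wpM2r; first exact: sqr_ge0.
    have -> : r ^+ 2 / 16 = (r / 4) ^+ 2 by field.
    by rewrite ler_pXn2r// ?nnegrE; lra.
  rewrite -tt in k; have := sqr_ge0 j0; nra.
Qed.

End LowerBounds.

(** * Residuals on discs and half discs *)

Section ScalarCurl.
Context {R : realType}.
Implicit Types (Omega : set (plane R)) (phi : plane R -> R) (x m n : R * R).
Local Notation mu := (mu2 R).

(** One row of [weak_curl], which acts on the rows separately. *)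
Definition scalar_curl Omega (t : 'I_2 -> plane R -> R) (c : plane R -> R) :=
  forall phi, test_function Omega phi ->
    \int[@leb2 R]_(x in Omega) (c x * phi x)
    = - \int[@leb2 R]_(x in Omega)
          (t 1 x * partial 0 phi x - t 0 x * partial 1 phi x).

Lemma test_function_C1 Omega phi : test_function Omega phi ->
  C1 phi (fun j => partial j phi).
Proof.
move=> [s _]; split.
- by have [] := s [::].
- by move=> j; have [] := s [:: j].
- by move=> j x; apply: derivableP; have [_] := s [::]; apply.
Qed.

Lemma test_function_out Omega phi : test_function Omega phi ->
  exists K : set (R * R), [/\ compact K, K `<=` Omega
    & forall x, ~ K x -> phi x = 0 /\ forall j, partial j phi x = 0].
Proof.
move=> hphi; have [_ _ dphi] := test_function_C1 hphi.
have [_ [K [cK KO K0]]] := hphi; exists K; split => // x nK; split; first exact: K0.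
move=> j; have h0 : is_derive x (evec j : R * R) phi 0.
  apply: (@near_eq_is_derive R (R * R)%type R (fun=> 0)).
  have clK : closed K by apply: compact_closed => //; exact: norm_hausdorff.
  near=> y; rewrite K0//; near: y; apply: open_nbhs_nbhs; split => //.
  exact: closed_openC.
by rewrite -(@derive_val _ _ _ _ _ _ _ (dphi j x)) (@derive_val _ _ _ _ _ _ _ h0).
Unshelve. all: by end_near. Qed.

(** The field need not vanish near the boundary of [Omega], because [phi] does: all integrals extend
    to the plane and [integral_C1_supp] applies to [t i * phi]. *)
Lemma scalar_curl_C1 Omega (N : R) t dt : (forall i, C1 (t i) (dt i)) ->
  (forall i x, ~ box 0 N x -> t i x = 0) ->
  scalar_curl Omega t (fun x => dt 1 0 x - dt 0 1 x).
Proof.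
move=> Ct t0 phi hphi; have Cphi := test_function_C1 hphi.
have [K [_ KO K0]] := test_function_out hphi.
have out x : ~ Omega x -> phi x = 0 /\ forall j, partial j phi x = 0.
  by move=> nO; apply: K0 => /KO.
have Cp i := C1M (Ct i) Cphi.
have p0 i x : ~ box 0 N x -> t i x * phi x = 0 by move=> /(t0 i) ->; rewrite mul0r.
have h i j := integral_C1_supp (Cp i) (p0 i) j.
have hi i j : integrableR mu setT (fun x => dt i j x * phi x + t i x * partial j phi x).
  have [_ c _] := Cp i.
  exact: (integrable_continuous_supp (c j) (C1_supp (Cp i) (p0 i) j)).
have hj i j : integrableR mu setT (fun x => t i x * partial j phi x).
  have [ct _ _] := Ct i; have [_ cphi _] := Cphi.
  apply: (@integrable_continuous_supp _ N).
    by move=> x; apply: (@continuousM _ _ (t i) (partial j phi)); [exact: ct|exact: cphi].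
  by move=> x /(t0 i) ->; rewrite mul0r.
have E1 : \int[mu]_(x in Omega) ((dt 1 0 x - dt 0 1 x) * phi x)
        = \int[mu]_x ((dt 1 0 x * phi x + t 1 x * partial 0 phi x)
                      - (dt 0 1 x * phi x + t 0 x * partial 1 phi x)
                      - (t 1 x * partial 0 phi x - t 0 x * partial 1 phi x)).
  rewrite -(@Rintegral0_out _ _ _ mu Omega [set: plane_m R])//; last first.
    by move=> x _ /out[-> p]; rewrite mulr0.
  by apply: eq_Rintegral => x _; ring.
have E2 : \int[mu]_(x in Omega) (t 1 x * partial 0 phi x - t 0 x * partial 1 phi x)
        = \int[mu]_x (t 1 x * partial 0 phi x - t 0 x * partial 1 phi x).
  rewrite -(@Rintegral0_out _ _ _ mu Omega [set: plane_m R])//.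
  by move=> x _ /out[_ p]; rewrite !p !mulr0 subr0.
rewrite [LHS]E1 [X in - X]E2 RintegralB//; last 2 first.
- exact: integrableRB.
- exact: integrableRB.
rewrite RintegralB; [|by []|exact: hi|exact: hi].
rewrite [X in X - _ - _](h 1 0) [X in _ - X - _](h 0 1).
by rewrite subr0 sub0r.
Qed.

(* A discontinuity of the field across the line is harmless as long as the line
   does not meet [Omega] inside the support. *)
Lemma scalar_curl_half_plane Omega m r c g n : 0 < r ->
  (forall x, Omega x -> 0 <= quad m r x -> affine 0 n m x != 0) ->
  scalar_curl Omega
    (fun j x => if 0 < affine 0 n m x then dwave m r c g j x else 0) (fun=> 0).
Proof.
move=> r0 hO phi hphi; have Cphi := test_function_C1 hphi.
have [cphi cdphi _] := Cphi.
have [K [cK KO K0]] := test_function_out hphi.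
set N := `|m.1| + `|m.2| + r.
have w0 j x : ~ box 0 N x -> dwave m r c g j x = 0.
  by move=> /(quad_out_box r0)/ltW; exact: dwave_out.
(* The rotated gradient of the wave times [phi]; the subtraction [1 - i] swaps the two indices. By
   symmetry of second derivatives its divergence contains only first derivatives of the wave and of
   [phi]. *)
pose V (i : 'I_2) x := (if i == 0 then 1 else -1) * (dwave m r c g (1 - i) x * phi x).
have CV i : C1 (V i) _ := C1M (C1_cst _) (C1M (C1_dwave m r c g (1 - i)) Cphi).
have V0 i x : ~ box 0 N x -> V i x = 0.
  by move=> nb; rewrite /V w0// mul0r mulr0.
pose l := affine 0 n m; pose E x := n.1 * V 0 x + n.2 * V 1 x.
have E0 x : ~ (K x /\ 0 <= quad m r x) -> E x = 0.
  move=> nKq; have [Kx|nK] := pselect (K x); last first.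
    by rewrite /E /V !(K0 _ nK).1 !mulr0 addr0.
  rewrite /E /V !(@dwave_out _ m r c g) ?mul0r ?mulr0 ?addr0//;
    by have [//|q] := ltP (quad m r x) 0; [exact: ltW | case: nKq].
have [B B0 hB] : exists2 B : R, 0 <= B & forall x, `|E x| <= B.
  apply: (@continuous_supp_bounded _ N).
    move=> x; apply: (@continuousD _ _ _ (fun x => n.1 * V 0 x) (fun x => n.2 * V 1 x)).
    - by apply: cvgM; [exact: cvg_cst|have [cc _ _] := CV 0; exact: cc].
    - by apply: cvgM; [exact: cvg_cst|have [cc _ _] := CV 1; exact: cc].
  by move=> x nb; rewrite /E !V0// !mulr0 addr0.
pose S := K `&` [set x | 0 <= quad m r x].
have cS : compact S.
  apply: compact_closedI => //.
  have [cq _ _] := C1_quad m r.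
  exact: (proj1 (continuous_closedP _) cq [set y : R | 0 <= y] (@closed_ge R 0)).
(* On this compact set the distance to the line has a positive minimum, so the normal component,
   bounded and zero elsewhere, is at most a multiple of that distance. *)
have [d d0 hd] : exists2 d : R, 0 < d & forall x, S x -> d <= `|l x|.
  have cl : continuous (fun x => `|l x|).
    move=> x; apply: (@continuous_comp _ _ _ l (fun y : R => `|y|)).
      exact: continuous_affine.
    exact: norm_continuous.
  have := compact_closed (@Rhausdorff R) (continuous_compact (continuous_subspaceT cl) cS).
  move=> /closed_openC oS.
  have : (~` ((fun x => `|l x|) @` S)) 0.
    move=> [x [Kx qx] /eqP]; rewrite normr_eq0; apply/negP.
    by apply: hO => //; exact: KO.
  move=> z; have /nbhs_ballP[d /= d0 bd] := open_nbhs_nbhs (conj oS z).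
  exists d => // x Sx; rewrite leNgt; apply/negP => lxd.
  apply: (bd `|l x|); last by exists x.
  by rewrite /ball /= sub0r normrN normr_id.
have En x : `|n.1 * V 0 x + n.2 * V 1 x| <= (B / d) * `|affine 0 n m x|.
  rewrite -/(E x) -/l; have [Sx|nS] := pselect (S x).
    apply: (le_trans (hB x)); rewrite mulrAC ler_pdivlMr// ler_wpM2l//; exact: hd.
  by rewrite E0// normr0 mulr_ge0// divr_ge0// ltW.
have h := integral_half_plane CV V0 En.
rewrite [LHS](@Rintegral0 _ _ _ mu); last by move=> x _; rewrite mul0r.
apply/esym/eqP; rewrite oppr_eq0; apply/eqP; rewrite -[RHS]h.
transitivity (\int[mu]_x ((if 0 < l x then dwave m r c g 1 x else 0) * partial 0 phi x
   - (if 0 < l x then dwave m r c g 0 x else 0) * partial 1 phi x)).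
  rewrite -(@Rintegral0_out _ _ _ mu Omega [set: plane_m R])//.
  move=> x _ nO; have [_ p] : phi x = 0 /\ forall j, partial j phi x = 0.
    by apply: K0 => /KO.
  by rewrite !p !mulr0 subr0.
rewrite [RHS]Rintegral_mkcond; apply: eq_Rintegral => x _; rewrite /patch.
case: ifPn => lx; last first.
  by rewrite memNset ?mul0r ?mul0r ?subr0//; exact/negP.
rewrite mem_set//= !mul0r !add0r.
rewrite (_ : 1 - 0 = 1 :> 'I_2); last exact/val_inj.
rewrite (_ : 1 - 1 = 0 :> 'I_2); last exact/val_inj.
rewrite (ddwave_sym m r c g 1 0) mul1r mulN1r; ring.
Qed.

End ScalarCurl.

(** * Integrals of waves against affine functions *)

Section LocalHelpers.
Context {R : realType}.
Implicit Types (x m n p g : R * R) (c r N : R) (D E : set (plane_m R)) (f : R * R -> R).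
Local Notation mu := (mu2 R).

Lemma integrable_continuous_suppS N D f : measurable D -> continuous f ->
  (forall x, ~ box 0 N x -> f x = 0) -> integrableR mu D f.
Proof.
move=> mD cf f0.
exact: (integrableRS mD measurableT (@subsetT _ D) (integrable_continuous_supp cf f0)).
Qed.

Lemma square_integrable_continuous_supp N D f : measurable D -> (mu D < +oo)%E ->
  continuous f -> (forall x, ~ box 0 N x -> f x = 0) -> square_integrable mu D f.
Proof.
move=> mD Doo cf f0; have [K K0 hK] := continuous_supp_bounded cf f0.
apply: (@square_integrable_bounded _ _ _ mu _ _ K) => //.
exact: (measurable_funTS (continuous_measurable2 cf)).
Qed.

Lemma Cauchy_Schwarz_bounded2 D (f h : plane_m R -> R) (K2 A : R) : measurable D ->
  square_integrable mu D f -> measurable_fun D h ->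
  (forall x, D x -> h x ^+ 2 <= K2) -> 0 <= K2 -> (mu D <= A%:E)%E ->
  (\int[mu]_(x in D) (f x * h x)) ^+ 2 <= K2 * A * \int[mu]_(x in D) f x ^+ 2.
Proof.
move=> mD hf mh hK K20 hA.
rewrite -(sqr_sqrtr K20); apply: Cauchy_Schwarz_bounded => // x Dx.
by rewrite normr_le_sqr ?sqrtr_ge0// sqr_sqrtr//; exact: hK.
Qed.

Lemma square_integrable_affine m r c g D : 0 < r -> measurable D -> D `<=` odisc m r ->
  square_integrable mu D (affine c g m).
Proof.
move=> r0 mD DU; have DA : (mu D <= (4 * r ^+ 2)%:E)%E.
  apply: le_trans (odisc_leb2 m r0); apply: le_measure => //; rewrite inE//.
  exact: measurable_odisc.
apply: (@square_integrable_bounded _ _ _ mu _ _ (Num.sqrt (3 * size2 c g r))) => //.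
- exact: le_lt_trans DA (ltry _).
- exact: (measurable_funTS (continuous_measurable2 (@continuous_affine _ c g m))).
- move=> x /DU/(odisc_bound r0)[h1 h2].
  rewrite normr_le_sqr ?sqrtr_ge0// sqr_sqrtr; last by rewrite mulr_ge0// size2_ge0.
  exact: affine_bound.
Qed.

Lemma continuous_wave m r c g : continuous (wave m r c g).
Proof. by case: (C1_wave m r c g). Qed.

Lemma continuous_dwave m r c g j : continuous (dwave m r c g j).
Proof. by case: (C1_dwave m r c g j). Qed.

Lemma wave_out_box m r c g x : 0 < r ->
  ~ box 0 (`|m.1| + `|m.2| + r) x -> wave m r c g x = 0.
Proof. by move=> r0 /(quad_out_box r0)/ltW; exact: wave_out. Qed.

Lemma dwave_out_box m r c g j x : 0 < r ->
  ~ box 0 (`|m.1| + `|m.2| + r) x -> dwave m r c g j x = 0.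
Proof. by move=> r0 /(quad_out_box r0)/ltW; exact: dwave_out. Qed.

Lemma wave_odisc m r c g x : ~ odisc m r x -> wave m r c g x = 0.
Proof. by move=> /negP; rewrite -leNgt; exact: wave_out. Qed.

Lemma dwave_odisc m r c g j x : ~ odisc m r x -> dwave m r c g j x = 0.
Proof. by move=> /negP; rewrite -leNgt; exact: dwave_out. Qed.

Lemma measurable_wave m r c g D : measurable_fun D (wave m r c g).
Proof. exact: (measurable_funTS (continuous_measurable2 (@continuous_wave m r c g))). Qed.

Lemma measurable_dwave m r c g j D : measurable_fun D (dwave m r c g j).
Proof. exact: (measurable_funTS (continuous_measurable2 (@continuous_dwave m r c g j))). Qed.

Lemma integrableM_wave m r c g D f : 0 < r -> measurable D -> continuous f ->
  integrableR mu D (fun x => f x * wave m r c g x).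
Proof.
move=> r0 mD cf; apply: (@integrable_continuous_suppS (`|m.1| + `|m.2| + r)) => //.
  move=> x; apply: (@continuousM _ _ f (wave m r c g)); first exact: cf.
  exact: continuous_wave.
by move=> x nb; rewrite (wave_out_box c g r0 nb) mulr0.
Qed.

Lemma integrableM_dwave m r c g j D f : 0 < r -> measurable D -> continuous f ->
  integrableR mu D (fun x => f x * dwave m r c g j x).
Proof.
move=> r0 mD cf; apply: (@integrable_continuous_suppS (`|m.1| + `|m.2| + r)) => //.
  move=> x; apply: (@continuousM _ _ f (dwave m r c g j)); first exact: cf.
  exact: continuous_dwave.
by move=> x nb; rewrite (dwave_out_box c g j r0 nb) mulr0.
Qed.

Lemma integrable_wave m r c g D : 0 < r -> measurable D ->
  integrableR mu D (wave m r c g).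
Proof.
move=> r0 mD; apply: (@integrable_continuous_suppS (`|m.1| + `|m.2| + r)) => //.
  exact: continuous_wave.
by move=> x; exact: wave_out_box.
Qed.

Lemma integral_affine_wave m r c g c' g' j : 0 < r ->
  \int[mu]_(x in odisc m r) (affine c' g' m x * dwave m r c g j x)
  = - (coord g' j * \int[mu]_(x in odisc m r) wave m r c g x).
Proof.
move=> r0; have mU := measurable_odisc m r.
have C := C1M (C1_affine c' g' m) (C1_wave m r c g).
have s x : ~ box 0 (`|m.1| + `|m.2| + r) x -> affine c' g' m x * wave m r c g x = 0.
  by move=> /(wave_out_box c g r0) ->; rewrite mulr0.
have h := integral_C1_supp C s j.
move: h; rewrite [X in X = 0](@Rintegral0_out _ _ _ mu (odisc m r) [set: plane_m R])//; last first.
  move=> x _ nU; rewrite (wave_odisc _ _ nU) (dwave_odisc _ _ _ nU).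
  by rewrite !mulr0 addr0.
rewrite RintegralD//; last 2 first.
- by apply: integrableRZ => //; exact: integrable_wave.
- by apply: integrableM_dwave => //; exact: continuous_affine.
rewrite RintegralZl//; last exact: integrable_wave.
by move=> /eqP; rewrite addrC addr_eq0 => /eqP.
Qed.

Lemma integral_wave_lower : exists2 k : R, 0 < k &
  forall m r c g, 0 < r -> k * size2 c g r * r ^+ 2 <=
  \int[mu]_(x in odisc m r) (affine c g m x * wave m r c g x).
Proof.
(* On the square of [affine_lower_box] the affine function has square at least [size2 / 16], the
   cubed profile is at least [1 / 8], and the area is [4 (r / 8)^2]. *)
exists (16^-1 / 8 * (4 / 8 ^+ 2)).
  by rewrite mulr_gt0 ?divr_gt0 ?invr_gt0 ?exprn_gt0.
move=> m r c g r0; have [p hp] := affine_lower_box c g m r0.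
have r80 : 0 <= r / 8 by rewrite divr_ge0// ltW.
have mU := measurable_odisc m r.
have -> : 16^-1 / 8 * (4 / 8 ^+ 2) * size2 c g r * r ^+ 2
    = size2 c g r / 16 / 8 * (4 * (r / 8) ^+ 2) by field.
apply: (@Rintegral_lower_box _ _ _ p) => //.
- by apply: integrableM_wave => //; exact: continuous_affine.
- by move=> x _; rewrite /wave mulrCA -expr2 mulr_ge0 ?bump_ge0 ?sqr_ge0.
- by move=> x /hp[h _]; rewrite /odisc /=; apply: lt_le_trans h; rewrite invr_gt0.
- move=> x /hp[h1 h2]; rewrite /wave mulrCA -expr2 mulrC.
  apply: ler_pM => //; first by rewrite divr_ge0// size2_ge0.
  rewrite /bump pospow_pos; last by apply: le_trans h1; rewrite invr_ge0.
  rewrite (_ : 8^-1 = (2^-1) ^+ 3 :> R); last by field.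
  by rewrite ler_pXn2r// ?nnegrE//; apply: le_trans h1; rewrite invr_ge0.
Qed.

End LocalHelpers.

(** * The residual of the curl equation on a disc *)

Section InteriorEstimates.
Context {R : realType}.
Implicit Types (x m n p : R * R) (r : R) (Omega : set (plane_m R)).
Implicit Types (c : 'I_2 -> R) (g : 'I_2 -> R * R).
Local Notation mu := (mu2 R).

(* One row of [(mu^-1 *: rpart sigma, u)] in the first eigenvalue equation. *)
Definition weak_pair Omega (s : 'I_2 -> plane_m R -> R) (u : plane_m R -> R) :=
  [/\ forall j, square_integrable mu Omega (s j), square_integrable mu Omega u
    & forall t k, (forall j, square_integrable mu Omega (t j)) ->
        square_integrable mu Omega k -> scalar_curl Omega t k ->
        \int[mu]_(x in Omega) (s 0 x * t 0 x + s 1 x * t 1 x)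
        + \int[mu]_(x in Omega) (u x * k x) = 0].

Definition dist2 (D : set (plane_m R)) (s : 'I_2 -> plane_m R -> R) c g m : R :=
  \int[mu]_(x in D) (s 0 x - affine (c 0) (g 0) m x) ^+ 2
  + \int[mu]_(x in D) (s 1 x - affine (c 1) (g 1) m x) ^+ 2.

Lemma sqr_sum3_le (a b d : R) : (a + b + d) ^+ 2 <= 3 * (a ^+ 2 + b ^+ 2 + d ^+ 2).
Proof.
have := sqr_ge0 (a - b); have := sqr_ge0 (a - d); have := sqr_ge0 (b - d); nra.
Qed.

Lemma int_sq_ge0 (D : set (plane_m R)) (f : plane_m R -> R) :
  0 <= \int[mu]_(x in D) f x ^+ 2.
Proof. by apply: Rintegral_ge0 => x _; exact: sqr_ge0. Qed.

(** Cancels one factor [S] after Cauchy-Schwarz; the case [S = 0] is separate. *)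
Lemma sqr_le_linear (k S E : R) : 0 < k -> 0 <= S -> 0 <= E ->
  (k * S) ^+ 2 <= S * E -> S <= k ^- 2 * E.
Proof.
move=> k0 S0 E0; have k2 : 0 < k ^+ 2 by rewrite exprn_gt0.
have [->|Sn0] := eqVneq S 0; first by rewrite mulr_ge0// invr_ge0 ltW.
have Sp : 0 < S by rewrite lt_neqAle eq_sym Sn0.
rewrite exprMn [S ^+ 2]expr2 mulrCA ler_pM2l// => h.
by rewrite mulrC ler_pdivlMr// mulrC.
Qed.

(** The discrete [u_h] is a constant [a] here, so the residual is minus the affine row of [s_h]; it
    is tested with that row times the bump. The left side is comparable to the squared diameter
    times the squared norm of the row on a triangle of size [r]. *)
Lemma interior_residual : exists2 C : R, 0 < C &
  forall Omega s u m r c g (a : R),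
  measurable Omega -> (mu Omega < +oo)%E -> weak_pair Omega s u ->
  0 < r -> odisc m r `<=` Omega ->
  r ^+ 4 * (size2 (c 0) (g 0) r + size2 (c 1) (g 1) r)
  <= C * (r ^+ 2 * dist2 (odisc m r) s c g m
          + \int[mu]_(x in odisc m r) (u x - a) ^+ 2).
Proof.
have [k0 k00 lower] := @integral_wave_lower R.
have K0 : 0 < dwave_cst :> R := dwave_cst_gt0; have K00 := ltW K0.
exists (k0 ^- 2 * (3 * (8 * dwave_cst))).
  by rewrite !mulr_gt0// invr_gt0 exprn_gt0.
move=> Omega s u m r c g a mO Ooo [hs hu wf] r0 UO.
set U := odisc m r; have mU : measurable U := measurable_odisc m r.
have UA : (mu U <= (4 * r ^+ 2)%:E)%E := odisc_leb2 m r0.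
have Uoo : (mu U < +oo)%E by apply: le_lt_trans UA (ltry _).
pose q j := affine (c j) (g j) m; pose t j := wave m r (c j) (g j).
pose k x := dwave m r (c 1) (g 1) 0 x - dwave m r (c 0) (g 0) 1 x.
pose N := `|m.1| + `|m.2| + r.
have ck : continuous k.
  move=> x; apply: (@continuousB _ _ _ (dwave m r (c 1) (g 1) 0) (dwave m r (c 0) (g 0) 1));
  exact: continuous_dwave.
have kout x : ~ box 0 N x -> k x = 0.
  by move=> nb; rewrite /k !(dwave_out_box _ _ _ r0 nb) subr0.
have kU x : ~ U x -> k x = 0 by move=> nU; rewrite /k !(dwave_odisc _ _ _ nU) subr0.
have tU j x : ~ U x -> t j x = 0 by exact: wave_odisc.
have ht D j : measurable D -> (mu D < +oo)%E -> square_integrable mu D (t j).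
  move=> mD Doo; apply: (@square_integrable_continuous_supp _ N) => //.
    exact: continuous_wave.
  by move=> x; exact: wave_out_box.
have hk D : measurable D -> (mu D < +oo)%E -> square_integrable mu D k.
  by move=> mD Doo; apply: (@square_integrable_continuous_supp _ N).
have := wf t k (fun j => ht _ j mO Ooo) (hk _ mO Ooo).
have sc : scalar_curl Omega t k.
  apply: (@scalar_curl_C1 _ _ N t (fun j => dwave m r (c j) (g j))).
    by move=> j; exact: C1_wave.
  by move=> j x; exact: wave_out_box.
move=> /(_ sc).
rewrite (@Rintegral0_out _ _ _ mu U Omega)//; last first.
  by move=> x _ nU; rewrite !tU// !mulr0 addr0.
rewrite (@Rintegral0_out _ _ _ mu U Omega)//; last first.
  by move=> x _ nU; rewrite kU// mulr0.
have sU j : square_integrable mu U (s j) by apply: square_integrableS (hs j).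
have uU : square_integrable mu U u by apply: square_integrableS hu.
have qU j : square_integrable mu U (q j) by apply: (square_integrable_affine _ _ r0 mU); exact: subset_refl.
have sqU j : square_integrable mu U (fun x => s j x - q j x).
  exact: square_integrableB.
have aU : square_integrable mu U (fun=> a).
  by apply: (@square_integrable_bounded _ _ _ mu _ _ `|a|).
have uaU : square_integrable mu U (fun x => u x - a) by exact: square_integrableB.
have tUi j := ht U j mU Uoo.
have kUi := hk U mU Uoo.
(* A compactly supported curl has mean zero, so [u] may be replaced by [u - a]. *)
have k_0 : \int[mu]_(x in U) k x = 0.
  have dU j i := integrable_continuous_suppS mU (@continuous_dwave R m r (c j) (g j) i)
    (fun x => @dwave_out_box R m r (c j) (g j) i x r0).
  rewrite RintegralB//; [|exact: dU|exact: dU].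
  have h j i : \int[mu]_(x in U) dwave m r (c j) (g j) i x = 0.
    have := integral_C1_supp (C1_wave m r (c j) (g j))
      (fun x => @wave_out_box R m r (c j) (g j) x r0) i.
    rewrite [X in X = _](@Rintegral0_out _ _ _ mu U [set: plane_m R])//.
    by move=> x _; exact: dwave_odisc.
  by rewrite !h subr0.
pose I j := \int[mu]_(x in U) ((s j x - q j x) * t j x).
pose P j := \int[mu]_(x in U) (q j x * t j x).
pose Iu := \int[mu]_(x in U) ((u x - a) * k x).
have st j : \int[mu]_(x in U) (s j x * t j x) = I j + P j.
  rewrite -RintegralD//; [|exact: integrableRM|exact: integrableRM].
  by apply: eq_Rintegral => x _; ring.
have uk : \int[mu]_(x in U) (u x * k x) = Iu.
  have -> : Iu = Iu + a * \int[mu]_(x in U) k x by rewrite k_0 mulr0 addr0.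
  have hki : integrableR mu U k by exact: (integrable_continuous_suppS mU ck kout).
  rewrite -RintegralZl// -RintegralD//; [|exact: integrableRM|exact: integrableRZ].
  by apply: eq_Rintegral => x _; ring.
rewrite RintegralD//; [|exact: integrableRM|exact: integrableRM].
rewrite !st uk => wf0.
pose S := size2 (c 0) (g 0) r + size2 (c 1) (g 1) r.
have S0 : 0 <= size2 (c 0) (g 0) r := size2_ge0 _ _ _.
have S1 : 0 <= size2 (c 1) (g 1) r := size2_ge0 _ _ _.
have S00 : 0 <= S by exact: addr_ge0.
have r2 : 0 < r ^+ 2 by rewrite exprn_gt0.
have r20 := ltW r2; have k000 := ltW k00.
have PS j : k0 * size2 (c j) (g j) r * r ^+ 2 <= P j by exact: lower.
pose e j := \int[mu]_(x in U) (s j x - q j x) ^+ 2.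
pose eu := \int[mu]_(x in U) (u x - a) ^+ 2.
have IB j : I j ^+ 2 <= 3 * size2 (c j) (g j) r * (4 * r ^+ 2) * e j.
  apply: Cauchy_Schwarz_bounded2 => //; first by case: (tUi j).
  - by move=> x; exact: wave_bound.
  - by rewrite mulr_ge0// size2_ge0.
have IuB : Iu ^+ 2 <= 2 * (dwave_cst * S / r ^+ 2) * (4 * r ^+ 2) * eu.
  apply: Cauchy_Schwarz_bounded2 => //; first by case: kUi.
  - move=> x Ux; rewrite /k.
    have := dwave_bound (c 1) (g 1) 0 r0 Ux; have := dwave_bound (c 0) (g 0) 1 r0 Ux.
    set d0 := dwave _ _ _ _ _ _; set d1 := dwave _ _ _ _ _ _ => h0 h1.
    have -> : dwave_cst * S / r ^+ 2 = dwave_cst * size2 (c 0) (g 0) r / r ^+ 2 + dwave_cst * size2 (c 1) (g 1) r / r ^+ 2.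
      by rewrite /S; ring.
    have := sqr_ge0 (d0 + d1); nra.
  - apply: mulr_ge0 => //; apply: divr_ge0; last exact: ltW.
    exact: mulr_ge0.
have e0 j : 0 <= e j by exact: int_sq_ge0.
have eu0 : 0 <= eu by exact: int_sq_ge0.
have PP : P 0 + P 1 = - (I 0 + I 1 + Iu) by lra.
have P0 : (k0 * S * r ^+ 2) ^+ 2 <= 3 * (I 0 ^+ 2 + I 1 ^+ 2 + Iu ^+ 2).
  apply: (@le_trans _ _ ((P 0 + P 1) ^+ 2)); last by rewrite PP sqrrN sqr_sum3_le.
  have := PS 0; have := PS 1 => h1 h0.
  have l0 : 0 <= k0 * S * r ^+ 2 by apply: mulr_ge0 => //; exact: mulr_ge0.
  have l1 : k0 * S * r ^+ 2 <= P 0 + P 1 by rewrite /S mulrDr mulrDl; lra.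
  have l2 := le_trans l0 l1; by rewrite ler_pXn2r ?nnegrE.
have E0 : 0 <= r ^+ 2 * (e 0 + e 1) + eu by apply: addr_ge0 => //; apply: mulr_ge0 => //; exact: addr_ge0.
rewrite -/S /dist2 -/(e 0) -/(e 1) -/eu.
have -> : r ^+ 4 * S = (r ^+ 2) ^+ 2 * S by ring.
have key : (k0 * S) ^+ 2 <= S * (3 * (8 * dwave_cst) * (r ^+ 2 * (e 0 + e 1) + eu) / (r ^+ 2) ^+ 2).
  rewrite mulrA ler_pdivlMr ?exprn_gt0//.
  have -> : (k0 * S) ^+ 2 * (r ^+ 2) ^+ 2 = (k0 * S * r ^+ 2) ^+ 2 by ring.
  apply: (le_trans P0).
  have i0 : I 0 ^+ 2 <= 12 * S * (r ^+ 2 * e 0).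
    apply: (le_trans (IB 0)).
    rewrite (_ : 3 * _ * _ * _ = 12 * size2 (c 0) (g 0) r * (r ^+ 2 * e 0)); last by ring.
    by apply: ler_wpM2r; [exact: mulr_ge0|rewrite ler_pM2l// lerDl].
  have i1 : I 1 ^+ 2 <= 12 * S * (r ^+ 2 * e 1).
    apply: (le_trans (IB 1)).
    rewrite (_ : 3 * _ * _ * _ = 12 * size2 (c 1) (g 1) r * (r ^+ 2 * e 1)); last by ring.
    by apply: ler_wpM2r; [exact: mulr_ge0|rewrite ler_pM2l// lerDr].
  have iu : Iu ^+ 2 <= 8 * dwave_cst * S * eu.
    by apply: (le_trans IuB); rewrite le_eqVlt; apply/orP; left; apply/eqP; field; rewrite gt_eqF.
  have s0 : 0 <= S * (r ^+ 2 * e 0) by apply: mulr_ge0 => //; exact: mulr_ge0.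
  have s1 : 0 <= S * (r ^+ 2 * e 1) by apply: mulr_ge0 => //; exact: mulr_ge0.
  have := ler_wpM2r s0 (@dwave_cst_ge12 R); have := ler_wpM2r s1 (@dwave_cst_ge12 R).
  lra.
have := sqr_le_linear _ _ _ key.
have F0 : 0 <= 3 * (8 * dwave_cst) * (r ^+ 2 * (e 0 + e 1) + eu) / (r ^+ 2) ^+ 2.
  by apply: divr_ge0; [rewrite !mulr_ge0|exact: sqr_ge0].
move=> /(_ k00 S00 F0) h.
have := ler_wpM2l (exprn_ge0 2 (ltW r2)) h => {}h; apply: (le_trans h).
rewrite le_eqVlt; apply/orP; left; apply/eqP; field.
by rewrite !gt_eqF.
Qed.

End InteriorEstimates.

(** * The residual of the divergence on a disc *)

Section DivergenceEstimate.
Context {R : realType}.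
Implicit Types (x m n p : R * R) (r : R) (Omega : set (plane_m R)).
Implicit Types (c : 'I_2 -> R) (g : 'I_2 -> R * R).
Local Notation mu := (mu2 R).

(** Testing with the gradient of a bump gives curl zero, hence no term in [u]; integrating by parts
    against the affine row leaves its constant divergence times the integral of the bump. *)
Lemma interior_div : exists2 C : R, 0 < C &
  forall Omega s u m r c g,
  measurable Omega -> (mu Omega < +oo)%E -> weak_pair Omega s u ->
  0 < r -> odisc m r `<=` Omega ->
  r ^+ 4 * ((g 0).1 + (g 1).2) ^+ 2 <= C * dist2 (odisc m r) s c g m.
Proof.
have [k0 k00 lower] := @integral_wave_lower R.
have K0 : 0 < dwave_cst :> R := dwave_cst_gt0; have K00 := ltW K0.
exists (k0 ^- 2 * (3 * (4 * dwave_cst))).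
  by rewrite !mulr_gt0// invr_gt0 exprn_gt0.
move=> Omega s u m r c g mO Ooo [hs hu wf] r0 UO.
set U := odisc m r; have mU : measurable U := measurable_odisc m r.
have UA : (mu U <= (4 * r ^+ 2)%:E)%E := odisc_leb2 m r0.
have Uoo : (mu U < +oo)%E by apply: le_lt_trans UA (ltry _).
(* With value 1 and gradient zero the wave is the bump itself. *)
pose z : R * R := (0, 0).
pose q j := affine (c j) (g j) m; pose w := wave m r 1 z; pose t j := dwave m r 1 z j.
pose N := `|m.1| + `|m.2| + r.
have tU j x : ~ U x -> t j x = 0 by exact: dwave_odisc.
have ht D j : measurable D -> (mu D < +oo)%E -> square_integrable mu D (t j).
  move=> mD Doo; apply: (@square_integrable_continuous_supp _ N) => //.
    exact: continuous_dwave.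
  by move=> x; exact: dwave_out_box.
have sc : scalar_curl Omega t (fun=> 0).
  have := @scalar_curl_C1 _ Omega N t (fun j => ddwave m r 1 z j)
    (fun j => C1_dwave m r 1 z j) (fun j x => @dwave_out_box _ m r 1 z j x r0).
  by under eq_fun do rewrite ddwave_sym subrr.
have z0 : square_integrable mu Omega (fun=> 0).
  by apply: (@square_integrable_bounded _ _ _ mu _ _ 0) => // x _; rewrite normr0.
have := wf t _ (fun j => ht _ j mO Ooo) z0 sc.
rewrite (@Rintegral0_out _ _ _ mu U Omega)//; last first.
  by move=> x _ nU; rewrite !tU// !mulr0 addr0.
rewrite [X in _ + X]Rintegral0; last by move=> x _; rewrite mulr0.
rewrite addr0.
have sU j : square_integrable mu U (s j) by apply: square_integrableS (hs j).
have qU j : square_integrable mu U (q j) by apply: (square_integrable_affine _ _ r0 mU); exact: subset_refl.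
have sqU j : square_integrable mu U (fun x => s j x - q j x).
  exact: square_integrableB.
have tUi j := ht U j mU Uoo.
pose I j := \int[mu]_(x in U) ((s j x - q j x) * t j x).
pose P j := \int[mu]_(x in U) (q j x * t j x).
pose W := \int[mu]_(x in U) w x.
have st j : \int[mu]_(x in U) (s j x * t j x) = I j + P j.
  rewrite -RintegralD//; [|exact: integrableRM|exact: integrableRM].
  by apply: eq_Rintegral => x _; ring.
rewrite RintegralD//; [|exact: integrableRM|exact: integrableRM].
rewrite !st => wf0.
have r2 : 0 < r ^+ 2 by rewrite exprn_gt0.
pose d := (g 0).1 + (g 1).2.
have PW : P 0 + P 1 = - (d * W).
  by rewrite /P /t !integral_affine_wave// /coord /= -/w -/W /d; ring.
pose e j := \int[mu]_(x in U) (s j x - q j x) ^+ 2.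
have s1 : size2 1 z r = 1 by rewrite /size2 /= !expr0n addr0 mulr0 addr0 expr1n.
have IB j : I j ^+ 2 <= dwave_cst / r ^+ 2 * (4 * r ^+ 2) * e j.
  apply: Cauchy_Schwarz_bounded2 => //; first by case: (tUi j).
  - by move=> x Ux; have := dwave_bound 1 z j r0 Ux; rewrite s1 mulr1.
  - by rewrite divr_ge0// ltW.
have W0 : k0 * r ^+ 2 <= W.
  have := lower m r 1 z r0; rewrite s1 mulr1 => h; apply: (le_trans h).
  rewrite le_eqVlt; apply/orP; left; apply/eqP; apply: eq_Rintegral => x _.
  by rewrite /affine /= !mul0r !addr0 mul1r.
have e0 j : 0 <= e j by exact: int_sq_ge0.
have dW : d * W = I 0 + I 1 + 0 by lra.
have dW2 : (d * W) ^+ 2 <= 3 * (4 * dwave_cst * (e 0 + e 1)).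
  rewrite dW; apply: (le_trans (sqr_sum3_le _ _ _)).
  have i j : I j ^+ 2 <= 4 * dwave_cst * e j.
    by apply: (le_trans (IB j)); rewrite le_eqVlt; apply/orP; left; apply/eqP; field; rewrite gt_eqF.
  by have := i 0; have := i 1; lra.
rewrite -/d /dist2 -/(e 0) -/(e 1).
have k1 : d ^+ 2 * (k0 * r ^+ 2) ^+ 2 <= d ^+ 2 * W ^+ 2.
  apply: ler_wpM2l; first exact: sqr_ge0.
  have l0 : 0 <= k0 * r ^+ 2 by apply: mulr_ge0; exact: ltW.
  have l2 := le_trans l0 W0; by rewrite ler_pXn2r ?nnegrE.
have -> : r ^+ 4 * d ^+ 2 = k0 ^- 2 * (d ^+ 2 * (k0 * r ^+ 2) ^+ 2).
  by field; rewrite gt_eqF.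
rewrite -[leRHS]mulrA ler_pM2l ?invr_gt0 ?exprn_gt0//; apply: (le_trans k1); rewrite -exprMn.
by apply: (le_trans dW2); lra.
Qed.

End DivergenceEstimate.

(** * The jump functional on a half disc *)

Section EdgeEstimate.
Context {R : realType}.
Implicit Types (x m n p : R * R) (r : R).
Implicit Types (c : 'I_2 -> R) (g : 'I_2 -> R * R).
Local Notation mu := (mu2 R).

Definition half_disc m r n : set (plane_m R) :=
  odisc m r `&` [set x | 0 < affine 0 n m x].

Lemma measurable_half_disc m r n : measurable (half_disc m r n).
Proof.
by apply: measurableI; [exact: measurable_odisc|exact: measurable_affine_gt0].
Qed.

Lemma affine_opp n m x : affine 0 (- n) m x = - affine 0 n m x.
Proof. by rewrite /affine /=; ring. Qed.

Lemma Rintegral_half_discs m r n (f : plane_m R -> R) :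
  n.1 ^+ 2 + n.2 ^+ 2 = 1 -> integrableR mu (odisc m r) f ->
  \int[mu]_(x in odisc m r) f x
  = \int[mu]_(x in half_disc m r n) f x + \int[mu]_(x in half_disc m r (- n)) f x.
Proof.
move=> n1 hf; pose k := n.1 * m.1 + n.2 * m.2.
have mU := measurable_odisc m r.
have n0 : n != 0.
  by apply/eqP => n0; move: n1; rewrite n0 /= !expr0n addr0 => /eqP; rewrite eq_sym oner_eq0.
pose L : set (plane_m R) := [set x | n.1 * x.1 + n.2 * x.2 = k].
have lE x : affine 0 n m x = n.1 * x.1 + n.2 * x.2 - k by rewrite /affine /k; ring.
have mL : measurable L.
  have -> : L = affine 0 n m @^-1` [set 0 : R].
    apply/seteqP; split=> x /=; rewrite /L /= lE; first by move=> ->; rewrite subrr.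
    by move=> /eqP; rewrite subr_eq0 => /eqP.
  apply: closed_measurable2.
  by apply: (proj1 (continuous_closedP _) (@continuous_affine R 0 n m) [set 0 : R]); exact: closed_eq.
have mP := measurable_half_disc m r n; have mN := measurable_half_disc m r (- n).
rewrite (Rintegral_setD_null mU mL _ hf); last exact: leb2_line.
have -> : odisc m r `\` L = half_disc m r n `|` half_disc m r (- n).
  apply/seteqP; split=> [x [Ux nL]|x].
    have [l0|l0|l0] := ltrgtP 0 (affine 0 n m x); [by left|right|].
      by split => //=; rewrite affine_opp oppr_gt0.
    by exfalso; apply: nL; apply/eqP; rewrite -subr_eq0 -lE -l0.
  move=> [] [Ux] /=; rewrite ?affine_opp ?oppr_gt0 lE => l0; split=> // Lx;
    by move: l0; rewrite Lx subrr ltxx.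
apply: Rintegral_setU => //.
- apply: (integrableRS _ mU _ hf); first exact: measurableU.
  by move=> x [] [].
- apply/disj_setPS => x [[_ /= h1] [_ /=]]; rewrite affine_opp oppr_gt0 => h2.
  by have := lt_trans h1 h2; rewrite ltxx.
Qed.

Section Jump.
Variables (m n : R * R) (r j0 j1 : R).
Hypotheses (r0 : 0 < r) (n1 : n.1 ^+ 2 + n.2 ^+ 2 = 1).
Let g0 : R * R := (j1 * - n.2, j1 * n.1).
Let J := affine j0 g0 m.
Let w := wave m r j0 g0.
Let dw := dwave m r j0 g0.
Let H := half_disc m r n.
Let mH : measurable H := measurable_half_disc m r n.

(** For a unit [n] this is the line integral of [J w] over the diameter of the half disc: [J] is
    constant along [n], so the integrand is the derivative of [J w] along the inner normal, and [w]
    vanishes on the arc. *)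
Definition jump_form :=
  - (n.1 * \int[mu]_(x in H) (J x * dw 0 x) + n.2 * \int[mu]_(x in H) (J x * dw 1 x)).

Let cJ : continuous J.
Proof. exact: continuous_affine. Qed.

Let iJ j : integrableR mu H (fun x => J x * dw j x).
Proof. exact: integrableM_dwave. Qed.

(** Since [g0] is orthogonal to [n], only the profile contributes to the normal derivative of the
    wave. The resulting integrand is nonnegative on the half disc and can be bounded below on a
    square. *)
Lemma jump_formE : jump_form =
  \int[mu]_(x in H) (6 * bump m r 2 x * affine 0 n m x / r ^+ 2 * J x ^+ 2).
Proof.
have i1 i : integrableR mu H (fun x => coord n i * (J x * dw i x)).
  by apply: integrableRZ => //; exact: iJ.
have i2 : integrableR mu H (fun x => n.1 * (J x * dw 0 x) + n.2 * (J x * dw 1 x)).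
  exact: (integrableRD mH (i1 0) (i1 1)).
transitivity (\int[mu]_(x in H)
    (- 1 * (n.1 * (J x * dw 0 x) + n.2 * (J x * dw 1 x)))).
  rewrite RintegralZl// RintegralD//; [|exact: (i1 0)|exact: (i1 1)].
  by rewrite !RintegralZl ?mulN1r//; exact: iJ.
apply: eq_Rintegral => x _; rewrite /dw /dwave -/(J x) /coord /= /dquad /coord /=.
rewrite /affine; ring.
Qed.

(* The field [q w - n J w] is tangential on the line. *)
Lemma integral_half_disc_affine c g :
  j0 = n.1 * c 0 + n.2 * c 1 ->
  j1 = - n.2 * (n.1 * (g 0).1 + n.2 * (g 1).1) + n.1 * (n.1 * (g 0).2 + n.2 * (g 1).2) ->
  \int[mu]_(x in H) (affine (c 0) (g 0) m x * dw 0 x)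
  + \int[mu]_(x in H) (affine (c 1) (g 1) m x * dw 1 x)
  + ((g 0).1 + (g 1).2) * \int[mu]_(x in H) w x = - jump_form.
Proof.
move=> ej0 ej1; pose q j := affine (c j) (g j) m.
pose V j x := q j x * w x + - coord n j * J x * w x.
pose N := `|m.1| + `|m.2| + r.
have CV j : C1 (V j) _ := C1D (C1M (C1_affine (c j) (g j) m) (C1_wave m r j0 g0))
  (C1M (C1M (C1_cst (- coord n j)) (C1_affine j0 g0 m)) (C1_wave m r j0 g0)).
have V0 j x : ~ box 0 N x -> V j x = 0.
  by move=> nb; rewrite /V /w (wave_out_box _ _ r0 nb) !mulr0 addr0.
have [B B0 hB] := @continuous_supp_bounded R N w (@continuous_wave R m r j0 g0)
  (fun x => @wave_out_box R m r j0 g0 x r0).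
(* The normal slope of the normal component of [q]. By the choice of [j0] and [j1], [J] agrees with
   that component on the line, so their difference is [k] times the signed distance. *)
pose k := n.1 * (n.1 * (g 0).1 + n.2 * (g 1).1) + n.2 * (n.1 * (g 0).2 + n.2 * (g 1).2).
have Vn x : `|n.1 * V 0 x + n.2 * V 1 x| <= (`|k| * B) * `|affine 0 n m x|.
  have -> : n.1 * V 0 x + n.2 * V 1 x = k * affine 0 n m x * w x.
    rewrite /V /coord /=.
    transitivity ((n.1 * q 0 x + n.2 * q 1 x - (n.1 ^+ 2 + n.2 ^+ 2) * J x) * w x).
      by rewrite /q /J; ring.
    rewrite n1 mul1r; congr (_ * _).
    pose X := x.1 - m.1; pose Y := x.2 - m.2.
    pose P1 := n.1 * (g 0).1 + n.2 * (g 1).1; pose P2 := n.1 * (g 0).2 + n.2 * (g 1).2.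
    transitivity ((n.1 ^+ 2 + n.2 ^+ 2) * (P1 * X + P2 * Y)
                  - j1 * (- n.2 * X + n.1 * Y)).
      by rewrite n1 mul1r /q /J /affine ej0 /g0 /= /P1 /P2 /X /Y; ring.
    by rewrite ej1 /k /affine -/X -/Y -/P1 -/P2; ring.
  have -> : `|k * affine 0 n m x * w x| = `|k| * `|w x| * `|affine 0 n m x|.
    by rewrite (normrM (k * _)) (normrM k) mulrAC.
  apply: ler_wpM2r => //; apply: ler_wpM2l => //.
have := integral_half_plane CV V0 Vn.
have iw : integrableR mu H w by exact: integrable_wave.
have iq j : integrableR mu H (fun x => q j x * dw j x).
  by apply: integrableM_dwave => //; exact: continuous_affine.
rewrite [X in X = _ -> _](@Rintegral0_out _ _ _ mu H); last 2 first.
- by move=> x [].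
- move=> x lx nH; have nU : ~ odisc m r x by move=> Ux; apply: nH.
  by rewrite /= (wave_odisc _ _ nU) !(dwave_odisc _ _ _ nU) !(mulr0, addr0).
rewrite (_ : \int[mu]_(x in H) _ =
  \int[mu]_(x in H) (q 0 x * dw 0 x + q 1 x * dw 1 x + ((g 0).1 + (g 1).2) * w x
    - (n.1 * (J x * dw 0 x) + n.2 * (J x * dw 1 x)))); last first.
  apply: eq_Rintegral => x _; rewrite /coord /= -/(J x) -/(w x) -/(dw 0 x) -/(dw 1 x) /q /g0 /=.
  ring.
have i1 : integrableR mu H (fun x => q 0 x * dw 0 x + q 1 x * dw 1 x + ((g 0).1 + (g 1).2) * w x).
  by apply: integrableRD => //; [exact: integrableRD|exact: integrableRZ].
have i2 : integrableR mu H (fun x => n.1 * (J x * dw 0 x) + n.2 * (J x * dw 1 x)).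
  by apply: integrableRD => //; apply: integrableRZ => //; exact: iJ.
have iJn i : integrableR mu H (fun x => coord n i * (J x * dw i x)).
  by apply: integrableRZ => //; exact: iJ.
have e1 : \int[mu]_(x in H) (q 0 x * dw 0 x + q 1 x * dw 1 x + ((g 0).1 + (g 1).2) * w x)
  = \int[mu]_(x in H) (q 0 x * dw 0 x) + \int[mu]_(x in H) (q 1 x * dw 1 x)
    + ((g 0).1 + (g 1).2) * \int[mu]_(x in H) w x.
  rewrite RintegralD//; [|exact: integrableRD|exact: integrableRZ].
  by rewrite RintegralZl//; congr (_ + _); rewrite RintegralD//; exact: iq.
have e2 : \int[mu]_(x in H) (n.1 * (J x * dw 0 x) + n.2 * (J x * dw 1 x)) = - jump_form.
  rewrite RintegralD//; [|exact: (iJn 0)|exact: (iJn 1)].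
  by rewrite !RintegralZl ?opprK//; exact: iJ.
rewrite RintegralB// e1 e2.
by move=> /eqP; rewrite subr_eq0 => /eqP.
Qed.

End Jump.

Lemma jump_form_lower : exists2 k : R, 0 < k & forall m n r j0 j1, 0 < r ->
  n.1 ^+ 2 + n.2 ^+ 2 = 1 ->
  k * r * size2 j0 (j1 * - n.2, j1 * n.1) r <= jump_form m n r j0 j1.
Proof.
(* The factors bound the integrand of [jump_formE] on the square of [affine_lower_box_half]: profile
   at least 1/2, squared; distance at least [r / 4]; [J^2] at least [size2 / 16]; area
   [4 (r / 16)^2]. *)
exists (6 * (2^-1 ^+ 2) * 4^-1 / 16 * (4 / 16 ^+ 2)).
  by rewrite !mulr_gt0 ?divr_gt0 ?invr_gt0 ?exprn_gt0.
move=> m n r j0 j1 r0 n1; rewrite jump_formE//.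
have [p hp] := affine_lower_box_half j0 j1 m r0 n1.
have mH := measurable_half_disc m r n.
set g := (j1 * - n.2, j1 * n.1) in hp *; set S := size2 j0 g r in hp *.
have rn0 : r != 0 by rewrite gt_eqF.
have S0 : 0 <= S by exact: size2_ge0.
have -> : 6 * 2^-1 ^+ 2 * 4^-1 / 16 * (4 / 16 ^+ 2) * r * S
   = 6 * (2^-1 ^+ 2) * (r / 4) / r ^+ 2 * (S / 16) * (4 * (r / 16) ^+ 2) by field.
have r2 : 0 < r ^+ 2 by rewrite exprn_gt0.
apply: (@Rintegral_lower_box _ _ _ p) => //.
- have c2 : continuous (fun x => 6 * bump m r 2 x * affine 0 n m x / r ^+ 2 * affine j0 g m x ^+ 2).
    move=> x; have [cb _ _] := C1_bump m r 0.
    apply: cvgM; last first.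
      rewrite expr2; under eq_fun do rewrite expr2.
      by apply: cvgM; exact: continuous_affine.
    apply: cvgM; last exact: cvg_cst.
    apply: cvgM; last exact: continuous_affine.
    by apply: cvgM; [exact: cvg_cst|exact: cb].
  apply: (@integrable_continuous_suppS R (`|m.1| + `|m.2| + r) _ _ mH c2).
  move=> x /(quad_out_box r0)/ltW q0.
  by rewrite (@bump_out _ m r 1 x q0); ring.
- move=> x [_ /= l0]; apply: mulr_ge0; last exact: sqr_ge0.
  apply: divr_ge0; last exact: ltW.
  by apply: mulr_ge0; [apply: mulr_ge0 => //; exact: bump_ge0|exact: ltW].
- by rewrite divr_ge0// ltW.
- move=> x /hp[h1 h2 _]; split; rewrite /odisc /=.
    by apply: lt_le_trans h1; rewrite invr_gt0.
  by apply: lt_le_trans h2; rewrite divr_gt0.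
- move=> x /hp[h1 h2 h3].
  have half0 : 0 <= 2^-1 :> R by rewrite invr_ge0.
  have b : 2^-1 ^+ 2 <= bump m r 2 x.
    rewrite /bump pospow_pos; last exact: le_trans h1.
    by have q0 := le_trans half0 h1; rewrite ler_pXn2r ?nnegrE.
  have r40 : 0 <= r / 4 by apply: divr_ge0 => //; exact: ltW.
  have hh0 : 0 <= 2^-1 ^+ 2 :> R by exact: sqr_ge0.
  have b1 : 6 * 2^-1 ^+ 2 <= 6 * bump m r 2 x by rewrite ler_pM2l.
  have b10 : 0 <= 6 * 2^-1 ^+ 2 :> R by apply: mulr_ge0.
  have b2 : 6 * 2^-1 ^+ 2 * (r / 4) <= 6 * bump m r 2 x * affine 0 n m x.
    by apply: ler_pM.
  apply: ler_pM => //.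
  + by apply: divr_ge0; [exact: mulr_ge0|exact: ltW].
  + exact: divr_ge0.
  + by rewrite ler_pM2r// invr_gt0.
Qed.

End EdgeEstimate.

(** * The jump residual on a disc cut by an edge *)

Section EdgeResidual.
Context {R : realType}.
Implicit Types (x m n p : R * R) (r : R).
Implicit Types (c : 'I_2 -> R) (g : 'I_2 -> R * R).
Local Notation mu := (mu2 R).

Lemma integral_wave_sqr_le m r (a : R) (p : R * R) (D : set (plane_m R)) : 0 < r ->
  measurable D -> D `<=` odisc m r ->
  (\int[mu]_(x in D) wave m r a p x) ^+ 2 <= 48 * size2 a p r * r ^+ 4.
Proof.
move=> r0 mD DU; have DA : (mu D <= (4 * r ^+ 2)%:E)%E.
  apply: le_trans (odisc_leb2 m r0); apply: le_measure => //; rewrite inE//.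
  exact: measurable_odisc.
have Doo : (mu D < +oo)%E by apply: le_lt_trans DA (ltry _).
have h1 : square_integrable mu D (fun=> 1).
  by apply: (@square_integrable_bounded _ _ _ mu _ _ 1) => // x _; rewrite normr1.
have S0 : 0 <= 3 * size2 a p r by rewrite mulr_ge0// size2_ge0.
have := Cauchy_Schwarz_bounded2 mD h1 (@measurable_wave R m r a p D)
  (fun x Dx => wave_bound a p r0 (DU x Dx)) S0 DA.
rewrite (@eq_Rintegral _ _ _ mu D (wave m r a p)); last by move=> x _; rewrite mul1r.
move=> h; apply: (le_trans h).
rewrite (@eq_Rintegral _ _ _ mu D (fun=> 1)); last by move=> x _; rewrite expr1n.
rewrite Rintegral_cst// mul1r.
have fD : fine (mu D) <= 4 * r ^+ 2 by rewrite -lee_fin fineK// ge0_fin_numE.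
have -> : 48 * size2 a p r * r ^+ 4 = 3 * size2 a p r * (4 * r ^+ 2) * (4 * r ^+ 2) by ring.
by apply: ler_wpM2l => //; apply: mulr_ge0 => //; apply: mulr_ge0 => //; exact: sqr_ge0.
Qed.

Lemma integral_diff_dwave_sqr_le m r (a : R) (p : R * R) j (D : set (plane_m R)) f : 0 < r ->
  measurable D -> D `<=` odisc m r -> square_integrable mu D f ->
  (\int[mu]_(x in D) (f x * dwave m r a p j x)) ^+ 2
  <= 4 * dwave_cst * size2 a p r * \int[mu]_(x in D) f x ^+ 2.
Proof.
move=> r0 mD DU hf; have DA : (mu D <= (4 * r ^+ 2)%:E)%E.
  apply: le_trans (odisc_leb2 m r0); apply: le_measure => //; rewrite inE//.
  exact: measurable_odisc.
have r2 : 0 < r ^+ 2 by rewrite exprn_gt0.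
have K0 : 0 < dwave_cst :> R := dwave_cst_gt0; have K00 := ltW K0.
have S0 : 0 <= dwave_cst * size2 a p r / r ^+ 2.
  by apply: divr_ge0; [apply: mulr_ge0 => //; exact: size2_ge0|exact: ltW].
have := Cauchy_Schwarz_bounded2 mD hf (@measurable_dwave R m r a p j D)
  (fun x Dx => dwave_bound a p j r0 (DU x Dx)) S0 DA.
move=> h; apply: (le_trans h); rewrite le_eqVlt; apply/orP; left; apply/eqP; field.
by rewrite gt_eqF.
Qed.

(** The affine field [q'] of the lower side is extended to the whole disc, so that the discontinuity
    sits in [q - q'] on the upper half. The numbers [j0] and [j1] are the normal jump at the centre
    and its tangential slope. The two sides carry separate fields, so a boundary edge can use zero
    on the outer side. *)
Lemma edge_residual : exists2 C : R, 0 < C &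
  forall m n r c g c' g' (sp sm : 'I_2 -> plane_m R -> R) j0 j1,
  0 < r -> n.1 ^+ 2 + n.2 ^+ 2 = 1 ->
  (forall j, square_integrable mu (half_disc m r n) (sp j)) ->
  (forall j, square_integrable mu (half_disc m r (- n)) (sm j)) ->
  j0 = n.1 * (c 0 - c' 0) + n.2 * (c 1 - c' 1) ->
  j1 = - n.2 * (n.1 * ((g 0).1 - (g' 0).1) + n.2 * ((g 1).1 - (g' 1).1))
       + n.1 * (n.1 * ((g 0).2 - (g' 0).2) + n.2 * ((g 1).2 - (g' 1).2)) ->
  let dw := dwave m r j0 (j1 * - n.2, j1 * n.1) in
  \int[mu]_(x in half_disc m r n) (sp 0 x * dw 0 x + sp 1 x * dw 1 x)
  + \int[mu]_(x in half_disc m r (- n)) (sm 0 x * dw 0 x + sm 1 x * dw 1 x) = 0 ->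
  r ^+ 2 * size2 j0 (j1 * - n.2, j1 * n.1) r
  <= C * (dist2 (half_disc m r n) sp c g m + dist2 (half_disc m r (- n)) sm c' g' m
          + r ^+ 4 * ((g 0).1 + (g 1).2) ^+ 2 + r ^+ 4 * ((g' 0).1 + (g' 1).2) ^+ 2).
Proof.
have [k0 k00 lower] := @jump_form_lower R.
have K0 : 0 < dwave_cst :> R := dwave_cst_gt0; have K00 := ltW K0.
exists (k0 ^- 2 * (6 * (4 * dwave_cst))).
  by rewrite !mulr_gt0// invr_gt0 exprn_gt0.
move=> m n r c g c' g' sp sm j0 j1 r0 n1 hsp hsm ej0 ej1.
set p := (j1 * - n.2, j1 * n.1); move=> dw.
set Hp := half_disc m r n; set Hm := half_disc m r (- n) => wf.
have mHp : measurable Hp := measurable_half_disc m r n.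
have mHm : measurable Hm := measurable_half_disc m r (- n).
have mU := measurable_odisc m r.
have HpU : Hp `<=` odisc m r by move=> x [].
have HmU : Hm `<=` odisc m r by move=> x [].
pose w := wave m r j0 p; pose X := jump_form m n r j0 j1.
pose d := (g 0).1 + (g 1).2; pose d' := (g' 0).1 + (g' 1).2.
pose q j := affine (c j) (g j) m; pose q' j := affine (c' j) (g' j) m.
have iw D : measurable D -> integrableR mu D w by move=> mD; exact: integrable_wave.
have iq D a b j : measurable D -> integrableR mu D (fun x => affine a b m x * dw j x).
  by move=> mD; apply: integrableM_dwave => //; exact: continuous_affine.
pose A j := \int[mu]_(x in Hp) (q j x * dw j x).
pose A' j := \int[mu]_(x in Hp) (q' j x * dw j x).
pose B' j := \int[mu]_(x in Hm) (q' j x * dw j x).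
pose Wp := \int[mu]_(x in Hp) w x; pose Wm := \int[mu]_(x in Hm) w x.
(* The difference [q - q'] on the upper half yields the jump, up to its divergence. *)
have E1 : A 0 - A' 0 + (A 1 - A' 1) + (d - d') * Wp = - X.
  have := @integral_half_disc_affine R m n r j0 j1 r0 n1
    (fun j => c j - c' j) (fun j => ((g j).1 - (g' j).1, (g j).2 - (g' j).2)) ej0 ej1.
  rewrite -/X -/Hp -/dw -/w -/Wp /=.
  have -> : (g 0).1 - (g' 0).1 + ((g 1).2 - (g' 1).2) = d - d' by rewrite /d /d'; ring.
  have h j : \int[mu]_(x in Hp)
      (affine (c j - c' j) ((g j).1 - (g' j).1, (g j).2 - (g' j).2) m x * dw j x) = A j - A' j.
    rewrite -RintegralB//; [|exact: iq|exact: iq].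
    by apply: eq_Rintegral => x _; rewrite /q /q' /affine /=; ring.
  by rewrite -!h.
(* The extended [q'] has no discontinuity; on the full disc only its derivatives remain. *)
have E2 j : A' j + B' j = - (coord (g' j) j * (Wp + Wm)).
  rewrite -[LHS](Rintegral_half_discs n1 (iq _ _ _ _ mU)).
  by rewrite -[X in _ * X](Rintegral_half_discs n1 (iw _ mU)) integral_affine_wave.
have sq : forall j, square_integrable mu Hp (q j).
  by move=> j; exact: (square_integrable_affine _ _ r0 mHp HpU).
have sq' : forall j, square_integrable mu Hm (q' j).
  by move=> j; exact: (square_integrable_affine _ _ r0 mHm HmU).
have Hoo D : measurable D -> D `<=` odisc m r -> (mu D < +oo)%E.
  move=> mD DU; apply: (@le_lt_trans _ _ (mu (odisc m r))).
    by apply: le_measure => //; rewrite inE.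
  by apply: le_lt_trans (odisc_leb2 m r0) (ltry _).
have sdw D j : measurable D -> D `<=` odisc m r -> square_integrable mu D (dw j).
  move=> mD DU; apply: (@square_integrable_continuous_supp _ (`|m.1| + `|m.2| + r)) => //.
  - exact: Hoo.
  - exact: continuous_dwave.
  - by move=> x; exact: dwave_out_box.
have sp_q j : square_integrable mu Hp (fun x => sp j x - q j x) by exact: square_integrableB.
have sm_q j : square_integrable mu Hm (fun x => sm j x - q' j x) by exact: square_integrableB.
pose I j := \int[mu]_(x in Hp) ((sp j x - q j x) * dw j x).
pose I' j := \int[mu]_(x in Hm) ((sm j x - q' j x) * dw j x).
have E3 : I 0 + A 0 + (I 1 + A 1) + (I' 0 + B' 0 + (I' 1 + B' 1)) = 0.
  rewrite -[RHS]wf !RintegralD//; try (apply: integrableRM => //; exact: sdw).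
  have sdwp j : square_integrable mu Hp (dw j) by exact: sdw.
  have sdwm j : square_integrable mu Hm (dw j) by exact: sdw.
  have h j : I j + A j = \int[mu]_(x in Hp) (sp j x * dw j x).
    rewrite -RintegralD//; [|exact: integrableRM|exact: integrableRM].
    by apply: eq_Rintegral => x _; ring.
  have h' j : I' j + B' j = \int[mu]_(x in Hm) (sm j x * dw j x).
    rewrite -RintegralD//; [|exact: integrableRM|exact: integrableRM].
    by apply: eq_Rintegral => x _; ring.
  by rewrite !h !h'.
(* The divergence terms regroup by [(d - d') Wp + d' (Wp + Wm) = d Wp + d' Wm], each side keeping
   its own divergence. *)
have XE : X = (I 0 + I 1 + - (d * Wp)) + (I' 0 + I' 1 + - (d' * Wm)).
  have e20 := E2 0; have e21 := E2 1; rewrite /coord /= in e20 e21.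
  have dE : d' * (Wp + Wm) = (g' 0).1 * (Wp + Wm) + (g' 1).2 * (Wp + Wm).
    by rewrite /d' mulrDl.
  have dE2 : d' * (Wp + Wm) = d' * Wp + d' * Wm by rewrite mulrDr.
  have dE3 : (d - d') * Wp = d * Wp - d' * Wp by rewrite mulrBl.
  lra.
pose S := size2 j0 p r; have S0 : 0 <= S by exact: size2_ge0.
pose e j := \int[mu]_(x in Hp) (sp j x - q j x) ^+ 2.
pose e' j := \int[mu]_(x in Hm) (sm j x - q' j x) ^+ 2.
have e0 j : 0 <= e j by exact: int_sq_ge0.
have e'0 j : 0 <= e' j by exact: int_sq_ge0.
have IB j : I j ^+ 2 <= 4 * dwave_cst * S * e j by exact: integral_diff_dwave_sqr_le.
have IB' j : I' j ^+ 2 <= 4 * dwave_cst * S * e' j by exact: integral_diff_dwave_sqr_le.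
have WB : Wp ^+ 2 <= 48 * S * r ^+ 4 by exact: integral_wave_sqr_le.
have WB' : Wm ^+ 2 <= 48 * S * r ^+ 4 by exact: integral_wave_sqr_le.
have Xl : k0 * r * S <= X by exact: lower.
rewrite -/p -/S /dist2 -/Hp -/Hm -/(e 0) -/(e 1) -/(e' 0) -/(e' 1) -/d -/d'.
have dd : (d * Wp) ^+ 2 <= 48 * S * (r ^+ 4 * d ^+ 2).
  rewrite exprMn; have -> : 48 * S * (r ^+ 4 * d ^+ 2) = d ^+ 2 * (48 * S * r ^+ 4) by ring.
  by apply: ler_wpM2l => //; exact: sqr_ge0.
have dd' : (d' * Wm) ^+ 2 <= 48 * S * (r ^+ 4 * d' ^+ 2).
  rewrite exprMn; have -> : 48 * S * (r ^+ 4 * d' ^+ 2) = d' ^+ 2 * (48 * S * r ^+ 4) by ring.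
  by apply: ler_wpM2l => //; exact: sqr_ge0.
have r4 : 0 <= r ^+ 4 by apply: exprn_ge0; exact: ltW.
have rd : 0 <= r ^+ 4 * d ^+ 2 by apply: mulr_ge0 => //; exact: sqr_ge0.
have rd' : 0 <= r ^+ 4 * d' ^+ 2 by apply: mulr_ge0 => //; exact: sqr_ge0.
pose E := e 0 + e 1 + (e' 0 + e' 1) + r ^+ 4 * d ^+ 2 + r ^+ 4 * d' ^+ 2.
have X2 : X ^+ 2 <= S * (6 * (4 * dwave_cst) * E).
  have s1 := sqr_sum3_le (I 0) (I 1) (- (d * Wp)).
  have s2 := sqr_sum3_le (I' 0) (I' 1) (- (d' * Wm)).
  rewrite !sqrrN in s1 s2.
  have s3 : X ^+ 2 <= 2 * ((I 0 + I 1 + - (d * Wp)) ^+ 2 + (I' 0 + I' 1 + - (d' * Wm)) ^+ 2).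
    rewrite XE; set a := I 0 + _ + _; set b := I' 0 + _ + _.
    by have := sqr_ge0 (a - b); nra.
  have i0 := IB 0; have i1 := IB 1; have i'0 := IB' 0; have i'1 := IB' 1.
  have Srd := ler_wpM2r (mulr_ge0 S0 rd) (@dwave_cst_ge12 R).
  have Srd' := ler_wpM2r (mulr_ge0 S0 rd') (@dwave_cst_ge12 R).
  have -> : S * (6 * (4 * dwave_cst) * E) = 6 * (4 * dwave_cst * S * e 0 + 4 * dwave_cst * S * e 1 +
     4 * dwave_cst * S * e' 0 + 4 * dwave_cst * S * e' 1 + 4 * dwave_cst * (S * (r ^+ 4 * d ^+ 2))
     + 4 * dwave_cst * (S * (r ^+ 4 * d' ^+ 2))) by rewrite /E; ring.
  lra.
have E00 : 0 <= E by rewrite /E !addr_ge0.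
have r2 : 0 < r ^+ 2 by rewrite exprn_gt0.
have key : (k0 * S) ^+ 2 <= S * (6 * (4 * dwave_cst) * E / r ^+ 2).
  rewrite [leRHS]mulrA ler_pdivlMr//; apply: le_trans X2.
  have l0 : 0 <= k0 * r * S by apply: mulr_ge0 => //; apply: mulr_ge0; exact: ltW.
  have l2 := le_trans l0 Xl.
  have -> : (k0 * S) ^+ 2 * r ^+ 2 = (k0 * r * S) ^+ 2 by ring.
  by rewrite ler_pXn2r ?nnegrE.
have F0 : 0 <= 6 * (4 * dwave_cst) * E / r ^+ 2.
  by apply: divr_ge0; [rewrite !mulr_ge0|exact: ltW].
have h := sqr_le_linear k00 S0 F0 key.
apply: (le_trans (ler_wpM2l (ltW r2) h)).
rewrite -/E le_eqVlt; apply/orP; left; apply/eqP; field.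
by rewrite !gt_eqF.
Qed.

End EdgeResidual.

(** * Triangles *)

Section TriangleGeometry.
Context {R : realType}.
Implicit Types (P Q W x y z m n : R * R) (r : R) (T : triangle R).

(** Twice the signed area of the triangle [P], [Q], [x]. Quotients by [det P Q W] are the
    barycentric coordinates, independent of the orientation. *)
Definition det P Q x : R := (Q.1 - P.1) * (x.2 - P.2) - (Q.2 - P.2) * (x.1 - P.1).

Lemma det_rot P Q W : det Q W P = det P Q W.
Proof. by rewrite /det; ring. Qed.

Lemma det_swap P Q W : det Q P W = - det P Q W.
Proof. by rewrite /det; ring. Qed.

Lemma det_sum P Q W x : det Q W x + det W P x + det P Q x = det P Q W.
Proof. by rewrite /det; ring. Qed.

Lemma triP P Q W x : det P Q W != 0 ->
  tri (P, Q, W) x <->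
  [/\ 0 <= det Q W x / det P Q W, 0 <= det W P x / det P Q W
    & 0 <= det P Q x / det P Q W].
Proof.
move=> D0; split=> [[a [b [c [a0 b0 c0 abc ->]]]]|[a0 b0 c0]].
  have aE : a = 1 - b - c by lra.
  have -> : det Q W (a *: P + b *: Q + c *: W) = a * det P Q W.
    by rewrite aE /det /= /GRing.scale /=; ring.
  have -> : det W P (a *: P + b *: Q + c *: W) = b * det P Q W.
    by rewrite aE /det /= /GRing.scale /=; ring.
  have -> : det P Q (a *: P + b *: Q + c *: W) = c * det P Q W.
    by rewrite aE /det /= /GRing.scale /=; ring.
  by split; rewrite mulfK.
exists (det Q W x / det P Q W), (det W P x / det P Q W), (det P Q x / det P Q W).
split => //; first by rewrite -!mulrDl det_sum divff.
have e1 : x.1 = det Q W x / det P Q W * P.1 + det W P x / det P Q W * Q.1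
    + det P Q x / det P Q W * W.1 by rewrite /det in D0 *; field.
have e2 : x.2 = det Q W x / det P Q W * P.2 + det W P x / det P Q W * Q.2
    + det P Q x / det P Q W * W.2 by rewrite /det in D0 *; field.
by rewrite [LHS]surjective_pairing e1 e2.
Qed.

Lemma tri_rot P Q W : tri (Q, W, P) = tri (P, Q, W).
Proof.
apply/seteqP; split=> x [a [b [c [a0 b0 c0 abc ->]]]] /=.
  by exists c, a, b; split => //; [lra|rewrite addrC addrA].
by exists b, c, a; split => //; [lra|rewrite -addrA addrC].
Qed.

Lemma tri_swap P Q W : tri (Q, P, W) = tri (P, Q, W).
Proof.
by apply/seteqP; split=> x [a [b [c [a0 b0 c0 abc ->]]]] /=;
  exists b, a, c; split => //; rewrite ?(addrC b)// (addrC (a *: _)).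
Qed.

Lemma tri_vertex P Q W : [/\ tri (P, Q, W) P, tri (P, Q, W) Q & tri (P, Q, W) W].
Proof.
split; [exists 1, 0, 0|exists 0, 1, 0|exists 0, 0, 1];
  by split; rewrite ?ler01// ?addr0 ?add0r// !scale0r scale1r ?addr0 ?add0r.
Qed.

Lemma segment_sub_tri P Q W : segment (P, Q) `<=` tri (P, Q, W).
Proof.
move=> x [t /=]; rewrite in_itv /= => /andP[t0 t1] <-.
exists (1 - t), t, 0; split => //; [lra|lra|].
by rewrite scale0r addr0.
Qed.

(** A normal form with the given edge first, so that later arguments treat a single position of the
    edge; the six cases are the rotations and reflections of the vertices. *)
Lemma has_edgeP T (e : edge R) : Defs.nondegenerate T -> has_edge T e ->
  exists W, [/\ tri T = tri (e.1, e.2, W), det e.1 e.2 W != 0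
    & vertices T =i [:: e.1; e.2; W]].
Proof.
case: T => [[A B] C] nd; case: e => P Q.
have {}nd : det A B C != 0 by [].
rewrite /has_edge /= /same_edge /= orbF => /or3P[] /orP[] /eqP[-> ->].
- by exists C; split.
- exists C; split; first by rewrite [RHS]tri_swap.
    by rewrite det_swap oppr_eq0.
  by move=> y; rewrite !inE; case: (y == A); case: (y == B); case: (y == C).
- exists A; split; first by rewrite [RHS]tri_rot.
    by rewrite det_rot.
  by move=> y; rewrite !inE; case: (y == A); case: (y == B); case: (y == C).
- exists A; split; first by rewrite [RHS]tri_swap [RHS]tri_rot.
    by rewrite det_swap oppr_eq0 det_rot.
  by move=> y; rewrite !inE; case: (y == A); case: (y == B); case: (y == C).
- exists B; split; first by rewrite -[RHS]tri_rot.
    by rewrite -det_rot.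
  by move=> y; rewrite !inE; case: (y == A); case: (y == B); case: (y == C).
- exists B; split; first by rewrite [RHS]tri_swap -[RHS]tri_rot.
    by rewrite det_swap oppr_eq0 -det_rot.
  by move=> y; rewrite !inE; case: (y == A); case: (y == B); case: (y == C).
Qed.

End TriangleGeometry.

(** * Interiors of triangles and slopes of barycentric coordinates *)

Section EdgeGeometry.
Context {R : realType}.
Implicit Types (P Q W x y z m n g : R * R) (c r : R) (T : triangle R) (A : set (R * R)).

(** A nonconstant affine function has no interior minimum; this keeps interior points of triangles
    off the lines carrying the edges. *)
Lemma affine_min c g m x A : nbhs x A -> (forall y, A y -> 0 <= affine c g m y) ->
  affine c g m x = 0 -> g.1 = 0 /\ g.2 = 0.
Proof.
move=> /nbhs_ball_sub[e e0 eA] pos fx.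
have step a b : `|a| < e -> `|b| < e -> 0 <= g.1 * a + g.2 * b.
  move=> ha hb; have -> : g.1 * a + g.2 * b = affine c g m (x.1 + a, x.2 + b).
    by rewrite -[LHS]add0r -fx /affine /=; ring.
  by apply: pos; apply: eA => /=; rewrite addrC addKr.
have e2 : `|e / 2| < e by rewrite gtr0_norm; lra.
have n0 : `|0 : R| < e by rewrite normr0.
have h1 := step (e / 2) 0 e2 n0; have h2 := step 0 (e / 2) n0 e2.
have h3 := step (- (e / 2)) 0; rewrite normrN in h3; have {}h3 := h3 e2 n0.
have h4 := step 0 (- (e / 2)); rewrite normrN in h4; have {}h4 := h4 n0 e2.
split; nra.
Qed.

Lemma open_affine_gt0 c g m : open [set x | 0 < affine c g m x].
Proof.
exact: (proj1 (continuousP _) (@continuous_affine R c g m) [set y : R | 0 < y] (@open_gt R 0)).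
Qed.

Lemma open_interiorS (O A : set (R * R)) x : open O -> O x -> O `<=` A -> A° x.
Proof.
by move=> oO Ox OA; apply: (filterS OA); exact: open_nbhs_nbhs.
Qed.

Lemma det_quot P Q x D : det P Q x / D = affine 0 (- (Q.2 - P.2) / D, (Q.1 - P.1) / D) P x.
Proof. by rewrite /det /affine /=; ring. Qed.

Lemma tri_interior P Q W x : det P Q W != 0 ->
  (tri (P, Q, W))° x <->
  [/\ 0 < det Q W x / det P Q W, 0 < det W P x / det P Q W
    & 0 < det P Q x / det P Q W].
Proof.
move=> D0; split=> [Tx|[a0 b0 c0]].
  have [a0 b0 c0] := (triP x D0).1 (interior_subset Tx).
  have gen P' Q' : (forall y, tri (P, Q, W) y -> 0 <= det P' Q' y / det P Q W) ->
      (exists y, det P' Q' y != 0) -> 0 < det P' Q' x / det P Q W.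
    move=> pos [y dy]; rewrite lt_neqAle pos ?andbT; last exact: interior_subset.
    apply/negP => /eqP/esym; rewrite det_quot => fx.
    have posA z : tri (P, Q, W) z ->
        0 <= affine 0 (- (Q'.2 - P'.2) / det P Q W, (Q'.1 - P'.1) / det P Q W) P' z.
      by move=> /pos; rewrite det_quot.
    have [/= /eqP g1 /eqP g2] := affine_min Tx posA fx.
    move: g1 g2; rewrite !mulf_eq0 !invr_eq0 (negbTE D0) !orbF => /eqP g1 /eqP g2.
    have g1' : Q'.2 - P'.2 = 0 by lra.
    by move: dy; rewrite /det g1' g2 !mul0r subrr eqxx.
  split; apply: gen.
  - by move=> y /(triP y D0)[].
  - by exists P; rewrite det_rot.
  - by move=> y /(triP y D0)[].
  - by exists Q; rewrite -det_rot.
  - by move=> y /(triP y D0)[].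
  - by exists W.
have oI : open [set y | [/\ 0 < det Q W y / det P Q W, 0 < det W P y / det P Q W
    & 0 < det P Q y / det P Q W]].
  have -> : [set y | [/\ 0 < det Q W y / det P Q W, 0 < det W P y / det P Q W
      & 0 < det P Q y / det P Q W]] = [set y | 0 < det Q W y / det P Q W] `&`
      ([set y | 0 < det W P y / det P Q W] `&` [set y | 0 < det P Q y / det P Q W]).
    by apply/seteqP; split=> [y []|y [h1 []]].
  have o P' Q' : open [set y | 0 < det P' Q' y / det P Q W].
    have -> : [set y | 0 < det P' Q' y / det P Q W] = [set y | 0 <
        affine 0 (- (Q'.2 - P'.2) / det P Q W, (Q'.1 - P'.1) / det P Q W) P' y].
      by apply/seteqP; split=> y /=; rewrite det_quot.
    exact: open_affine_gt0.
  by apply: openI; [exact: o|apply: openI; exact: o].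
apply: (open_interiorS oI) => // y [h1 h2 h3].
by apply/triP => //; split; exact: ltW.
Qed.

Lemma edistE x y : Defs.edist x y = Num.sqrt (sqdist x y).
Proof. by []. Qed.

Lemma sqdist_ge0 x y : 0 <= sqdist x y.
Proof. by rewrite addr_ge0 ?sqr_ge0. Qed.

Lemma discP z r x : 0 <= r -> disc z r x <-> sqdist x z <= r ^+ 2.
Proof.
move=> r0; rewrite /disc /= edistE.
have -> : sqdist z x = sqdist x z by rewrite /sqdist; ring.
split=> [h|h]; last by rewrite -(ger0_norm r0) -sqrtr_sqr ler_wsqrtr.
by rewrite -(sqr_sqrtr (sqdist_ge0 x z)) ler_pXn2r ?nnegrE ?sqrtr_ge0.
Qed.

Lemma odisc_sub_interior z r A : 0 < r -> disc z r `<=` A -> odisc z r `<=` A°.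
Proof.
move=> r0 dA x Ux; apply: (open_interiorS (@open_odisc _ z r)) => // y.
by move=> /(odiscP _ _ r0) h; apply: dA; apply/discP; exact: ltW.
Qed.

(** On a disc of radius [r] an affine function oscillates by [2 r |g|], attained at the ends of the
    diameter along the gradient. *)
Lemma affine_slope c g m z r : 0 < r ->
  (forall x, disc z r x -> 0 <= affine c g m x <= 1) ->
  4 * r ^+ 2 * (g.1 ^+ 2 + g.2 ^+ 2) <= 1.
Proof.
move=> r0 h; set s := g.1 ^+ 2 + g.2 ^+ 2.
have s0 : 0 <= s by rewrite addr_ge0 ?sqr_ge0.
have [->|sn0] := eqVneq s 0; first by rewrite mulr0 ler01.
have sp : 0 < s by rewrite lt_neqAle eq_sym sn0.
pose k := Num.sqrt s; have k0 : 0 < k by rewrite sqrtr_gt0.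
have kk : k ^+ 2 = s by rewrite sqr_sqrtr.
have hd e : e ^+ 2 = 1 -> 0 <= affine c g m (z.1 + e * (r * (g.1 / k)), z.2 + e * (r * (g.2 / k))) <= 1.
  move=> ee; apply: h; apply/discP; first exact: ltW.
  rewrite /sqdist /=.
  have -> : (z.1 + e * (r * (g.1 / k)) - z.1) ^+ 2 + (z.2 + e * (r * (g.2 / k)) - z.2) ^+ 2
     = e ^+ 2 * r ^+ 2 * (s / k ^+ 2).
    by rewrite /s; field; rewrite gt_eqF.
  by rewrite ee mul1r kk divff// mulr1.
have /andP[_ h1] := hd 1 (expr1n _ _).
have /andP[h2 _] : 0 <= affine c g m (z.1 + -1 * (r * (g.1 / k)), z.2 + -1 * (r * (g.2 / k))) <= 1.
  by apply: hd; rewrite sqrrN expr1n.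
have E : affine c g m (z.1 + 1 * (r * (g.1 / k)), z.2 + 1 * (r * (g.2 / k)))
  - affine c g m (z.1 + -1 * (r * (g.1 / k)), z.2 + -1 * (r * (g.2 / k))) = 2 * r * (s / k).
  by rewrite /affine /s /=; field; rewrite gt_eqF.
have sk : s / k = k by rewrite -kk expr2 mulfK// gt_eqF.
rewrite sk in E.
have l1 : 2 * r * k <= 1 by lra.
have -> : 4 * r ^+ 2 * s = (2 * r * k) ^+ 2 by rewrite -kk; ring.
by rewrite exprn_ile1// !mulr_ge0// ltW.
Qed.

(** By [affine_slope] the gradient is at most [1 / (2 r)], so the value 1/2 at [m] cannot drop below
    0 within distance [r]. The point [m] may lie outside the disc around [z]. *)
Lemma affine_near_half c g m z r p : 0 < r -> 0 <= p <= r ->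
  (forall x, disc z r x -> 0 <= affine c g m x <= 1) -> affine c g m m = 2^-1 ->
  (forall x, sqdist x m <= p ^+ 2 -> 0 <= affine c g m x) /\
  (forall x, sqdist x m < p ^+ 2 -> 0 < affine c g m x).
Proof.
move=> r0 /andP[p0 pr] h fm; have sl := affine_slope r0 h.
have s0 : 0 <= g.1 ^+ 2 + g.2 ^+ 2 by rewrite addr_ge0 ?sqr_ge0.
have pr2 : p ^+ 2 <= r ^+ 2 by rewrite ler_pXn2r// ?nnegrE ?ltW.
have key x : exists2 d, affine c g m x = 2^-1 + d &
    d ^+ 2 <= (g.1 ^+ 2 + g.2 ^+ 2) * sqdist x m.
  pose X := x.1 - m.1; pose Y := x.2 - m.2; exists (g.1 * X + g.2 * Y).
    by rewrite -fm /affine /X /Y !subrr !mulr0; ring.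
  by rewrite /sqdist -/X -/Y; have := sqr_ge0 (g.1 * Y - g.2 * X); nra.
split=> x xm; have [d -> cs] := key x.
  have dd : 4 * d ^+ 2 <= 1.
    by have := ler_wpM2l s0 (le_trans xm pr2); nra.
  have : `|2 * d| <= 1 by rewrite normr_le_sqr// expr1n; nra.
  by rewrite ler_norml => /andP[]; lra.
(* A vanishing gradient is split off because the strict bound on the distance gets multiplied by the
   squared gradient. *)
have [sE|sn0] := eqVneq (g.1 ^+ 2 + g.2 ^+ 2) 0.
  have : d ^+ 2 <= 0 by rewrite sE mul0r in cs.
  by move=> d0; nra.
have sp : 0 < g.1 ^+ 2 + g.2 ^+ 2 by rewrite lt_neqAle eq_sym sn0.
have xr := lt_le_trans xm pr2.
have := xr; rewrite -(ltr_pM2l sp) => xr'.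
have dd : 4 * d ^+ 2 < 1 by nra.
rewrite ltNge; apply/negP => dn; nra.
Qed.

End EdgeGeometry.

(** * Discs at edge midpoints, inner normals, conformity *)

Section MeshGeometry.
Context {R : realType}.
Implicit Types (P Q W x y z m n g : R * R) (c r p : R) (T : triangle R) (A : set (R * R)).

Definition midpoint P Q : R * R := ((P.1 + Q.1) / 2, (P.2 + Q.2) / 2).

Lemma affine_recenter c g m m' x :
  affine c g m x = affine (affine c g m m') g m' x.
Proof. by rewrite /affine; ring. Qed.

Lemma det_midpoint P Q W :
  [/\ det P Q (midpoint P Q) = 0, det Q W (midpoint P Q) = det P Q W / 2
    & det W P (midpoint P Q) = det P Q W / 2].
Proof. by split; rewrite /det /midpoint /=; field. Qed.

(** The barycentric coordinates of [P] and [Q] equal 1/2 at the midpoint and hence stay positive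
    within the inscribed radius; there the triangle is cut out by the sign of the third coordinate
    alone. *)
Lemma edge_disc P Q W z r p : det P Q W != 0 -> 0 < r -> 0 < p <= r ->
  disc z r `<=` tri (P, Q, W) ->
  (forall x, odisc (midpoint P Q) p x ->
     (tri (P, Q, W))° x <-> 0 < det P Q x / det P Q W) /\
  (forall x, sqdist x (midpoint P Q) <= p ^+ 2 -> det P Q x = 0 -> segment (P, Q) x).
Proof.
move=> D0 r0 /andP[p0 pr] dT; set m := midpoint P Q; set D := det P Q W.
have [m0 m1 m2] := det_midpoint P Q W; rewrite -/m -/D in m0 m1 m2.
have half P' Q' : det P' Q' m = D / 2 ->
    (forall x, disc z r x -> 0 <= det P' Q' x / D <= 1) ->
    (forall x, sqdist x m <= p ^+ 2 -> 0 <= det P' Q' x / D) /\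
    (forall x, sqdist x m < p ^+ 2 -> 0 < det P' Q' x / D).
  move=> dm bd; pose g : R * R := (- (Q'.2 - P'.2) / D, (Q'.1 - P'.1) / D).
  have E x : det P' Q' x / D = affine 2^-1 g m x.
    rewrite det_quot (affine_recenter _ _ _ m); congr affine.
    by rewrite -det_quot dm; field.
  have [|||h1 h2] := @affine_near_half R 2^-1 g m z r p r0.
  - by rewrite ltW.
  - by move=> x /bd; rewrite E.
  - by rewrite -E dm; field.
  by split=> x; rewrite E; [exact: h1|exact: h2].
have sum1 x : det Q W x / D + det W P x / D + det P Q x / D = 1.
  by rewrite -!mulrDl det_sum divff.
have inT x : disc z r x -> [/\ 0 <= det Q W x / D, 0 <= det W P x / D & 0 <= det P Q x / D].
  by move=> /dT/(triP x D0).
have [a1 a2] := half Q W m1 (fun x dx => ltac:(have [h1 h2 h3] := inT x dx;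
  have h4 := sum1 x; apply/andP; split; lra)).
have [b1 b2] := half W P m2 (fun x dx => ltac:(have [h1 h2 h3] := inT x dx;
  have h4 := sum1 x; apply/andP; split; lra)).
split=> x.
  move=> /(odiscP _ _ p0) xm; split; first by move=> /(tri_interior x D0)[].
  by move=> lx; apply/(tri_interior x D0); split => //; [exact: a2|exact: b2].
move=> xm dx; have ax := a1 x xm; have bx := b1 x xm; have s := sum1 x.
have tx : tri (P, Q, W) x.
  by apply/(triP x D0); split => //; rewrite dx mul0r.
have ab : det W P x / D <= 1 by rewrite dx mul0r in s; lra.
exists (det W P x / D); first by rewrite /= in_itv /= bx.
rewrite /= (_ : 1 - det W P x / D = det Q W x / D); last by rewrite dx mul0r in s; lra.
have dW : det Q W x = D - det W P x by have := det_sum P Q W x; rewrite -/D; lra.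
rewrite [RHS]surjective_pairing /=; congr pair; rewrite /= /GRing.scale /=.
- have e1 : x.1 = det Q W x / D * P.1 + det W P x / D * Q.1 + det P Q x / D * W.1.
    by rewrite /D /det in D0 *; field.
  by rewrite [RHS]e1 dx mul0r mul0r addr0.
- have e2 : x.2 = det Q W x / D * P.2 + det W P x / D * Q.2 + det P Q x / D * W.2.
    by rewrite /D /det in D0 *; field.
  by rewrite [RHS]e2 dx mul0r mul0r addr0.
Qed.

Definition normal P Q : R * R :=
  ((Q.2 - P.2) / edge_length (P, Q), (P.1 - Q.1) / edge_length (P, Q)).

Lemma edge_length_gt0 P Q W : det P Q W != 0 -> 0 < edge_length (P, Q).
Proof.
move=> D0; rewrite /edge_length edistE sqrtr_gt0 /sqdist /= lt_neqAle addr_ge0 ?sqr_ge0// andbT.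
rewrite eq_sym paddr_eq0 ?sqr_ge0// !sqrf_eq0 !subr_eq0.
apply/negP => /andP[/eqP e1 /eqP e2]; move: D0.
by rewrite /det e1 e2 !subrr !mul0r subrr eqxx.
Qed.

Lemma sqr_edge_length P Q : edge_length (P, Q) ^+ 2 = sqdist P Q.
Proof. by rewrite sqr_sqrtr// sqdist_ge0. Qed.

Lemma normal_unit P Q W : det P Q W != 0 ->
  (normal P Q).1 ^+ 2 + (normal P Q).2 ^+ 2 = 1.
Proof.
move=> D0; have l0 := edge_length_gt0 D0.
rewrite /normal /= !expr_div_n -mulrDl sqr_edge_length.
have -> : (Q.2 - P.2) ^+ 2 + (P.1 - Q.1) ^+ 2 = sqdist P Q by rewrite /sqdist; ring.
by rewrite divff// -sqr_edge_length expf_neq0// gt_eqF.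
Qed.

Lemma det_normal P Q W x : det P Q W != 0 ->
  det P Q x = - edge_length (P, Q) * affine 0 (normal P Q) (midpoint P Q) x.
Proof.
move=> D0; have l0 := edge_length_gt0 D0.
rewrite /det /affine /normal /midpoint /=; field.
by rewrite gt_eqF.
Qed.

(** By [det_normal], [normal P Q] points away from [W] exactly when the orientation is positive. *)
Definition inner_normal P Q W : R * R :=
  if 0 < det P Q W then - normal P Q else normal P Q.

Lemma inner_normal_unit P Q W : det P Q W != 0 ->
  (inner_normal P Q W).1 ^+ 2 + (inner_normal P Q W).2 ^+ 2 = 1.
Proof.
by move=> D0; rewrite /inner_normal; case: ifP => _; rewrite /= ?sqrrN;
  exact: normal_unit D0.
Qed.

Lemma inner_normalP P Q W x : det P Q W != 0 ->
  0 < det P Q x / det P Q W <->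
  0 < affine 0 (inner_normal P Q W) (midpoint P Q) x.
Proof.
move=> D0; have l0 := edge_length_gt0 D0.
rewrite (det_normal x D0) /inner_normal.
have [Dp|Dn] := ltP 0 (det P Q W).
  rewrite pmulr_lgt0 ?invr_gt0// affine_opp mulNr -mulrN pmulr_rgt0//.
have Dn' : det P Q W < 0 by rewrite lt_neqAle D0.
by rewrite nmulr_lgt0 ?invr_lt0// mulNr oppr_lt0 pmulr_rgt0.
Qed.

Lemma half_disc_tri P Q W z r p : det P Q W != 0 -> 0 < r -> 0 < p <= r ->
  disc z r `<=` tri (P, Q, W) ->
  half_disc (midpoint P Q) p (inner_normal P Q W) `<=` (tri (P, Q, W))°.
Proof.
move=> D0 r0 pr dT x [Ux lx]; have [h _] := edge_disc D0 r0 pr dT.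
by apply/(h x Ux)/inner_normalP.
Qed.

Lemma half_disc_nonempty m p n : 0 < p -> n.1 ^+ 2 + n.2 ^+ 2 = 1 ->
  half_disc m p n !=set0.
Proof.
move=> p0 n1; exists (m.1 + p / 2 * n.1, m.2 + p / 2 * n.2); split.
  apply/odiscP => //; rewrite /sqdist /=.
  have -> : (m.1 + p / 2 * n.1 - m.1) ^+ 2 + (m.2 + p / 2 * n.2 - m.2) ^+ 2
     = (p / 2) ^+ 2 * (n.1 ^+ 2 + n.2 ^+ 2) by ring.
  rewrite n1 mulr1; have := exprn_gt0 2 p0; rewrite expr_div_n; lra.
rewrite /= /affine /=.
have -> : 0 + n.1 * (m.1 + p / 2 * n.1 - m.1) + n.2 * (m.2 + p / 2 * n.2 - m.2)
  = p / 2 * (n.1 ^+ 2 + n.2 ^+ 2) by ring.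
by rewrite n1 mulr1 divr_gt0.
Qed.

(** A common vertex or edge lies in the zero set of a nonconstant affine function, so by
    [affine_min] it is not a neighbourhood of any point. *)
Lemma conforming_interior T T' : Defs.nondegenerate T -> Defs.nondegenerate T' ->
  conforming T T' -> (tri T)° `&` (tri T')° = set0.
Proof.
move=> nd nd' cf; apply/seteqP; split=> // x [Tx Tx'].
have nx : nbhs x (tri T `&` tri T') by exact: filterI.
case: cf => [E|[z [_ _ E]]|[[P Q] [eT _ E]]]; rewrite E in nx.
- by have := nbhs_singleton nx.
- have pos y : [set z] y -> 0 <= affine 0 (1, 0) z y.
    by move=> ->; rewrite /affine !subrr !mulr0 !addr0.
  have x0 : affine 0 (1, 0) z x = 0.
    by have -> : x = z := nbhs_singleton nx; rewrite /affine !subrr !mulr0 !addr0.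
  by have [/= /eqP] := affine_min nx pos x0; rewrite oner_eq0.
- have [W [_ D0 _]] := has_edgeP nd eT.
  have d0 y : segment (P, Q) y -> det P Q y = 0.
    by move=> [t _ <-]; rewrite /det /= /GRing.scale /=; ring.
  have E1 y : det P Q y = affine 0 (- (Q.2 - P.2), Q.1 - P.1) P y.
    by rewrite /det /affine /=; ring.
  have pos y : segment (P, Q) y -> 0 <= affine 0 (- (Q.2 - P.2), Q.1 - P.1) P y.
    by move=> /d0 dy; rewrite -E1 dy.
  have x0 : affine 0 (- (Q.2 - P.2), Q.1 - P.1) P x = 0.
    by rewrite -E1 d0//; exact: nbhs_singleton nx.
  have [/= h1 h2] := affine_min nx pos x0.
  by move: D0; rewrite /= E1 h1 h2 /affine /= !mul0r !addr0 eqxx.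
Qed.

(** Excludes hanging nodes. If the triangles share an edge, a vertex of [T] in the intersection is
    an end point of it, the opposite vertex being off its line. *)
Lemma conforming_vertex T T' z : Defs.nondegenerate T -> Defs.nondegenerate T' ->
  conforming T T' -> z \in vertices T -> tri T' z -> z \in vertices T'.
Proof.
move=> nd nd' cf zT zT'.
have Tz : tri T z.
  move: zT; case: T {nd cf} => [[A B] C]; have [hA hB hC] := tri_vertex A B C.
  by rewrite !inE => /or3P[] /eqP->.
have Iz : (tri T `&` tri T') z by [].
case: cf => [E|[y [_ yT' E]]|[[P Q] [eT eT' E]]]; rewrite E in Iz.
- by [].
- by rewrite Iz.
- have [W [_ D0 vT]] := has_edgeP nd eT.
  have [W' [_ D0' vT']] := has_edgeP nd' eT'.
  rewrite vT'; move: zT; rewrite vT !inE => /or3P[] /eqP zE; rewrite zE ?eqxx ?orbT//.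
  case: Iz => t _ tE; move: D0; rewrite -zE -tE /det /= /GRing.scale /=.
  by rewrite (_ : _ - _ = 0) ?eqxx//; ring.
Qed.

End MeshGeometry.

(** * Lipschitz and bounded domains *)

Section DomainFacts.
Context {R : realType}.
Implicit Types (Omega : set (plane R)) (x p : R * R).
Local Notation mu := (mu2 R).

(* A boundary point has points below the Lipschitz graph, which are not in the
   closure, arbitrarily near. *)
Lemma interior_closure_lipschitz Omega : open Omega -> lipschitz_boundary Omega ->
  (closure Omega)° `<=` Omega.
Proof.
move=> oO lip p cp; apply: contrapT => nOp.
have bp : boundary Omega p.
  split; first exact: interior_subset.
  by move=> /interior_subset.
have [n [g [L [n1 gL nr]]]] := lip p bp.
have [e e0 he] := nbhs_ball_sub nr.
have [e' e'0 he'] := nbhs_ball_sub cp.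
(* The point [p] is the origin of the local coordinates and does not belong to [Omega]. *)
have g0 : 0 <= g 0.
  rewrite leNgt; apply/negP => g0; apply: nOp; apply/(he p); rewrite ?subrr ?normr0//.
  by rewrite !mul0r subrr addr0.
have n11 : `|n.1| <= 1 by rewrite normr_le_sqr// expr1n; have := sqr_ge0 n.2; lra.
have n21 : `|n.2| <= 1 by rewrite normr_le_sqr// expr1n; have := sqr_ge0 n.1; lra.
pose d := Num.min (e / 2) (e' / 2).
have d0 : 0 < d by rewrite lt_min !divr_gt0.
have de : d <= e / 2 by rewrite ge_min lexx.
have de' : d <= e' / 2 by rewrite ge_min lexx orbT.
pose K := `|L| + 1; have K0 : 1 <= K by rewrite lerDr.
(* Points within [eta] of [q] have height at most [- d + 2 eta], while the graph there is at height
   at least [- 2 |L| eta]. With [d = 4 (|L| + 1) eta] they lie below the graph, although [q] is in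
   the closure. *)
pose eta := d / (4 * K).
have eta0 : 0 < eta by rewrite divr_gt0// mulr_gt0//; lra.
have etaK : eta * (4 * K) = d by rewrite /eta divfK// gt_eqF// mulr_gt0//; lra.
have etad : eta <= d / 4 by nra.
pose q : R * R := (p.1 - d * n.1, p.2 - d * n.2).
have dn k : `|k| <= 1 -> `|d * k| <= d.
  by move=> k1; rewrite normrM gtr0_norm// ler_piMr// ltW.
have cq : closure Omega q.
  by apply: he' => /=; rewrite addrAC subrr add0r normrN;
    (apply: le_lt_trans (dn _ _) _ => //; lra).
have Nq : nbhs q (ball q eta) by exact: nbhsx_ballx.
have [x [Ox [/= qx1 qx2]]] := cq _ Nq.
rewrite /ball /= in qx1 qx2.
set a := q.1 - x.1 in qx1; set b := q.2 - x.2 in qx2.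
have x1 : x.1 - p.1 = - (d * n.1) - a by rewrite /a /q /=; ring.
have x2 : x.2 - p.2 = - (d * n.2) - b by rewrite /b /q /=; ring.
have xp1 : `|x.1 - p.1| < e.
  rewrite x1; apply: (le_lt_trans (ler_normB _ _)); rewrite normrN.
  by have := dn _ n11; lra.
have xp2 : `|x.2 - p.2| < e.
  rewrite x2; apply: (le_lt_trans (ler_normB _ _)); rewrite normrN.
  by have := dn _ n21; lra.
have := (he x xp1 xp2).1 Ox.
have -> : (x.1 - p.1) * n.1 + (x.2 - p.2) * n.2 = - d - (a * n.1 + b * n.2).
  transitivity (- (d * (n.1 ^+ 2 + n.2 ^+ 2)) - (a * n.1 + b * n.2)).
    by rewrite x1 x2; ring.
  by rewrite n1 mulr1.
have -> : (x.1 - p.1) * n.2 - (x.2 - p.2) * n.1 = b * n.1 - a * n.2.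
  by rewrite x1 x2; ring.
have small u v k l : `|u| < eta -> `|v| < eta -> `|k| <= 1 -> `|l| <= 1 ->
    `|u * k + v * l| <= 2 * eta.
  move=> hu hv hk hl; apply: (le_trans (ler_normD _ _)); rewrite !normrM.
  have : `|u| * `|k| <= eta * 1 by apply: ler_pM => //; exact: ltW.
  have : `|v| * `|l| <= eta * 1 by apply: ler_pM => //; exact: ltW.
  lra.
have s1 := small _ _ _ _ qx1 qx2 n11 n21.
have s2 : `|b * n.1 - a * n.2| <= 2 * eta.
  by rewrite -mulrN; apply: small => //; rewrite normrN.
have := gL (b * n.1 - a * n.2, 0) (conj I I); rewrite /= subr0 => h.
move: s1; rewrite ler_norml => /andP[s1 _].
have h2 : `|g (b * n.1 - a * n.2) - g 0| <= `|L| * (2 * eta).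
  apply: (le_trans h); apply: (@le_trans _ _ (`|L| * `|b * n.1 - a * n.2|)).
    by apply: ler_wpM2r => //; exact: ler_norm.
  exact: ler_wpM2l.
move: h2; rewrite ler_norml => /andP[h2 _] h3.
have : (`|L| + 1) * (4 * eta) = d by rewrite -etaK /K; ring.
have : 0 <= `|L| * eta by rewrite mulr_ge0// ltW.
nra.
Qed.

Lemma bounded_sub_box Omega : bounded_set Omega ->
  exists2 N : R, 0 < N & closure Omega `<=` box 0 N.
Proof.
move=> [M [_ hM]]; exists (`|M| + 1); first by have := normr_ge0 M; lra.
have sub : Omega `<=` box 0 (`|M| + 1).
  move=> x Ox; have := hM (`|M| + 1) _ x Ox; have := ler_norm M => h1 h2.
  apply/box0P; have : `|x| <= `|M| + 1 by apply: h2; lra.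
  by rewrite prod_normE ge_max => /andP[].
rewrite (closure_id (box 0 (`|M| + 1))).1; last exact: closed_box.
exact: closureS.
Qed.

End DomainFacts.

(** * Element and edge estimates *)

Section WeakPair.
Context {R : realType}.
Implicit Types (Omega : set (plane_m R)) (x p : R * R) (A B : 'M[R]_2).
Local Notation mu := (mu2 R).

Lemma dot2E A B : dot A B = A 0 0 * B 0 0 + A 0 1 * B 0 1 + (A 1 0 * B 1 0 + A 1 1 * B 1 1).
Proof.
rewrite /dot !big_ord_recl !big_ord0 !addr0.
by rewrite (_ : lift ord0 ord0 = 1)//; exact/val_inj.
Qed.

Lemma dotc2E (u v : 'cV[R]_2) : dot u v = u 0 0 * v 0 0 + u 1 0 * v 1 0.
Proof.
rewrite /dot !big_ord_recl !big_ord0 !addr0.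
by rewrite (_ : lift ord0 ord0 = 1)//; exact/val_inj.
Qed.

Lemma ord2 (i : 'I_2) : i = 0 \/ i = 1.
Proof. by case: i => -[|[|//]] ij; [left|right]; apply/val_inj. Qed.

Lemma JmxE (i j : 'I_2) : (Jmx : 'M[R]_2) i j = (i < j)%N%:R - (j < i)%N%:R.
Proof. by rewrite mxE. Qed.

Lemma rpartE A i j : rpart A i j = (A i j + A j i) / 2.
Proof.
rewrite /rpart dot2E !mxE /=.
by case: (ord2 i) => ->; case: (ord2 j) => -> /=; field.
Qed.

Lemma rpart_dot_le A : dot (rpart A) (rpart A) <= dot A A.
Proof.
rewrite !dot2E !rpartE; have := sqr_ge0 (A 0 1 - A 1 0); nra.
Qed.

Lemma eigen_weak_pair Omega (mu0 lam N : R) sigma u : measurable Omega ->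
  0 < fine (mu Omega) -> Omega `<=` box 0 N -> (mu Omega < +oo)%E ->
  eigensolution Omega mu0 (H0 Omega) (Q Omega) lam sigma u ->
  forall i, weak_pair Omega (fun j x => mu0^-1 * rpart (sigma x) i j) (fun x => u x i 0).
Proof.
move=> mO O0 ON Ooo [[[Ls _] _] Lu _ weq _] i.
have si a b : square_integrable mu Omega (fun x => sigma x a b) by exact: (Ls a b).
have ui : square_integrable mu Omega (fun x => u x i 0) by exact: (Lu i 0).
have ri j : square_integrable mu Omega (fun x => rpart (sigma x) i j).
  have -> : (fun x => rpart (sigma x) i j) = (fun x => 2^-1 * (sigma x i j + sigma x j i)).
    by apply/funext => x; rewrite rpartE mulrC.
  by apply: square_integrableZ => //; exact: square_integrableD.
split => //; first by move=> j; exact: square_integrableZ.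
move=> t k ti ki sc.
pose tau0 x : 'M[R]_2 := \matrix_(a < 2, b < 2) (if a == i then t b x else 0).
pose c x : 'cV[R]_2 := \col_(a < 2) (if a == i then k x else 0).
(* The factor 2 is [dot Jmx Jmx]; this multiple of [Jmx] brings the skew mean to zero. *)
pose k0 := \int[mu]_(x in Omega) dot (tau0 x) Jmx / (2 * fine (mu Omega)).
pose tau x := tau0 x - k0 *: Jmx.
have cst_si (b : R) : square_integrable mu Omega (fun=> b).
  by apply: (@square_integrable_bounded _ _ _ mu _ _ `|b|).
have cst_i (b : R) : integrableR mu Omega (fun=> b).
  by apply: (@integrable_bounded _ _ _ mu _ _ `|b|).
have t0i a b : square_integrable mu Omega (fun x => tau0 x a b).
  have -> : (fun x => tau0 x a b) = fun x => if a == i then t b x else 0.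
    by apply/funext => x; rewrite mxE.
  by case: (a == i).
have taui : L2 Omega tau.
  move=> a b; suff : square_integrable mu Omega (fun x => tau x a b) by [].
  have -> : (fun x => tau x a b) = fun x => tau0 x a b - k0 * (Jmx : 'M[R]_2) a b.
    by apply/funext => x; rewrite !mxE.
  exact: square_integrableB.
have Lc : L2 Omega c.
  move=> a b; suff : square_integrable mu Omega (fun x => c x a b) by [].
  have -> : (fun x => c x a b) = fun x => if a == i then k x else 0.
    by apply/funext => x; rewrite mxE.
  by case: (a == i).
have wc : weak_curl Omega tau c.
  move=> phi hphi a; have Cphi := test_function_C1 hphi.
  have [K [_ KO K0]] := test_function_out hphi.
  have out x : ~ Omega x -> phi x = 0 /\ forall j, partial j phi x = 0.
    by move=> nO; apply: K0 => /KO.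
  have phi0 x : ~ box 0 N x -> phi x = 0 by move=> nb; apply: (out x _).1 => /ON.
  have [_ cphi _] := Cphi.
  (* The weak curl of a constant field vanishes, so the shift does not change the curl. *)
  have dphi j : \int[mu]_(x in Omega) partial j phi x = 0.
    rewrite -[RHS](integral_C1_supp Cphi phi0 j).
    rewrite [RHS](@Rintegral0_out _ _ _ mu Omega [set: plane_m R])//.
    by move=> x _ /out[_ ->].
  have sphi j : square_integrable mu Omega (partial j phi).
    exact: (square_integrable_continuous_supp mO Ooo (cphi j) (C1_supp Cphi phi0 j)).
  have iphi j : integrableR mu Omega (partial j phi).
    exact: (integrable_continuous_suppS mO (cphi j) (C1_supp Cphi phi0 j)).
  have main : \int[mu]_(x in Omega) (c x a 0 * phi x)
      = - \int[mu]_(x in Omega) (tau0 x a 1 * partial 0 phi x - tau0 x a 0 * partial 1 phi x).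
    have [->|ai] := eqVneq a i.
      have := sc phi hphi; rewrite [X in X = _ -> _](_ : _ = \int[mu]_(x in Omega) (k x * phi x))//.
      move=> h; transitivity (\int[mu]_(x in Omega) (k x * phi x)).
        by apply: eq_Rintegral => x _; rewrite mxE eqxx.
      rewrite h; congr (- _); apply: eq_Rintegral => x _.
      by rewrite !mxE eqxx.
    rewrite !Rintegral0 ?oppr0// => x _; rewrite !mxE (negbTE ai) ?mul0r//.
    by rewrite subrr.
  suff E : \int[mu]_(x in Omega) (tau x a 1 * partial 0 phi x - tau x a 0 * partial 1 phi x)
      = \int[mu]_(x in Omega) (tau0 x a 1 * partial 0 phi x - tau0 x a 0 * partial 1 phi x).
    by rewrite [LHS]main -E.
  transitivity (\int[mu]_(x in Omega) ((tau0 x a 1 * partial 0 phi x - tau0 x a 0 * partial 1 phi x)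
     - ((k0 * (Jmx : 'M[R]_2) a 1) * partial 0 phi x - (k0 * (Jmx : 'M[R]_2) a 0) * partial 1 phi x))).
    by apply: eq_Rintegral => x _; rewrite /tau !mxE; ring.
  have i1 : integrableR mu Omega (fun x => tau0 x a 1 * partial 0 phi x - tau0 x a 0 * partial 1 phi x).
    by apply: integrableRB => //; apply: integrableRM.
  have i2 : integrableR mu Omega (fun x => (k0 * (Jmx : 'M[R]_2) a 1) * partial 0 phi x
      - (k0 * (Jmx : 'M[R]_2) a 0) * partial 1 phi x).
    by apply: integrableRB => //; apply: integrableRZ => //; exact: iphi.
  rewrite RintegralB// [X in _ - X]RintegralB//;
    [|by apply: integrableRZ => //; exact: iphi ..].
  rewrite !RintegralZl//; try exact: iphi.
  by rewrite !dphi !mulr0 !subr0.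
have i0 : integrableR mu Omega (fun x => dot (tau0 x) Jmx).
  have -> : (fun x => dot (tau0 x) Jmx) = fun x => tau0 x 0 1 * 1 - tau0 x 1 0 * 1.
    by apply/funext => x; rewrite dot2E !JmxE /=; ring.
  by apply: integrableRB => //; apply: integrableRM.
have msf : mean_skew_free Omega tau.
  rewrite /mean_skew_free; transitivity (\int[mu]_(x in Omega) (dot (tau0 x) Jmx - 2 * k0)).
    by apply: eq_Rintegral => x _; rewrite /tau !dot2E !mxE /=; ring.
  rewrite RintegralB//; last exact: cst_i.
  rewrite [X in _ - X](Rintegral_cst mu mO) /k0.
  by field; rewrite gt_eqF.
have Htau : H0 Omega tau by split => //; split => //; exists c.
have := weq tau c Htau Lc wc.
rewrite /aform (_ : L2dot Omega u c = \int[mu]_(x in Omega) (u x i 0 * k x)); last first.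
  apply: eq_Rintegral => x _; rewrite dotc2E !mxE.
  by case: (ord2 i) => -> /=; rewrite ?mulr0 ?addr0 ?add0r.
(* The shift is annihilated by [rpart], and the symmetric [rpart (sigma x)] pairs with
   [rpart (tau0 x)] as with [tau0 x] itself. *)
rewrite (_ : L2dot Omega (fun x => rpart (sigma x)) (fun x => rpart (tau x)) =
  \int[mu]_(x in Omega) (rpart (sigma x) i 0 * t 0 x + rpart (sigma x) i 1 * t 1 x)); last first.
  apply: eq_Rintegral => x _; rewrite dot2E !rpartE !mxE /=.
  by case: (ord2 i) => -> /=; field.
rewrite -RintegralZl//; last by apply: integrableRD => //; exact: integrableRM.
move=> h; rewrite -[RHS]h; congr (_ + _).
by apply: eq_Rintegral => x _; ring.
Qed.

End WeakPair.

(** * Shape-regular triangles *)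

Section ElementBounds.
Context {R : realType}.
Implicit Types (Omega : set (plane_m R)) (x y z p : R * R) (T : triangle R) (D : set (plane_m R)).
Local Notation mu := (mu2 R).

Lemma dot_ge0 m n (A : 'M[R]_(m, n)) : 0 <= dot A A.
Proof. by apply: sumr_ge0 => i _; apply: sumr_ge0 => j _; rewrite -expr2 sqr_ge0. Qed.

Lemma L2norm_sqr D m n (F : plane R -> 'M[R]_(m, n)) :
  L2norm D F ^+ 2 = \int[mu]_(x in D) dot (F x) (F x).
Proof. by rewrite sqr_sqrtr//; apply: Rintegral_ge0 => x _; exact: dot_ge0. Qed.

Lemma Rintegral_le_bound D (f : plane_m R -> R) (B A : R) : measurable D ->
  (mu D <= A%:E)%E -> measurable_fun D f -> (forall x, D x -> 0 <= f x <= B) ->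
  0 <= B -> \int[mu]_(x in D) f x <= B * A.
Proof.
move=> mD DA mf fB B0; have Doo : (mu D < +oo)%E by apply: le_lt_trans DA (ltry _).
apply: (@le_trans _ _ (\int[mu]_(x in D) B)).
  apply: le_Rintegral => //.
  - apply: (@integrable_bounded _ _ _ mu _ _ B) => // x /fB/andP[f0 fb].
    by rewrite ger0_norm.
  - by apply: (@integrable_bounded _ _ _ mu _ _ `|B|).
  - by move=> x /fB/andP[].
rewrite Rintegral_cst//; apply: ler_wpM2l => //.
by rewrite -lee_fin fineK// ge0_fin_numE.
Qed.

Lemma edist_ge_coord x y : `|x.1 - y.1| <= Defs.edist x y /\ `|x.2 - y.2| <= Defs.edist x y.
Proof.
have h1 := sqr_ge0 (x.1 - y.1); have h2 := sqr_ge0 (x.2 - y.2).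
by split; rewrite normr_le_sqr ?edistE ?sqrtr_ge0// sqr_sqrtr ?sqdist_ge0// /sqdist; lra.
Qed.

Lemma edist_le_diam T (N : R) x y : tri T `<=` box 0 N -> tri T x -> tri T y ->
  Defs.edist x y <= diam (tri T).
Proof.
move=> TN Tx Ty; apply: ub_le_sup; last by exists x => //; exists y.
exists (4 * N) => _ [a Ta [b Tb <-]].
have /box0P[a1 a2] := TN a Ta; have /box0P[b1 b2] := TN b Tb.
have N0 : 0 <= N by apply: le_trans a1.
have m4 : 0 <= 4 * N by rewrite mulr_ge0.
rewrite edistE -(ger0_norm m4) -sqrtr_sqr ler_wsqrtr// /sqdist.
have bd (s t : R) : `|s| <= N -> `|t| <= N -> (s - t) ^+ 2 <= 4 * N ^+ 2.
  move=> hs ht; have : `|s - t| <= 2 * N.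
    by apply: (le_trans (ler_normB _ _)); lra.
  by rewrite normr_le_sqr ?mulr_ge0//; nra.
by have := bd _ _ a1 b1; have := bd _ _ a2 b2; nra.
Qed.

Definition affine_on D (F : tfield R) (c : 'I_2 -> 'I_2 -> R) (g : 'I_2 -> 'I_2 -> R * R) :=
  forall x, D x -> forall i j, F x i j = affine (c i j) (g i j) (0, 0) x.

Lemma size2_scale (c : R) (g : R * R) (r k : R) :
  size2 c g (k * r) <= (1 + k ^+ 2) * size2 c g r.
Proof.
rewrite /size2; have := sqr_ge0 c; have := sqr_ge0 g.1; have := sqr_ge0 g.2.
move=> h2 h1 h0; set G := g.1 ^+ 2 + g.2 ^+ 2.
have G0 : 0 <= G by exact: addr_ge0.
have := mulr_ge0 (sqr_ge0 r) G0; have := mulr_ge0 (sqr_ge0 k) h0.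
rewrite exprMn; nra.
Qed.

(** An inscribed disc of centre [z] and radius [r]; all local constants will depend on [kappa] and
    the size [N] of the domain only. *)
Record shape Omega T (kappa N : R) z r : Prop := Shape {
  shape_gt0 : 0 < r;
  shape_disc : disc z r `<=` tri T;
  shape_diam : diam (tri T) <= kappa * r;
  shape_box : tri T `<=` box 0 N;
  shape_sub : (tri T)° `<=` Omega }.

Lemma shape_odisc Omega T kappa N z r : shape Omega T kappa N z r -> odisc z r `<=` (tri T)°.
Proof. by case=> r0 dT _ _ _; exact: odisc_sub_interior. Qed.

Lemma shape_center Omega T kappa N z r : shape Omega T kappa N z r -> tri T z.
Proof.
case=> r0 dT _ _ _; apply: dT; apply/discP; first exact: ltW.
by rewrite /sqdist !subrr expr0n addr0 exprn_ge0// ltW.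
Qed.

Lemma shape_dist Omega T kappa N z r x : shape Omega T kappa N z r -> tri T x ->
  `|x.1 - z.1| <= kappa * r /\ `|x.2 - z.2| <= kappa * r.
Proof.
move=> sh Tx; have [r0 dT dk TN _] := sh.
have h := le_trans (edist_le_diam TN Tx (shape_center sh)) dk.
by have [h1 h2] := edist_ge_coord x z; split; exact: le_trans h.
Qed.

Lemma shape_kappa Omega T kappa N z r : shape Omega T kappa N z r -> 0 < kappa * r.
Proof.
move=> sh; have [r0 dT dk TN _] := sh.
have Tx : tri T (z.1 + r, z.2).
  apply: dT; apply/discP; first exact: ltW.
  by rewrite /sqdist /= subrr expr0n addr0 addrAC subrr add0r.
have [/= + _] := shape_dist sh Tx.
by rewrite addrAC subrr add0r gtr0_norm//; exact: lt_le_trans.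
Qed.

(** The weight [r^2] on the tensor error in [interior_residual] becomes the constant [N^2]. *)
Lemma shape_r_le Omega T kappa N z r : shape Omega T kappa N z r -> r <= N.
Proof.
move=> [r0 dT _ TN _].
have Tp (e : R) : e ^+ 2 = 1 -> `|z.1 + e * r| <= N.
  move=> e1; have /TN/box0P[] : tri T (z.1 + e * r, z.2); last by [].
  apply: dT; apply/discP; first exact: ltW.
  by rewrite /sqdist /= subrr expr0n addr0 addrAC subrr add0r exprMn e1 mul1r.
have := Tp 1 (expr1n _ _); have := Tp (-1); rewrite sqrrN expr1n => /(_ erefl).
rewrite !ler_norml => /andP[h1 h2] /andP[h3 h4]; lra.
Qed.

Lemma measurable_tri_interior T : @measurable _ (plane_m R) (tri T)°.
Proof. exact: (open_measurable2 (@open_interior _ _)). Qed.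

Lemma shape_area Omega T kappa N z r : shape Omega T kappa N z r ->
  (mu (tri T)° <= (4 * (kappa * r) ^+ 2)%:E)%E.
Proof.
move=> sh; have k0 := shape_kappa sh.
apply: (@leb2_sub_box _ _ z); [exact: measurable_tri_interior|exact: ltW|].
by move=> x /interior_subset/(shape_dist sh) h; apply/boxP.
Qed.

Lemma sqr_affine_integral_le Omega T kappa N z r (c : R) (g : R * R) :
  shape Omega T kappa N z r ->
  \int[mu]_(x in (tri T)°) affine c g z x ^+ 2
  <= 12 * (1 + kappa ^+ 2) * (kappa * r) ^+ 2 * size2 c g r.
Proof.
move=> sh; have k0 := shape_kappa sh; have mT := measurable_tri_interior T.
have B0 : 0 <= 3 * ((1 + kappa ^+ 2) * size2 c g r).
  by apply: mulr_ge0 => //; apply: mulr_ge0; [rewrite addr_ge0 ?sqr_ge0|exact: size2_ge0].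
have -> : 12 * (1 + kappa ^+ 2) * (kappa * r) ^+ 2 * size2 c g r
  = 3 * ((1 + kappa ^+ 2) * size2 c g r) * (4 * (kappa * r) ^+ 2) by ring.
apply: Rintegral_le_bound => //; first exact: (shape_area sh).
  apply: measurable_funX.
  exact: (measurable_funTS (continuous_measurable2 (@continuous_affine _ c g z))).
move=> x /interior_subset/(shape_dist sh)[h1 h2]; rewrite sqr_ge0 /=.
apply: (le_trans (affine_bound c g k0 h1 h2)).
by rewrite ler_pM2l//; exact: size2_scale.
Qed.

End ElementBounds.

(** * Element terms of the estimator *)

Section ElementResiduals.
Context {R : realType}.
Implicit Types (Omega : set (plane_m R)) (x y z m : R * R) (T : triangle R) (D E : set (plane_m R)).
Implicit Types (S F : tfield R) (c : 'I_2 -> 'I_2 -> R) (g : 'I_2 -> 'I_2 -> R * R).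
Local Notation mu := (mu2 R).

Definition field_si n D (G : plane_m R -> 'M[R]_(2, n)) :=
  forall i j, square_integrable mu D (fun x => G x i j).

Definition sqnorm n D (G : plane_m R -> 'M[R]_(2, n)) := \int[mu]_(x in D) dot (G x) (G x).

Lemma dot_integrable n D (G : plane_m R -> 'M[R]_(2, n)) : measurable D -> field_si D G ->
  integrableR mu D (fun x => dot (G x) (G x)).
Proof.
move=> mD hG; rewrite /dot /integrableR.
have -> : EFin \o (fun x => \sum_(i < 2) \sum_(j < n) G x i j * G x i j) =
    fun x => (\sum_(i < 2) \sum_(j < n) (G x i j ^+ 2)%:E)%E.
  apply/funext => x /=; rewrite -sumEFin; apply: eq_bigr => i _.
  by rewrite -sumEFin; apply: eq_bigr => j _; rewrite expr2.
apply: integrable_sum => // i _; apply: integrable_sum => // j _.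
exact: (hG i j).2.
Qed.

Lemma sqnorm_ge0 n D (G : plane_m R -> 'M[R]_(2, n)) : 0 <= sqnorm D G.
Proof. by apply: Rintegral_ge0 => x _; exact: dot_ge0. Qed.

Lemma sqnorm_subset n D E (G : plane_m R -> 'M[R]_(2, n)) : measurable D -> measurable E ->
  D `<=` E -> field_si E G -> sqnorm D G <= sqnorm E G.
Proof.
move=> mD mE DE hG; apply: ge0_subset_Rintegral => //; first exact: dot_integrable.
by move=> x _; exact: dot_ge0.
Qed.

Lemma field_siS n D E (G : plane_m R -> 'M[R]_(2, n)) : measurable D -> measurable E ->
  D `<=` E -> field_si E G -> field_si D G.
Proof. by move=> mD mE DE hG i j; apply: (square_integrableS mD mE DE). Qed.

Lemma field_siB n D (G H : plane_m R -> 'M[R]_(2, n)) : measurable D ->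
  field_si D G -> field_si D H -> field_si D (fun x => G x - H x).
Proof.
move=> mD hG hH i j; rewrite (_ : (fun x => _) = fun x => G x i j - H x i j).
  exact: square_integrableB.
by apply/funext => x; rewrite !mxE.
Qed.

(** Discrete fields are recorded with base point at the origin, common to all elements; this moves
    the base point to the disc in use. *)
Definition rcoef c g m (i j : 'I_2) : R := affine (c i j) (g i j) (0, 0) m.

Lemma sum2 (f : 'I_2 -> R) : \sum_(i < 2) f i = f 0 + f 1.
Proof.
rewrite !big_ord_recl big_ord0 addr0.
by rewrite (_ : lift ord0 ord0 = 1)//; exact/val_inj.
Qed.

Lemma sqnorm_dist2 D S F c g m : measurable D -> affine_on D F c g ->
  field_si D (fun x => S x - F x) ->
  \sum_(i < 2) dist2 D (fun j x => S x i j) (rcoef c g m i) (g i) m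
  = sqnorm D (fun x => S x - F x).
Proof.
move=> mD FA hSF; rewrite /sqnorm.
have h i j : integrableR mu D (fun x => (S x i j - F x i j) ^+ 2).
  have := (hSF i j).2; rewrite (_ : (fun x => _) = fun x => ((S x i j - F x i j) ^+ 2)%:E)//.
  by apply/funext => x; rewrite !mxE.
have hh i : integrableR mu D (fun x => (S x i 0 - F x i 0) ^+ 2 + (S x i 1 - F x i 1) ^+ 2).
  exact: (integrableRD mD (h i 0) (h i 1)).
transitivity (\int[mu]_(x in D) ((S x 0 0 - F x 0 0) ^+ 2 + (S x 0 1 - F x 0 1) ^+ 2
  + ((S x 1 0 - F x 1 0) ^+ 2 + (S x 1 1 - F x 1 1) ^+ 2))); last first.
  by apply: eq_Rintegral => x _; rewrite dot2E !mxE -!expr2.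
rewrite RintegralD//; [|exact: (hh 0)|exact: (hh 1)].
rewrite sum2; congr (_ + _); (rewrite RintegralD//; [|exact: h|exact: h]);
  rewrite /dist2; congr (_ + _); apply: eq_Rintegral => x /set_mem Dx;
  by rewrite (FA x Dx) -affine_recenter.
Qed.

Lemma affine_on_subset D E F c g : D `<=` E -> affine_on E F c g -> affine_on D F c g.
Proof. by move=> DE h x /DE; exact: h. Qed.

Lemma weak_pair_row_si Omega S (u : vfield R) :
  (forall i, weak_pair Omega (fun j x => S x i j) (fun x => u x i 0)) ->
  field_si Omega S /\ field_si Omega u.
Proof.
move=> h; split=> i j; first by have [hs _ _] := h i; exact: hs.
by have [_ hu _] := h i; rewrite (ord1 j).
Qed.

Lemma affine_on_si Omega T kappa N z r F c g : shape Omega T kappa N z r ->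
  affine_on (tri T)° F c g -> field_si (tri T)° F.
Proof.
move=> sh FA i j; have mT := measurable_tri_interior T.
have k0 := shape_kappa sh.
have [Doo DA] : (mu (tri T)° < +oo)%E /\ True.
  by split=> //; apply: le_lt_trans (shape_area sh) (ltry _).
have bd x : (tri T)° x -> `|affine (c i j) (g i j) (0, 0) x|
    <= Num.sqrt (3 * size2 (rcoef c g z i j) (g i j) (kappa * r)).
  move=> /interior_subset/(shape_dist sh)[h1 h2].
  rewrite normr_le_sqr ?sqrtr_ge0// sqr_sqrtr; last by rewrite mulr_ge0// size2_ge0.
  by rewrite (affine_recenter _ _ _ z); exact: affine_bound.
have ma : measurable_fun (tri T)° (fun x => F x i j).
  apply: (@eq_measurable_fun _ _ _ _ _ (affine (c i j) (g i j) (0, 0))).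
    by move=> x /set_mem Tx; rewrite (FA x Tx).
  exact: (measurable_funTS (continuous_measurable2 (@continuous_affine _ _ _ _))).
apply: (square_integrable_bounded mT Doo ma) => x Tx.
by rewrite (FA x Tx); exact: bd.
Qed.

Lemma element_residual (kappa N : R) : 0 < kappa -> 0 < N -> exists2 C : R, 0 < C &
  forall Omega S (u : vfield R) F (uh : vfield R) T z r c g (a : 'I_2 -> R),
  measurable Omega -> (mu Omega < +oo)%E ->
  (forall i, weak_pair Omega (fun j x => S x i j) (fun x => u x i 0)) ->
  shape Omega T kappa N z r -> affine_on (tri T)° F c g ->
  (forall x, (tri T)° x -> forall i, uh x i 0 = a i) ->
  diam (tri T) ^+ 2 * L2norm (tri T)° (fun x => ecurl uh x - F x) ^+ 2
  <= C * (sqnorm (tri T)° (fun x => S x - F x) + sqnorm (tri T)° (fun x => u x - uh x)).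
Proof.
move=> ka0 N0; have [CA CA0 hA] := @interior_residual R.
(* [sqr_affine_integral_le] passes from the disc to the triangle, the squared diameter adds a factor
   [kappa^2 r^2], and [1 + N^2] absorbs the weight [r^2]. *)
exists (12 * (1 + kappa ^+ 2) * kappa ^+ 4 * CA * (1 + N ^+ 2)).
  by rewrite !mulr_gt0// ?ltr_pwDl ?sqr_ge0// exprn_gt0.
move=> Omega S u F uh T z r c g a mO Ooo wp sh FA ua.
have [r0 dT dk TN TO] := sh; have k0 := shape_kappa sh.
have mT := measurable_tri_interior T; have mU := measurable_odisc z r.
have UT := shape_odisc sh.
have [sS su] := weak_pair_row_si wp.
have FT := affine_on_si sh FA.
have SFT : field_si (tri T)° (fun x => S x - F x).
  by apply: field_siB => //; exact: (field_siS mT mO TO).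
have Toi : (mu (tri T)° < +oo)%E by apply: le_lt_trans (shape_area sh) (ltry _).
have uhT : field_si (tri T)° uh.
  move=> i j; rewrite (ord1 j); apply: (@square_integrable_bounded _ _ _ mu _ _ `|a i|) => //.
    apply: (@eq_measurable_fun _ _ _ _ _ (fun=> a i)) => //.
    by move=> x /set_mem Tx; rewrite (ua x Tx).
  by move=> x Tx; rewrite (ua x Tx).
have uuT : field_si (tri T)° (fun x => u x - uh x).
  by apply: field_siB => //; exact: (field_siS mT mO TO).
(* The discrete [uh] is constant near each interior point, so its elementwise curl vanishes. *)
have ec x : (tri T)° x -> ecurl uh x = 0.
  move=> Tx; have d0 i j : partial j (fun y => uh y i 0) x = 0.
    rewrite /partial -(@near_eq_derive R (R * R)%type R (fun=> a i)).
      exact: derive_cst.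
    near=> y; rewrite (ua y)//; near: y.
    by apply: open_nbhs_nbhs; split => //; exact: open_interior.
  by apply/matrixP => i j; rewrite !mxE !d0 oppr0 if_same.
rewrite L2norm_sqr.
have -> : \int[@leb2 R]_(x in (tri T)°) dot (ecurl uh x - F x) (ecurl uh x - F x)
   = \sum_(i < 2) (\int[mu]_(x in (tri T)°) affine (rcoef c g z i 0) (g i 0) z x ^+ 2
     + \int[mu]_(x in (tri T)°) affine (rcoef c g z i 1) (g i 1) z x ^+ 2).
  have := sqnorm_dist2 (S := fun=> 0) z mT FA.
  have zT : field_si (tri T)° (fun x => (0 : 'M[R]_2) - F x).
    apply: field_siB => // i j.
    by apply: (@square_integrable_bounded _ _ _ mu _ _ 0) => // x _; rewrite mxE normr0.
  move=> /(_ zT) h; transitivity (sqnorm (tri T)° (fun x => (0 : 'M[R]_2) - F x)).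
    by apply: eq_Rintegral => x /set_mem Tx; rewrite ec.
  rewrite -h; apply: eq_bigr => i _; rewrite /dist2; congr (_ + _);
    by apply: eq_Rintegral => x _; rewrite mxE sub0r sqrrN.
have PA i := hA Omega _ _ z r (rcoef c g z i) (g i) (a i) mO Ooo (wp i) r0
  (subset_trans UT TO).
have uU i : integrableR mu (odisc z r) (fun x => (u x i 0 - a i) ^+ 2).
  have := (uuT i 0).2 => h; have {h} := integrableS mT mU UT h.
  move=> h; refine (eq_integrable mU _ _ _ h) => x /set_mem Ux /=.
  by rewrite !mxE (ua x (UT x Ux)).
have duU : \sum_(i < 2) \int[mu]_(x in odisc z r) (u x i 0 - a i) ^+ 2
    = sqnorm (odisc z r) (fun x => u x - uh x).
  rewrite sum2 -RintegralD//; [|exact: (uU 0)|exact: (uU 1)].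
  apply: eq_Rintegral => x /set_mem Ux.
  by rewrite dotc2E !mxE -!expr2 !(ua x (UT x Ux)).
have SFU := field_siS mU mT UT SFT.
have ES : \sum_(i < 2) dist2 (odisc z r) (fun j x => S x i j) (rcoef c g z i) (g i) z
    <= sqnorm (tri T)° (fun x => S x - F x).
  rewrite (sqnorm_dist2 z mU (affine_on_subset UT FA) SFU).
  exact: sqnorm_subset.
have EU := sqnorm_subset mU mT UT uuT.
set es := sqnorm _ _ in ES *; set eu := sqnorm (tri T)° (fun x => u x - uh x) in EU *.
have es0 : 0 <= es by exact: sqnorm_ge0. have eu0 : 0 <= eu by exact: sqnorm_ge0.
pose s2 i := size2 (rcoef c g z i 0) (g i 0) r + size2 (rcoef c g z i 1) (g i 1) r.
have s20 i : 0 <= s2 i by rewrite addr_ge0// size2_ge0.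
have rN : r ^+ 2 <= N ^+ 2 by rewrite ler_pXn2r ?nnegrE ?(shape_r_le sh)// ltW.
have r2 : 0 <= r ^+ 2 by exact: sqr_ge0.
have sum4 : r ^+ 4 * (s2 0 + s2 1) <= CA * ((1 + N ^+ 2) * (es + eu)).
  have := PA 0; have := PA 1; rewrite -/(s2 0) -/(s2 1) => h1 h0.
  rewrite sum2 in duU; rewrite sum2 in ES.
  set d0 := dist2 _ _ _ _ _ in h0 ES; set d1 := dist2 _ _ _ _ _ in h1 ES.
  set e0 := Rintegral _ _ _ in h0 duU; set e1 := Rintegral _ _ _ in h1 duU.
  have e01 : e0 + e1 <= eu by rewrite duU.
  apply: (@le_trans _ _ (CA * (r ^+ 2 * (d0 + d1) + (e0 + e1)))); first by lra.
  rewrite ler_pM2l//.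
  have p1 : r ^+ 2 * (d0 + d1) <= N ^+ 2 * es.
    apply: (@le_trans _ _ (r ^+ 2 * es)); first exact: ler_wpM2l.
    exact: ler_wpM2r.
  have p2 : 0 <= N ^+ 2 * eu by rewrite mulr_ge0 ?sqr_ge0.
  by lra.
have q i j := sqr_affine_integral_le (rcoef c g z i j) (g i j) sh.
have dm0 : 0 <= diam (tri T).
  have := edist_le_diam TN (shape_center sh) (shape_center sh).
  by apply: le_trans; rewrite edistE sqrtr_ge0.
have dm2 : diam (tri T) ^+ 2 <= (kappa * r) ^+ 2 by rewrite ler_pXn2r ?nnegrE// ltW.
set X := \sum_(i < 2) _.
have X0 : 0 <= X by apply: sumr_ge0 => i _; apply: addr_ge0; exact: int_sq_ge0.
have XB : X <= 12 * (1 + kappa ^+ 2) * (kappa * r) ^+ 2 * (s2 0 + s2 1).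
  rewrite /X sum2; have := q 0 0; have := q 0 1; have := q 1 0; have := q 1 1.
  rewrite /s2; lra.
apply: (@le_trans _ _ ((kappa * r) ^+ 2 * X)); first exact: ler_wpM2r.
apply: (@le_trans _ _ ((kappa * r) ^+ 2 * (12 * (1 + kappa ^+ 2) * (kappa * r) ^+ 2 * (s2 0 + s2 1)))).
  by apply: ler_wpM2l => //; exact: sqr_ge0.
have -> : (kappa * r) ^+ 2 * (12 * (1 + kappa ^+ 2) * (kappa * r) ^+ 2 * (s2 0 + s2 1))
  = 12 * (1 + kappa ^+ 2) * kappa ^+ 4 * (r ^+ 4 * (s2 0 + s2 1)) by ring.
rewrite -[leRHS]mulrA -[leRHS]mulrA; apply: ler_wpM2l => //.
apply: mulr_ge0; last by apply: exprn_ge0; exact: ltW.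
by apply: mulr_ge0 => //; apply: addr_ge0 => //; exact: sqr_ge0.
Unshelve. all: by end_near. Qed.

(** The first bound is a term of the indicator, with the factor [4 kappa^4] for the passage to the
    triangle. The second, on the coefficients, absorbs the divergence terms of the edge
    estimates. *)
Lemma element_div (kappa N : R) : 0 < kappa -> exists2 C : R, 0 < C &
  forall Omega S (u : vfield R) F T z r c g,
  measurable Omega -> (mu Omega < +oo)%E ->
  (forall i, weak_pair Omega (fun j x => S x i j) (fun x => u x i 0)) ->
  shape Omega T kappa N z r -> affine_on (tri T)° F c g ->
  diam (tri T) ^+ 2 * L2norm (tri T)° (ediv F) ^+ 2
     <= C * sqnorm (tri T)° (fun x => S x - F x)
  /\ r ^+ 4 * \sum_(i < 2) ((g i 0).1 + (g i 1).2) ^+ 2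
     <= C * sqnorm (tri T)° (fun x => S x - F x).
Proof.
move=> ka0; have [CB CB0 hB] := @interior_div R.
exists ((4 * kappa ^+ 4 + 1) * CB).
  by rewrite mulr_gt0// ltr_wpDl// mulr_ge0// exprn_ge0// ltW.
move=> Omega S u F T z r c g mO Ooo wp sh FA.
have [r0 dT dk TN TO] := sh; have k0 := shape_kappa sh.
have mT := measurable_tri_interior T; have mU := measurable_odisc z r.
have UT := shape_odisc sh.
have [sS _] := weak_pair_row_si wp.
have FT := affine_on_si sh FA.
have SFT : field_si (tri T)° (fun x => S x - F x).
  by apply: field_siB => //; exact: (field_siS mT mO TO).
have SFU := field_siS mU mT UT SFT.
have PB i := hB Omega _ _ z r (rcoef c g z i) (g i) mO Ooo (wp i) r0
  (subset_trans UT TO).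
have ES : \sum_(i < 2) dist2 (odisc z r) (fun j x => S x i j) (rcoef c g z i) (g i) z
    <= sqnorm (tri T)° (fun x => S x - F x).
  rewrite (sqnorm_dist2 z mU (affine_on_subset UT FA) SFU).
  exact: sqnorm_subset.
set es := sqnorm _ _ in ES *; have es0 : 0 <= es by exact: sqnorm_ge0.
pose d i := (g i 0).1 + (g i 1).2.
have key : r ^+ 4 * \sum_(i < 2) d i ^+ 2 <= CB * es.
  have := PB 0; have := PB 1; rewrite -/(d 0) -/(d 1) => h1 h0.
  apply: (@le_trans _ _ (CB * \sum_(i < 2) dist2 (odisc z r) (fun j x => S x i j) (rcoef c g z i) (g i) z)).
    by rewrite !sum2; lra.
  by rewrite ler_pM2l.
have CBe : 0 <= CB * es by apply: mulr_ge0 => //; exact: ltW.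
have ka4 : 0 <= kappa ^+ 4 by apply: exprn_ge0; exact: ltW.
split; last first.
  apply: (le_trans key); rewrite -mulrA mulrDl mul1r lerDr.
  by apply: mulr_ge0 => //; apply: mulr_ge0.
have dv x : (tri T)° x -> forall i, ediv F x i 0 = d i.
  move=> Tx i; rewrite mxE sum2 /d.
  have h j : partial j (fun y => F y i j) x = coord (g i j) j.
    have [_ _ da] := C1_affine (c i j) (g i j) (0, 0).
    rewrite /partial -(@near_eq_derive R (R * R)%type R (affine (c i j) (g i j) (0, 0))).
      exact: (@derive_val _ _ _ _ _ _ _ (da j x)).
    near=> y; rewrite (FA y)//; near: y.
    by apply: open_nbhs_nbhs; split => //; exact: open_interior.
  by rewrite !h.
rewrite L2norm_sqr.
have D0 : 0 <= \sum_(i < 2) d i ^+ 2 by apply: sumr_ge0 => i _; exact: sqr_ge0.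
have IB : \int[@leb2 R]_(x in (tri T)°) dot (ediv F x) (ediv F x)
    <= (\sum_(i < 2) d i ^+ 2) * (4 * (kappa * r) ^+ 2).
  rewrite [leLHS](_ : _ = \int[mu]_(x in (tri T)°) (\sum_(i < 2) d i ^+ 2)).
    apply: Rintegral_le_bound => //; first exact: (shape_area sh).
    by move=> x _; rewrite D0 lexx.
  by apply: eq_Rintegral => x /set_mem Tx; rewrite dotc2E sum2 !dv.
have dm0 : 0 <= diam (tri T).
  have := edist_le_diam TN (shape_center sh) (shape_center sh).
  by apply: le_trans; rewrite edistE sqrtr_ge0.
have dm2 : diam (tri T) ^+ 2 <= (kappa * r) ^+ 2 by rewrite ler_pXn2r ?nnegrE// ltW.
apply: (le_trans (ler_wpM2l (sqr_ge0 _) IB)).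
have B0 : 0 <= (\sum_(i < 2) d i ^+ 2) * (4 * (kappa * r) ^+ 2).
  by apply: mulr_ge0 => //; apply: mulr_ge0 => //; exact: sqr_ge0.
apply: (le_trans (ler_wpM2r B0 dm2)).
have -> : (kappa * r) ^+ 2 * ((\sum_(i < 2) d i ^+ 2) * (4 * (kappa * r) ^+ 2))
  = 4 * kappa ^+ 4 * (r ^+ 4 * \sum_(i < 2) d i ^+ 2) by ring.
rewrite -[leRHS]mulrA [leRHS]mulrDl mul1r; apply: ler_wpDr => //.
by apply: ler_wpM2l => //; apply: mulr_ge0.
Unshelve. all: by end_near. Qed.

End ElementResiduals.

(** * Traces on edges and edge norms of affine fields *)

Section TraceAndEdgeNorm.
Context {R : realType}.
Implicit Types (P Q W x y z m n : R * R) (T : triangle R) (r p : R).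
Implicit Types (F : tfield R) (c : 'I_2 -> 'I_2 -> R) (g : 'I_2 -> 'I_2 -> R * R).
Local Notation mu := (mu2 R).

Lemma closure_tri_interior T x z : Defs.nondegenerate T -> (tri T)° z -> tri T x ->
  closure (tri T)° x.
Proof.
case: T => [[A B] C] nd Tz Tx U /nbhs_ball_sub[e e0 eU].
have D0 : det A B C != 0 by [].
have [z1 z2 z3] := (tri_interior z D0).1 Tz; have [x1 x2 x3] := (triP x D0).1 Tx.
pose k := 1 + `|z.1 - x.1| + `|z.2 - x.2| + e; have k0 : 0 < k.
  by rewrite /k; have := normr_ge0 (z.1 - x.1); have := normr_ge0 (z.2 - x.2); lra.
pose s := e / k; have s0 : 0 < s by rewrite divr_gt0.
have s1 : s <= 1.
  rewrite /s ler_pdivrMr// mul1r /k.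
  by have := normr_ge0 (z.1 - x.1); have := normr_ge0 (z.2 - x.2); lra.
have sk : s * k = e by rewrite /s divfK// gt_eqF.
pose y : R * R := (x.1 + s * (z.1 - x.1), x.2 + s * (z.2 - x.2)).
have conv P' Q' : 0 <= det P' Q' x / det A B C -> 0 < det P' Q' z / det A B C ->
    0 < det P' Q' y / det A B C.
  move=> h1 h2.
  have -> : det P' Q' y / det A B C
     = (1 - s) * (det P' Q' x / det A B C) + s * (det P' Q' z / det A B C).
    by rewrite /det /y /=; ring.
  by apply: ltr_wpDl; [rewrite mulr_ge0// subr_ge0|exact: mulr_gt0].
exists y; split; first by apply/(tri_interior y D0); split; apply: conv.
apply: eU; rewrite /y /= addrAC subrr add0r normrM gtr0_norm// -sk ltr_pM2l// /k;
  by have := normr_ge0 (z.1 - x.1); have := normr_ge0 (z.2 - x.2); lra.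
Qed.

(** An interior point [z] makes every point of the triangle a limit of interior points, so that the
    filter in [trace] is proper and its limit meaningful. *)
Lemma trace_affine T F c g x z i j : Defs.nondegenerate T -> (tri T)° z ->
  affine_on (tri T)° F c g -> tri T x ->
  trace T F x i j = affine (c i j) (g i j) (0, 0) x.
Proof.
move=> nd Tz FA Tx; rewrite mxE.
have pf : ProperFilter (within (tri T)° (nbhs x)).
  apply: within_nbhs_proper; exact: (closure_tri_interior nd Tz Tx).
apply: cvg_lim; first exact: Rhausdorff.
apply: (@cvg_trans _ (affine (c i j) (g i j) (0, 0) @ within (tri T)° (nbhs x))).
  apply: near_eq_cvg; rewrite near_withinE; near=> y => Ty; by rewrite (FA y Ty).
by apply: cvg_within_filter; exact: continuous_affine.
Unshelve. all: by end_near. Qed.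

Lemma unit_normalE P Q i : unit_normal (P, Q) i 0 = coord (normal P Q) i.
Proof.
by rewrite !mxE /coord /normal /=; case: (ord2 i) => -> /=; rewrite mulrC.
Qed.

Lemma mulmx_normal (A : 'M[R]_2) P Q i : (A *m unit_normal (P, Q)) i 0
  = A i 0 * (normal P Q).1 + A i 1 * (normal P Q).2.
Proof. by rewrite mxE sum2 !unit_normalE. Qed.

Lemma edge_norm_affine_le P Q (G : vfield R) (a b : 'I_2 -> R) (B : R) :
  (forall t, 0 <= t <= 1 -> forall i, G ((1 - t) *: P + t *: Q) i 0 = a i + b i * t) ->
  (forall t, 0 <= t <= 1 -> \sum_(i < 2) (a i + b i * t) ^+ 2 <= B) -> 0 <= B ->
  edge_length (P, Q) * edge_norm (P, Q) G ^+ 2 <= edge_length (P, Q) ^+ 2 * B.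
Proof.
move=> hG hB B0; set l := edge_length _.
have l0 : 0 <= l by exact: sqrtr_ge0.
have I0 : 0 <= \int[@lebesgue_measure R]_(t in `[0, 1])
    dot (G ((1 - t) *: P + t *: Q)) (G ((1 - t) *: P + t *: Q)).
  by apply: Rintegral_ge0 => t _; exact: dot_ge0.
rewrite sqr_sqrtr; last by rewrite mulr_ge0.
rewrite mulrA -expr2; apply: ler_wpM2l; first exact: sqr_ge0.
pose f (t : R) := \sum_(i < 2) (a i + b i * t) ^+ 2.
have cf : continuous f.
  have -> : f = fun t => (a 0 + b 0 * t) * (a 0 + b 0 * t) + (a 1 + b 1 * t) * (a 1 + b 1 * t).
    by apply/funext => t; rewrite /f sum2 !expr2.
  have c1 i : continuous (fun t : R => a i + b i * t).
    move=> t; apply: cvgD; first exact: cvg_cst.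
    by apply: cvgM; [exact: cvg_cst|exact: cvg_id].
  by move=> t; apply: cvgD; apply: cvgM; exact: c1.
have -> : \int[@lebesgue_measure R]_(t in `[0, 1])
    dot (G ((1 - t) *: P + t *: Q)) (G ((1 - t) *: P + t *: Q))
  = \int[@lebesgue_measure R]_(t in `[0, 1]) f t.
  apply: eq_Rintegral => t; rewrite inE /= in_itv /= => t01.
  by rewrite dotc2E /f sum2 !hG// -!expr2.
pose I01 : set (measurableTypeR R) := `[0, 1]%classic.
have mI : measurable I01 by exact: measurable_itv.
have muI : lebesgue_measure I01 = 1%E.
  by rewrite /I01 lebesgue_measure_itv /= lte_fin ltr01 sube0.
have Ioo : (lebesgue_measure I01 < +oo)%E by rewrite muI ltry.
apply: (@le_trans _ _ (\int[@lebesgue_measure R]_(t in `[0, 1]) B)).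
  apply: le_Rintegral => //.
  - apply: (@integrable_bounded _ _ _ (@lebesgue_measure R) _ f B) => //.
    + exact: (measurable_funTS (continuous_measurable_fun cf)).
    + move=> t /=; rewrite in_itv /= => t01; rewrite ger0_norm; first exact: hB.
      by apply: sumr_ge0 => i _; exact: sqr_ge0.
  - apply: (@integrable_bounded _ _ _ (@lebesgue_measure R) _ (fun=> B) `|B|) => //.
have fin1 : fine (lebesgue_measure I01) = 1 by rewrite muI.
by have := Rintegral_cst (@lebesgue_measure R) mI B; rewrite fin1 mulr1 => h; rewrite le_eqVlt; apply/orP; left; apply/eqP.
Qed.

(** The normal [normal P Q] is [s] times the inner one. The value [j0] is linear in the normal and
    picks up the sign; the tangential slope [j1] is quadratic in it and does not. *)
Lemma edge_jump P Q W (cc : 'I_2 -> R) (gg : 'I_2 -> R * R) t : det P Q W != 0 ->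
  let n := inner_normal P Q W in let m := midpoint P Q in
  let s := if 0 < det P Q W then - 1 else 1 in
  let j0 := n.1 * affine (cc 0) (gg 0) (0, 0) m + n.2 * affine (cc 1) (gg 1) (0, 0) m in
  let j1 := - n.2 * (n.1 * (gg 0).1 + n.2 * (gg 1).1) + n.1 * (n.1 * (gg 0).2 + n.2 * (gg 1).2) in
  affine (cc 0) (gg 0) (0, 0) ((1 - t) *: P + t *: Q) * (normal P Q).1
  + affine (cc 1) (gg 1) (0, 0) ((1 - t) *: P + t *: Q) * (normal P Q).2
  = s * j0 + j1 * ((t - 2^-1) * edge_length (P, Q)).
Proof.
move=> D0 n m s j0 j1; have l0 := edge_length_gt0 D0.
have ss : s ^+ 2 = 1 by rewrite /s; case: ifP => _; rewrite ?sqrrN expr1n.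
have nE : n.1 = s * (normal P Q).1 /\ n.2 = s * (normal P Q).2.
  by rewrite /n /inner_normal /s; case: ifP => _; rewrite /= ?mulN1r ?mul1r.
have u1 := normal_unit D0; rewrite /j0 /j1; case: nE => -> ->.
set v := normal P Q in u1 *; set l := edge_length _ in l0 *.
have q1 : Q.1 = P.1 - v.2 * l by rewrite /v /normal -/l /=; field; rewrite gt_eqF.
have q2 : Q.2 = P.2 + v.1 * l by rewrite /v /normal -/l /=; field; rewrite gt_eqF.
clearbody v l; rewrite /affine /m /midpoint /= /GRing.scale /= q1 q2.
have h1 : (P.1 + (P.1 - v.2 * l)) / 2 = P.1 - v.2 * l * 2^-1 by field.
have h2 : (P.2 + (P.2 + v.1 * l)) / 2 = P.2 + v.1 * l * 2^-1 by field.
rewrite h1 h2 -[LHS]mul1r -[X in X * _]ss.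
move: (gg 0).1 (gg 0).2 (gg 1).1 (gg 1).2 (cc 0) (cc 1) P.1 P.2 v.1 v.2 (2^-1) => A B A' B' b b' p p' v1 v2 k.
ring.
Qed.

End TraceAndEdgeNorm.

(** * Edge terms in terms of half discs *)

Section EdgeBounds.
Context {R : realType}.
Implicit Types (Omega : set (plane_m R)) (P Q W x y z m n : R * R) (T : triangle R) (r p : R).
Implicit Types (S F : tfield R) (c : 'I_2 -> 'I_2 -> R) (g : 'I_2 -> 'I_2 -> R * R).
Local Notation mu := (mu2 R).

(** Common to both kinds of edges: for a boundary edge the data on the side of [- n] are zero. The
    hypothesis on [dw] is orthogonality to gradients of waves. *)
Lemma edge_core (kappa : R) : 0 < kappa -> exists2 C : R, 0 < C &
  forall P Q W c g c' g' (Sp Sm : tfield R) (G : vfield R) p,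
  det P Q W != 0 -> 0 < p -> edge_length (P, Q) = kappa * p ->
  let m := midpoint P Q in let n := inner_normal P Q W in
  field_si (half_disc m p n) Sp -> field_si (half_disc m p (- n)) Sm ->
  (forall i a b, let dw := dwave m p a (b * - n.2, b * n.1) in
    \int[mu]_(x in half_disc m p n) (Sp x i 0 * dw 0 x + Sp x i 1 * dw 1 x)
    + \int[mu]_(x in half_disc m p (- n)) (Sm x i 0 * dw 0 x + Sm x i 1 * dw 1 x) = 0) ->
  (forall t, 0 <= t <= 1 -> forall i, let y := (1 - t) *: P + t *: Q in
    G y i 0 = (affine (c i 0) (g i 0) (0, 0) y - affine (c' i 0) (g' i 0) (0, 0) y) * (normal P Q).1
      + (affine (c i 1) (g i 1) (0, 0) y - affine (c' i 1) (g' i 1) (0, 0) y) * (normal P Q).2) ->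
  edge_length (P, Q) * edge_norm (P, Q) G ^+ 2 <=
  C * (\sum_(i < 2) dist2 (half_disc m p n) (fun j x => Sp x i j) (rcoef c g m i) (g i) m
     + \sum_(i < 2) dist2 (half_disc m p (- n)) (fun j x => Sm x i j) (rcoef c' g' m i) (g' i) m
     + p ^+ 4 * \sum_(i < 2) ((g i 0).1 + (g i 1).2) ^+ 2
     + p ^+ 4 * \sum_(i < 2) ((g' i 0).1 + (g' i 1).2) ^+ 2).
Proof.
move=> ka0; have [CE CE0 hE] := @edge_residual R.
(* The squared length is [kappa^2 p^2]; on the edge the jump is [j0] up to sign plus at most [j1]
   times the length, so its square is at most [2 (1 + kappa^2)] times [size2]. *)
exists (kappa ^+ 2 * (2 * (1 + kappa ^+ 2)) * CE).
  by rewrite !mulr_gt0 ?exprn_gt0// ltr_pwDl// sqr_ge0.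
move=> P Q W c g c' g' Sp Sm G p D0 p0 lp m n sSp sSm orth hG.
have n1 : n.1 ^+ 2 + n.2 ^+ 2 = 1 by exact: inner_normal_unit.
pose cc i j := c i j - c' i j.
pose gg i j : R * R := ((g i j).1 - (g' i j).1, (g i j).2 - (g' i j).2).
pose j0 i := n.1 * affine (cc i 0) (gg i 0) (0, 0) m + n.2 * affine (cc i 1) (gg i 1) (0, 0) m.
pose j1 i := - n.2 * (n.1 * (gg i 0).1 + n.2 * (gg i 1).1) + n.1 * (n.1 * (gg i 0).2 + n.2 * (gg i 1).2).
pose s : R := if 0 < det P Q W then - 1 else 1.
have ss : s ^+ 2 = 1 by rewrite /s; case: ifP => _; rewrite ?sqrrN expr1n.
set l := edge_length (P, Q) in lp *.
pose z2 i := size2 (j0 i) (j1 i * - n.2, j1 i * n.1) p.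
have z2E i : z2 i = j0 i ^+ 2 + p ^+ 2 * j1 i ^+ 2.
  by rewrite /z2 /size2 /= !exprMn sqrrN -mulrDr [n.2 ^+ 2 + _]addrC n1 mulr1.
have z20 i : 0 <= z2 i by exact: size2_ge0.
have k1 : 0 <= 2 * (1 + kappa ^+ 2).
  by apply: mulr_ge0 => //; apply: addr_ge0 => //; exact: sqr_ge0.
have B0 : 0 <= 2 * (1 + kappa ^+ 2) * (z2 0 + z2 1) by apply: mulr_ge0 => //; exact: addr_ge0.
have hn := @edge_norm_affine_le R P Q G (fun i => s * j0 i - j1 i * (2^-1 * l))
  (fun i => j1 i * l) (2 * (1 + kappa ^+ 2) * (z2 0 + z2 1)) _ _ B0.
have {}hn : l * edge_norm (P, Q) G ^+ 2 <= l ^+ 2 * (2 * (1 + kappa ^+ 2) * (z2 0 + z2 1)).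
  apply: hn.
    move=> t t01 i; rewrite hG//.
    have hj : affine (cc i 0) (gg i 0) (0, 0) ((1 - t) *: P + t *: Q) * (normal P Q).1
      + affine (cc i 1) (gg i 1) (0, 0) ((1 - t) *: P + t *: Q) * (normal P Q).2
      = s * j0 i + j1 i * ((t - 2^-1) * l) by exact: (edge_jump (cc i) (gg i) t D0).
    have aE j y : affine (c i j) (g i j) (0, 0) y - affine (c' i j) (g' i j) (0, 0) y
       = affine (cc i j) (gg i j) (0, 0) y by rewrite /affine /cc /gg /=; ring.
    by rewrite !aE hj; ring.
  move=> t /andP[t0 t1]; rewrite sum2.
  have bd i : (s * j0 i - j1 i * (2^-1 * l) + j1 i * l * t) ^+ 2 <= 2 * (1 + kappa ^+ 2) * z2 i.
    have -> : s * j0 i - j1 i * (2^-1 * l) + j1 i * l * t = s * j0 i + j1 i * ((t - 2^-1) * l) by ring.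
    have tt : (t - 2^-1) ^+ 2 <= 1 by nra.
    have e1 : (s * j0 i + j1 i * ((t - 2^-1) * l)) ^+ 2
        <= 2 * (j0 i ^+ 2 + j1 i ^+ 2 * l ^+ 2 * (t - 2^-1) ^+ 2).
      have -> : j0 i ^+ 2 = (s * j0 i) ^+ 2 by rewrite exprMn ss mul1r.
      have -> : j1 i ^+ 2 * l ^+ 2 * (t - 2^-1) ^+ 2 = (j1 i * ((t - 2^-1) * l)) ^+ 2 by ring.
      have := sqr_ge0 (s * j0 i - j1 i * ((t - 2^-1) * l)); nra.
    apply: (le_trans e1); rewrite -[leRHS]mulrA ler_pM2l//.
    have jl0 : 0 <= j1 i ^+ 2 * l ^+ 2 by apply: mulr_ge0; exact: sqr_ge0.
    have e2 : j1 i ^+ 2 * l ^+ 2 * (t - 2^-1) ^+ 2 <= j1 i ^+ 2 * l ^+ 2.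
      by rewrite -[leRHS]mulr1; apply: ler_wpM2l.
    have e3 : j1 i ^+ 2 * l ^+ 2 = kappa ^+ 2 * (p ^+ 2 * j1 i ^+ 2) by rewrite lp; ring.
    have a0 := sqr_ge0 (j0 i); have b0 : 0 <= p ^+ 2 * j1 i ^+ 2 by apply: mulr_ge0; exact: sqr_ge0.
    have ab0 : 0 <= kappa ^+ 2 * j0 i ^+ 2 by apply: mulr_ge0; exact: sqr_ge0.
    rewrite z2E mulrDl mul1r mulrDr; lra.
  by have := bd 0; have := bd 1; lra.
apply: (le_trans hn).
set X := (X in _ <= _ * X).
have key : p ^+ 2 * (z2 0 + z2 1) <= CE * X.
  have row i := hE m n p (rcoef c g m i) (g i) (rcoef c' g' m i) (g' i)
    (fun j x => Sp x i j) (fun j x => Sm x i j) (j0 i) (j1 i) p0 n1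
    (sSp i) (sSm i).
  have j0E i : j0 i = n.1 * (rcoef c g m i 0 - rcoef c' g' m i 0) + n.2 * (rcoef c g m i 1 - rcoef c' g' m i 1).
    by rewrite /j0 /rcoef /affine /cc /gg /=; ring.
  have r0 := row 0 (j0E 0) erefl (orth 0 _ _); have r1 := row 1 (j0E 1) erefl (orth 1 _ _).
  rewrite -/(z2 0) in r0; rewrite -/(z2 1) in r1.
  rewrite /X !sum2 mulrDr; move: r0 r1.
  set d0 := dist2 _ _ _ _ _; set d1 := dist2 _ _ _ _ _.
  set d2 := dist2 _ _ _ _ _; set d3 := dist2 _ _ _ _ _; lra.
rewrite lp.
have -> : (kappa * p) ^+ 2 * (2 * (1 + kappa ^+ 2) * (z2 0 + z2 1))
  = kappa ^+ 2 * (2 * (1 + kappa ^+ 2)) * (p ^+ 2 * (z2 0 + z2 1)) by ring.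
rewrite -[leRHS]mulrA; apply: ler_wpM2l => //.
by apply: mulr_ge0 => //; exact: sqr_ge0.
Qed.

(** If both triangles lay on the same side of the edge, a small half disc at its midpoint would
    belong to both interiors. *)
Lemma inner_normal_opp P Q W W' z r z' r' : det P Q W != 0 -> det P Q W' != 0 ->
  0 < r -> disc z r `<=` tri (P, Q, W) -> 0 < r' -> disc z' r' `<=` tri (P, Q, W') ->
  (tri (P, Q, W))° `&` (tri (P, Q, W'))° = set0 ->
  inner_normal P Q W' = - inner_normal P Q W.
Proof.
move=> D0 D0' r0 dT r0' dT' dis.
have [E|E] : inner_normal P Q W' = inner_normal P Q W \/
    inner_normal P Q W' = - inner_normal P Q W; last by [].
  by rewrite /inner_normal; case: ifP => _; case: ifP => _; rewrite ?opprK; by [left|right].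
pose p := Num.min r r'; have p0 : 0 < p by rewrite lt_min r0.
have pr : 0 < p <= r by rewrite p0 ge_min lexx.
have pr' : 0 < p <= r' by rewrite p0 ge_min lexx orbT.
have [x hx] := half_disc_nonempty (midpoint P Q) p0 (inner_normal_unit D0).
have Tx := half_disc_tri D0 r0 pr dT hx.
rewrite -E in hx; have Tx' := half_disc_tri D0' r0' pr' dT' hx.
by have : set0 x by rewrite -dis.
Qed.

Lemma odisc_center z r : 0 < r -> odisc z r z.
Proof.
by move=> r0; apply/odiscP => //; rewrite /sqdist !subrr expr0n /= addr0 exprn_gt0.
Qed.

Lemma dist2_half_le Omega T kappa N z r m p n S F c g : measurable Omega ->
  shape Omega T kappa N z r -> field_si Omega S ->
  affine_on (tri T)° F c g -> half_disc m p n `<=` (tri T)° ->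
  \sum_(i < 2) dist2 (half_disc m p n) (fun j x => S x i j) (rcoef c g m i) (g i) m
  <= sqnorm (tri T)° (fun x => S x - F x).
Proof.
move=> mO sh sS FA hT; have [_ _ _ _ TO] := sh.
have mT := measurable_tri_interior T; have mH := measurable_half_disc m p n.
have SFT : field_si (tri T)° (fun x => S x - F x).
  by apply: field_siB => //; [exact: (field_siS mT mO TO)|exact: (affine_on_si sh FA)].
rewrite (sqnorm_dist2 m mH (affine_on_subset hT FA)); first exact: sqnorm_subset.
exact: (field_siS mH mT hT SFT).
Qed.

(** The edge is at most the diameter, hence at most [kappa r]. This radius depends on the edge only,
    so the triangles on its two sides use the same disc. *)
Lemma edge_shape Omega T kappa N z r P Q W : 0 < kappa -> shape Omega T kappa N z r ->
  tri T = tri (P, Q, W) -> det P Q W != 0 -> 0 < edge_length (P, Q) / kappa <= r.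
Proof.
move=> ka0 sh TE D0; have [r0 _ dk TN _] := sh.
rewrite divr_gt0 ?(edge_length_gt0 D0)//= ler_pdivrMr// mulrC.
apply: le_trans dk; apply: (edist_le_diam TN); rewrite TE; by have [] := tri_vertex P Q W.
Qed.

End EdgeBounds.

(** * Interior edges *)

Section InteriorEdge.
Context {R : realType}.
Implicit Types (Omega : set (plane_m R)) (T : triangle R) (e : edge R) (S F : tfield R)
  (c : 'I_2 -> 'I_2 -> R) (g : 'I_2 -> 'I_2 -> R * R).
Local Notation mu := (mu2 R).

Lemma edge_interior (kappa N : R) : 0 < kappa -> exists2 C : R, 0 < C &
  forall Omega S (u : vfield R) F T z r c g T' z' r' c' g' (e : edge R),
  measurable Omega -> (mu Omega < +oo)%E -> (closure (Omega : set (plane R)))° `<=` Omega ->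
  tri T `<=` closure (Omega : set (plane R)) -> tri T' `<=` closure (Omega : set (plane R)) ->
  (forall i, weak_pair Omega (fun j x => S x i j) (fun x => u x i 0)) ->
  shape Omega T kappa N z r -> affine_on (tri T)° F c g ->
  shape Omega T' kappa N z' r' -> affine_on (tri T')° F c' g' ->
  Defs.nondegenerate T -> Defs.nondegenerate T' ->
  (tri T)° `&` (tri T')° = set0 -> has_edge T e -> has_edge T' e ->
  edge_length e * edge_norm e (fun x => (trace T F x - trace T' F x) *m unit_normal e) ^+ 2
  <= C * (sqnorm (tri T)° (fun x => S x - F x) + sqnorm (tri T')° (fun x => S x - F x)).
Proof.
move=> ka0; have [CE CE0 hE] := edge_core ka0; have [CB CB0 hB] := @element_div R kappa N ka0.
(* The part [CB] pays for the divergence terms of [edge_core], since [p] is at most both inscribed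
   radii. *)
exists (CE * (1 + CB)); first by rewrite mulr_gt0// addr_gt0.
move=> Omega S u F T z r c g T' z' r' c' g' [P Q] mO Ooo icO TO TO' wp sh FA sh' FA' nd nd' dis eT eT'.
have [W [TE D0 _]] := has_edgeP nd eT; have [W' [TE' D0' _]] := has_edgeP nd' eT'.
rewrite /= in TE D0 TE' D0'.
have [r0 dT _ _ TOi] := sh; have [r0' dT' _ _ TOi'] := sh'.
pose p := edge_length (P, Q) / kappa.
have pr : 0 < p <= r := edge_shape ka0 sh TE D0.
have pr' : 0 < p <= r' := edge_shape ka0 sh' TE' D0'.
have /andP[p0 pler] := pr; have /andP[_ pler'] := pr'.
rewrite TE in dT dis; rewrite TE' in dT' dis.
pose m := midpoint P Q; pose n := inner_normal P Q W.
have nE := inner_normal_opp D0 D0' r0 dT r0' dT' dis.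
have hT : half_disc m p n `<=` (tri T)° by rewrite TE; exact: half_disc_tri pr dT.
have hT' : half_disc m p (- n) `<=` (tri T')° by rewrite TE' -nE; exact: half_disc_tri pr' dT'.
have [sS _] := weak_pair_row_si wp.
have n1 : n.1 ^+ 2 + n.2 ^+ 2 = 1 by exact: inner_normal_unit.
have mU := measurable_odisc m p.
(* Both triangles and their common edge cover the disc, which is therefore an open subset of the
   closure of [Omega]. *)
have UO : odisc m p `<=` Omega.
  apply: subset_trans icO => x Ux; apply: (open_interiorS (@open_odisc _ m p)) => // y Uy.
  have [_ seg] := edge_disc D0 r0 pr dT.
  have [l0|l0|l0] := ltrgtP 0 (affine 0 n m y).
  - by apply: TO; apply: interior_subset; apply: hT; split.
  - by apply: TO'; apply: interior_subset; apply: hT'; split => //=; rewrite affine_opp oppr_gt0.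
  - apply: TO; rewrite TE; apply: segment_sub_tri; apply: seg.
      by move: Uy => /(odiscP _ _ p0)/ltW.
    rewrite (det_normal y D0); move: l0; rewrite /n /inner_normal; case: ifP => _;
      rewrite ?affine_opp -/m => l0; first by (rewrite (_ : affine 0 (normal P Q) m y = 0) ?mulr0 //; lra).
    by rewrite -l0 mulr0.
have sSU D : measurable D -> D `<=` Omega -> field_si D S.
  by move=> mD DO; exact: (field_siS mD mO DO).
have hO : half_disc m p n `<=` Omega by exact: subset_trans TOi.
have hO' : half_disc m p (- n) `<=` Omega by exact: subset_trans TOi'.
(* The gradient of a wave is curl-free and vanishes off the disc, so it is an admissible test field
   without a term in [u]. *)
have orth i a b : let dw := dwave m p a (b * - n.2, b * n.1) in
    \int[mu]_(x in half_disc m p n) (S x i 0 * dw 0 x + S x i 1 * dw 1 x)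
    + \int[mu]_(x in half_disc m p (- n)) (S x i 0 * dw 0 x + S x i 1 * dw 1 x) = 0.
  move=> dw; have [hs hu wf] := wp i.
  have dout j x : ~ box 0 (`|m.1| + `|m.2| + p) x -> dw j x = 0 by move=> nb; exact: (dwave_out_box _ _ _ p0 nb).
  have ht D j : measurable D -> (mu D < +oo)%E -> square_integrable mu D (dw j).
    move=> mD Doo; apply: (@square_integrable_continuous_supp _ (`|m.1| + `|m.2| + p)) => //.
      exact: continuous_dwave.
    exact: dout.
  have sc : scalar_curl Omega dw (fun=> 0).
    have := @scalar_curl_C1 _ Omega (`|m.1| + `|m.2| + p) dw _ (fun j => C1_dwave m p a _ j) dout.
    by under eq_fun do rewrite ddwave_sym subrr.
  have z0 : square_integrable mu Omega (fun=> 0).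
    by apply: (@square_integrable_bounded _ _ _ mu _ _ 0) => // x _; rewrite normr0.
  have hdw j : square_integrable mu Omega (dw j) by exact: ht.
  have := wf dw (fun=> 0) hdw z0 sc.
  rewrite (@Rintegral0_out _ _ _ mu (odisc m p) Omega)//; last first.
    by move=> x _ nU; rewrite /dw !(dwave_odisc _ _ _ nU) !mulr0 addr0.
  rewrite [X in _ + X]Rintegral0; last by move=> x _; rewrite mulr0.
  rewrite addr0 (Rintegral_half_discs n1)//.
  have Uoo : (mu (odisc m p) < +oo)%E by apply: le_lt_trans (odisc_leb2 m p0) (ltry _).
  have sU := sSU _ mU UO.
  apply: integrableRD => //; apply: integrableRM => //; by [exact: sU|exact: ht].
have Tz : (tri T)° z by apply: (shape_odisc sh); exact: odisc_center.
have Tz' : (tri T')° z' by apply: (shape_odisc sh'); exact: odisc_center.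
have := hE P Q W c g c' g' S S
  (fun x => (trace T F x - trace T' F x) *m unit_normal (P, Q)) p D0 p0
  _ (sSU _ (measurable_half_disc m p n) hO) (sSU _ (measurable_half_disc m p (- n)) hO') orth.
move=> h; apply: le_trans (h _ _) _; first by rewrite /p mulrC divfK// gt_eqF.
  move=> t /andP[t0 t1] i /=; set y := (1 - t) *: P + t *: Q.
  have sy : segment (P, Q) y by exists t => //=; rewrite in_itv /= t0.
  have Ty : tri T y by rewrite TE; exact: segment_sub_tri.
  have Ty' : tri T' y by rewrite TE'; exact: segment_sub_tri.
  have mxB (A B : 'M[R]_2) j : (A - B) i j = A i j - B i j by rewrite !mxE.
  by rewrite mulmx_normal !mxB !(trace_affine _ _ nd Tz FA Ty) !(trace_affine _ _ nd' Tz' FA' Ty').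
rewrite -/m -/n -mulrA ler_pM2l//.
have d1 := dist2_half_le mO sh sS FA hT.
have d2 := dist2_half_le mO sh' sS FA' hT'.
have [_ b1] := hB Omega S u F T z r c g mO Ooo wp sh FA.
have [_ b2] := hB Omega S u F T' z' r' c' g' mO Ooo wp sh' FA'.
have p4 : p ^+ 4 <= r ^+ 4 by rewrite ler_pXn2r ?nnegrE// ltW.
have p4' : p ^+ 4 <= r' ^+ 4 by rewrite ler_pXn2r ?nnegrE// ltW.
have sq (f : 'I_2 -> R) : 0 <= \sum_(i < 2) f i ^+ 2 by apply: sumr_ge0 => i _; exact: sqr_ge0.
have q1 := ler_wpM2r (sq (fun i => (g i 0).1 + (g i 1).2)) p4.
have q2 := ler_wpM2r (sq (fun i => (g' i 0).1 + (g' i 1).2)) p4'.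
have := le_trans q1 b1; have := le_trans q2 b2.
set E1 := sqnorm _ _ in d1 *; set E2 := sqnorm _ _ in d2 *; lra.
Qed.

End InteriorEdge.

(** * Boundary edges *)

Section BoundaryEdge.
Context {R : realType}.
Implicit Types (Omega : set (plane_m R)) (T : triangle R) (e : edge R) (S F : tfield R)
  (c : 'I_2 -> 'I_2 -> R) (g : 'I_2 -> 'I_2 -> R * R).
Local Notation mu := (mu2 R).

Lemma edge_boundary (kappa N : R) : 0 < kappa -> exists2 C : R, 0 < C &
  forall Omega S (u : vfield R) F T z r c g (e : edge R),
  measurable Omega -> (mu Omega < +oo)%E ->
  (forall i, weak_pair Omega (fun j x => S x i j) (fun x => u x i 0)) ->
  shape Omega T kappa N z r -> affine_on (tri T)° F c g ->
  Defs.nondegenerate T -> has_edge T e -> segment e `&` Omega = set0 ->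
  edge_length e * edge_norm e (fun x => trace T F x *m unit_normal e) ^+ 2
  <= C * sqnorm (tri T)° (fun x => S x - F x).
Proof.
move=> ka0; have [CE CE0 hE] := edge_core ka0; have [CB CB0 hB] := @element_div R kappa N ka0.
exists (CE * (1 + CB)); first by rewrite mulr_gt0// addr_gt0.
move=> Omega S u F T z r c g [P Q] mO Ooo wp sh FA nd eT eO.
have [W [TE D0 _]] := has_edgeP nd eT.
rewrite /= in TE D0.
have [r0 dT _ _ TOi] := sh.
pose p := edge_length (P, Q) / kappa.
have pr : 0 < p <= r := edge_shape ka0 sh TE D0.
have /andP[p0 pler] := pr.
rewrite TE in dT.
pose m := midpoint P Q; pose n := inner_normal P Q W.
have hT : half_disc m p n `<=` (tri T)° by rewrite TE; exact: half_disc_tri pr dT.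
have [sS _] := weak_pair_row_si wp.
have hO : half_disc m p n `<=` Omega by exact: subset_trans TOi.
have mH := measurable_half_disc m p n; have mH' := measurable_half_disc m p (- n).
(* Within the closed disc the line consists of points of the edge, which does not meet [Omega]. *)
have line x : Omega x -> 0 <= quad m p x -> affine 0 n m x != 0.
  move=> Ox qx; apply/eqP => lx; have [_ seg] := edge_disc D0 r0 pr dT.
  suff : (segment (P, Q) `&` Omega) x by rewrite eO.
  split => //; apply: seg.
    by move: qx; rewrite /quad subr_ge0 ler_pdivrMr ?exprn_gt0// mul1r.
  rewrite (det_normal x D0); move: lx; rewrite /n /inner_normal; case: ifP => _;
    rewrite ?affine_opp -/m => lx; first by (rewrite (_ : affine 0 (normal P Q) m x = 0) ?mulr0 //; lra).
  by rewrite lx mulr0.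
have orth i a b : let dw := dwave m p a (b * - n.2, b * n.1) in
    \int[mu]_(x in half_disc m p n) (S x i 0 * dw 0 x + S x i 1 * dw 1 x)
    + \int[mu]_(x in half_disc m p (- n)) ((0 : 'M[R]_2) i 0 * dw 0 x + (0 : 'M[R]_2) i 1 * dw 1 x) = 0.
  move=> dw; have [hs hu wf] := wp i.
  (* The gradient extended by zero below the line: whatever [Omega] contains on that side of the
     disc contributes nothing. *)
  pose t j x := if 0 < affine 0 n m x then dw j x else 0.
  have dout j x : ~ box 0 (`|m.1| + `|m.2| + p) x -> dw j x = 0 by move=> nb; exact: (dwave_out_box _ _ _ p0 nb).
  have cd j : continuous (dw j) by exact: continuous_dwave.
  have mt j : measurable_fun [set: plane_m R] (t j).
    have mP := measurable_affine_gt0 0 n m.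
    have -> : t j = dw j \_ [set x | 0 < affine 0 n m x].
      apply/funext => x; rewrite /t /patch; case: ifPn => lx; first by rewrite mem_set.
      by rewrite memNset//; exact/negP.
    apply/(measurable_restrictT _ mP)/measurable_funTS.
    exact: (continuous_measurable2 (cd j)).
  have ht j : square_integrable mu Omega (t j).
    have [K K0 hK] := continuous_supp_bounded (cd j) (dout j).
    apply: (@square_integrable_bounded _ _ _ mu _ _ K) => //.
      exact: measurable_funTS.
    by move=> x _; rewrite /t; case: ifP => // _; rewrite normr0.
  have sc : scalar_curl Omega t (fun=> 0) by exact: (scalar_curl_half_plane _ _ p0 line).
  have z0 : square_integrable mu Omega (fun=> 0).
    by apply: (@square_integrable_bounded _ _ _ mu _ _ 0) => // x _; rewrite normr0.
  have := wf t _ ht z0 sc.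
  rewrite (@Rintegral0_out _ _ _ mu (half_disc m p n) Omega)//; last first.
    move=> x _ nH; rewrite /t; case: ifP => lx; last by rewrite !mulr0 addr0.
    have nU : ~ odisc m p x by move=> Ux; apply: nH.
    by rewrite /dw !(dwave_odisc _ _ _ nU) !mulr0 addr0.
  rewrite [X in _ + X]Rintegral0; last by move=> x _; rewrite mulr0.
  rewrite addr0 => h; rewrite [X in _ + X]Rintegral0; last by move=> x _; rewrite !mxE !mul0r addr0.
  rewrite addr0 -[RHS]h; apply: eq_Rintegral => x /set_mem[_ /= lx].
  by rewrite /t lx.
have Tz : (tri T)° z by apply: (shape_odisc sh); exact: odisc_center.
have z0 : field_si (half_disc m p (- n)) (fun=> (0 : 'M[R]_2)).
  move=> i j; apply: (@square_integrable_bounded _ _ _ mu _ _ 0) => //.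
    apply: (@le_lt_trans _ _ (mu (odisc m p))); last exact: le_lt_trans (odisc_leb2 m p0) (ltry _).
    by apply: le_measure; rewrite ?inE//; [exact: measurable_odisc|move=> x []].
  by move=> x _; rewrite mxE normr0.
(* On the outer side both the exact field and the affine data are zero, so the jump is the normal
   trace itself. *)
have := hE P Q W c g (fun _ _ => 0) (fun _ _ => (0, 0)) S (fun=> 0)
  (fun x => trace T F x *m unit_normal (P, Q)) p D0 p0
  _ (field_siS mH mO hO sS) z0 orth.
move=> h; apply: le_trans (h _ _) _; first by rewrite /p mulrC divfK// gt_eqF.
  move=> t /andP[t0 t1] i /=; set y := (1 - t) *: P + t *: Q.
  have sy : segment (P, Q) y by exists t => //=; rewrite in_itv /= t0.
  have Ty : tri T y by rewrite TE; exact: segment_sub_tri.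
  rewrite mulmx_normal !(trace_affine _ _ nd Tz FA Ty).
  have a0 : affine 0 (0, 0) (0, 0) y = 0 by rewrite /affine /= !mul0r !addr0.
  by rewrite a0 !subr0.
rewrite -/m -/n -mulrA ler_pM2l//.
have d1 := dist2_half_le mO sh sS FA hT.
have d2 : \sum_(i < 2) dist2 (half_disc m p (- n)) (fun j x => (0 : 'M[R]_2) i j)
    (rcoef (fun _ _ => 0) (fun _ _ => (0, 0)) m i) (fun=> (0, 0)) m = 0.
  rewrite big1// => i _; rewrite /dist2.
  by rewrite !Rintegral0 ?addr0// => x _; rewrite mxE /rcoef /affine /= !mul0r !addr0 subrr expr0n.
rewrite d2 addr0.
have [_ b1] := hB Omega S u F T z r c g mO Ooo wp sh FA.
have p4 : p ^+ 4 <= r ^+ 4 by rewrite ler_pXn2r ?nnegrE// ltW.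
have sq (f : 'I_2 -> R) : 0 <= \sum_(i < 2) f i ^+ 2 by apply: sumr_ge0 => i _; exact: sqr_ge0.
have q1 := ler_wpM2r (sq (fun i => (g i 0).1 + (g i 1).2)) p4.
have := le_trans q1 b1.
rewrite [X in _ + _ * X](_ : _ = 0); last by rewrite big1// => i _; rewrite /= addr0 expr0n.
rewrite mulr0 addr0.
set E1 := sqnorm _ _ in d1 *; lra.
Qed.

End BoundaryEdge.

(** * Averaging over vertex patches *)

Section Averages.
Context {R : realType}.
Implicit Types (Omega : set (plane_m R)) (P Q W x y z : R * R) (T : triangle R)
  (M : seq (triangle R)) (v w : vfield R).
Local Notation mu := (mu2 R).

Record mesh Omega M (kappa N : R) : Prop := Mesh {
  mesh_uniq : uniq M;
  mesh_nondegenerate : {in M, forall T, Defs.nondegenerate T};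
  mesh_conforming : {in M &, forall T T', T != T' -> conforming T T'};
  mesh_shape : {in M, forall T, exists z r, shape Omega T kappa N z r} }.

Lemma closed_tri T : Defs.nondegenerate T -> closed (tri T).
Proof.
case: T => [[P Q] W] nd; have {}nd : det P Q W != 0 by [].
have cl A B : closed [set x : R * R | 0 <= det A B x / det P Q W].
  pose g : R * R := (- (B.2 - A.2) / det P Q W, (B.1 - A.1) / det P Q W).
  have gE x : affine 0 g A x = det A B x / det P Q W.
    rewrite /affine /g /=; move: nd; set D := det P Q W => D0; rewrite /det; clearbody D; field.
    exact: D0.
  have -> : [set x : R * R | 0 <= det A B x / det P Q W]
      = affine 0 g A @^-1` [set y : R | 0 <= y].
    by apply/funext => x /=; rewrite gE.
  by apply: (proj1 (continuous_closedP _) (@continuous_affine R 0 g A)); exact: closed_ge.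
rewrite (_ : tri _ = [set x | 0 <= det Q W x / det P Q W] `&`
   [set x | 0 <= det W P x / det P Q W] `&` [set x | 0 <= det P Q x / det P Q W]).
  by apply: closedI => //; exact: closedI.
apply/seteqP; split=> x; first by move=> /(triP _ nd)[].
by move=> [[h1 h2] h3]; apply/(triP _ nd).
Qed.

(** The discrete Cauchy-Schwarz inequality without square roots. *)
Lemma sqr_sum_le (I : eqType) (s : seq I) (f a b : I -> R) :
  {in s, forall i, 0 <= a i} -> {in s, forall i, 0 <= b i} ->
  {in s, forall i, f i ^+ 2 <= a i * b i} ->
  (\sum_(i <- s) f i) ^+ 2 <= (\sum_(i <- s) a i) * \sum_(i <- s) b i.
Proof.
elim: s => [|i s IH] ha hb hf; first by rewrite !big_nil expr0n mul0r.
have inS j : j \in s -> j \in i :: s by rewrite inE orbC => ->.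
have {}IH := IH (fun j js => ha j (inS j js)) (fun j js => hb j (inS j js))
  (fun j js => hf j (inS j js)).
rewrite !big_cons; have ai := ha i (mem_head _ _); have bi := hb i (mem_head _ _).
have fi := hf i (mem_head _ _).
have A0 : 0 <= \sum_(j <- s) a j.
  by rewrite big_seq; apply: sumr_ge0 => j /inS/ha.
have B0 : 0 <= \sum_(j <- s) b j.
  by rewrite big_seq; apply: sumr_ge0 => j /inS/hb.
move: IH A0 B0; set X := \sum_(j <- s) f j; set A := \sum_(j <- s) a j; set B := \sum_(j <- s) b j.
move=> IH A0 B0.
(* Arithmetic-geometric mean: the square of the left side is at most [4 (a i * B) (A * b i)], hence
   at most the square of the right side. *)
suff h : 2 * (f i * X) <= a i * B + A * b i by nra.
have c0 : 0 <= a i * B + A * b i by apply: addr_ge0; apply: mulr_ge0.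
apply: le_trans (ler_norm _) _; rewrite normr_le_sqr//.
have h1 : f i ^+ 2 * X ^+ 2 <= (a i * b i) * (A * B).
  by apply: ler_pM => //; exact: sqr_ge0.
have h2 := sqr_ge0 (a i * B - A * b i); nra.
Qed.

Lemma sum_subset_le (I : eqType) (s t : seq I) (P : pred I) (f : I -> R) : uniq s ->
  {in s, forall i, P i -> i \in t} -> (forall i, 0 <= f i) ->
  \sum_(i <- s | P i) f i <= \sum_(i <- t) f i.
Proof.
elim: s t => [|i s IH] t /= => [_ _ f0|/andP[ns us] st f0].
  by rewrite big_nil; exact: sumr_ge0.
rewrite big_cons; case: ifPn => Pi; last first.
  by apply: IH => // j js; apply: st; rewrite inE js orbT.
have it := st i (mem_head _ _) Pi.
rewrite (big_rem i it) /= lerD2l; apply: IH => // j js Pj.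
have jt := st j _ Pj; rewrite inE js orbT in jt.
have := jt erefl; rewrite (perm_mem (perm_to_rem it)) inE => /orP[/eqP ji|//].
by move: ns; rewrite -ji js.
Qed.

Lemma convex_sqr_le (a b c x y z : R) : 0 <= a -> 0 <= b -> 0 <= c -> a + b + c = 1 ->
  (a * x + b * y + c * z) ^+ 2 <= x ^+ 2 + y ^+ 2 + z ^+ 2.
Proof.
move=> a0 b0 c0 abc; have -> : c = 1 - a - b by lra.
have c1 : 0 <= 1 - a - b by lra.
have h : (a * x + b * y + (1 - a - b) * z) ^+ 2 <= a * x ^+ 2 + b * y ^+ 2 + (1 - a - b) * z ^+ 2.
  rewrite -subr_ge0.
  have -> : a * x ^+ 2 + b * y ^+ 2 + (1 - a - b) * z ^+ 2 - (a * x + b * y + (1 - a - b) * z) ^+ 2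
    = a * b * (x - y) ^+ 2 + a * (1 - a - b) * (x - z) ^+ 2 + b * (1 - a - b) * (y - z) ^+ 2 by ring.
  by apply: addr_ge0; first apply: addr_ge0; apply: mulr_ge0; rewrite ?sqr_ge0//; apply: mulr_ge0.
have := sqr_ge0 x; have := sqr_ge0 y; have := sqr_ge0 z; nra.
Qed.

Lemma mesh_disjoint Omega M kappa N : mesh Omega M kappa N ->
  {in M &, forall T T', T != T' -> (tri T)° `&` (tri T')° = set0}.
Proof.
case=> _ nd cf _ T T' TM TM' TT'.
by apply: conforming_interior (cf _ _ TM TM' TT'); exact: nd.
Qed.

Lemma sum_sqnorm_le Omega M kappa N n (G : plane_m R -> 'M[R]_(2, n)) : measurable Omega ->
  mesh Omega M kappa N -> field_si Omega G ->
  \sum_(T <- M) sqnorm (tri T)° G <= sqnorm Omega G.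
Proof.
move=> mO ms si; apply: sum_Rintegral_le => //.
- exact: mesh_uniq ms.
- by move=> T _; exact: measurable_tri_interior.
- by move=> T /(mesh_shape ms)[z [r []]].
- exact: mesh_disjoint ms.
- exact: dot_integrable.
- by move=> x _; exact: dot_ge0.
Qed.

Lemma patch_area Omega M kappa N z : mesh Omega M kappa N ->
  \sum_(T <- Defs.patch M z) fine (mu (tri T)°) <= area (patch_set M z).
Proof.
move=> ms; have pM T : T \in Defs.patch M z -> T \in M by rewrite mem_filter => /andP[].
have mp : @measurable _ (plane_m R) (patch_set M z).
  apply: fin_bigcup_measurable; first exact: finite_seq.
  by move=> T /= /pM TM; apply: closed_measurable2; apply: closed_tri; exact: (mesh_nondegenerate ms).
apply: sum_fine_measure_le => //.
- exact: (filter_uniq _ (mesh_uniq ms)).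
- apply: (@le_lt_trans _ _ (4 * `|N| ^+ 2)%:E); last exact: ltry.
  apply: (@leb2_sub_box _ _ 0) => // x [T /= /pM/(mesh_shape ms)[y [r [_ _ _ TN _]]] /TN/box0P[h1 h2]].
  by apply/box0P; split; apply: le_trans (ler_norm _).
- by move=> T _; exact: measurable_tri_interior.
- by move=> T Tp x /interior_subset Tx; exists T.
- by move=> T T' /pM TM /pM TM'; exact: mesh_disjoint ms T T' TM TM'.
Qed.

Lemma measure_tri_interior Omega T kappa N z r : shape Omega T kappa N z r ->
  (mu (tri T)° < +oo)%E.
Proof. by move=> sh; apply: le_lt_trans (shape_area sh) (ltry _). Qed.

(** Jensen's inequality for the patch average: Cauchy-Schwarz on each triangle, then over the patch,
    whose area bounds the sum of the areas of the triangles. *)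
Lemma sqr_average_le Omega M kappa N z (d : vfield R) : measurable Omega ->
  mesh Omega M kappa N -> field_si Omega d ->
  \sum_(i < 2) (\sum_(T <- Defs.patch M z)
     (area (patch_set M z))^-1 * \int[mu]_(x in (tri T)°) d x i 0) ^+ 2
  <= (area (patch_set M z))^-1 * \sum_(T <- Defs.patch M z) sqnorm (tri T)° d.
Proof.
move=> mO ms si; have pM T : T \in Defs.patch M z -> T \in M by rewrite mem_filter => /andP[].
set A := area (patch_set M z).
have A0 : 0 <= A by exact: fine_ge0.
have mT := measurable_tri_interior.
have siT T : T \in M -> field_si (tri T)° d.
  by move=> /(mesh_shape ms)[y [r [_ _ _ _ TO]]]; exact: field_siS si.
have b0 i T : 0 <= \int[mu]_(x in (tri T)°) d x i 0 ^+ 2.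
  by apply: Rintegral_ge0 => x _; exact: sqr_ge0.
have h i : (\sum_(T <- Defs.patch M z) A^-1 * \int[mu]_(x in (tri T)°) d x i 0) ^+ 2
    <= A^-1 * \sum_(T <- Defs.patch M z) \int[mu]_(x in (tri T)°) d x i 0 ^+ 2.
  rewrite -mulr_sumr exprMn.
  have := @sqr_sum_le _ (Defs.patch M z) (fun T => \int[mu]_(x in (tri T)°) d x i 0)
    (fun T => fine (mu (tri T)°)) (fun T => \int[mu]_(x in (tri T)°) d x i 0 ^+ 2).
  move=> /(_ (fun _ _ => fine_ge0 (measure_ge0 _ _)) (fun T _ => b0 i T)) cs.
  have {}cs := cs _; apply: (@le_trans _ _ (A^-1 ^+ 2 * (A * \sum_(T <- Defs.patch M z) \int[mu]_(x in (tri T)°) d x i 0 ^+ 2))).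
    rewrite ler_wpM2l ?sqr_ge0//; apply: le_trans (cs _) _.
      move=> T /pM TM; have [y [r sh]] := mesh_shape ms TM.
      have Too := measure_tri_interior sh.
      have s1 : square_integrable mu (tri T)° (fun=> 1).
        by apply: (@square_integrable_bounded _ _ _ mu _ _ 1) => // x _; rewrite normr1.
      have := Cauchy_Schwarz (mT _ T) s1 (siT T TM i 0).
      under eq_Rintegral do rewrite mul1r.
      under [X in _ <= X * _ -> _]eq_Rintegral do rewrite expr1n.
      by rewrite Rintegral_cst// mul1r.
    by apply: ler_wpM2r; [exact: sumr_ge0|exact: patch_area ms].
  (* For area zero the inverse is zero as well, and both sides vanish. *)
  have [->|An0] := eqVneq A 0; first by rewrite invr0 expr0n !mul0r.
  by rewrite mulrA expr2 -(mulrA A^-1) mulVf// mulr1.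
apply: (le_trans (ler_sum _ (fun i _ => h i))).
rewrite -mulr_sumr exchange_big /=; apply: ler_wpM2l; first by rewrite invr_ge0.
rewrite le_eqVlt; apply/orP; left; apply/eqP; rewrite big_seq [RHS]big_seq.
apply: eq_bigr => T /pM TM.
have ii i : integrableR mu (tri T)° (fun x => d x i 0 ^+ 2) by exact: (siT T TM i 0).2.
have mTT := mT R T; rewrite sum2 /sqnorm -RintegralD//; [|exact: (ii 0)|exact: (ii 1)].
by apply: eq_Rintegral => x _; rewrite dotc2E -!expr2.
Qed.

Lemma vertices_uniq T : Defs.nondegenerate T -> uniq (vertices T).
Proof.
case: T => [[P Q] W] nd; have {}nd : det P Q W != 0 by [].
rewrite /vertices /= !inE !negb_or !andbT -andbA.
apply/and3P; split; apply: contra_neq nd => ->; rewrite /det; ring.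
Qed.

(** The difference is affine on each triangle, hence bounded by its vertex values, and these by
    patch averages. After exchanging the sums, a triangle [T'] is charged once per vertex, with
    weights [|T| / |patch|] of total at most 1; this gives the factor 3. *)
Lemma postprocessing_le Omega M kappa N (Theta : vfield R -> vfield R) v w : measurable Omega ->
  mesh Omega M kappa N -> postprocessing Omega M Theta -> Q Omega v -> Q Omega w ->
  \sum_(T <- M) sqnorm (tri T)° (fun x => Theta v x - Theta w x)
  <= 3 * sqnorm Omega (fun x => v x - w x).
Proof.
move=> mO ms pp Qv Qw; have [[_ Yv] Vv] := pp v Qv; have [[_ Yw] Vw] := pp w Qw.
have siv : field_si Omega v by move=> i j; exact: Qv.
have siw : field_si Omega w by move=> i j; exact: Qw.
pose d x := v x - w x; have sid : field_si Omega d by exact: field_siB.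
have mT := measurable_tri_interior.
pose A z := (area (patch_set M z))^-1.
have A0 z : 0 <= A z by rewrite invr_ge0 fine_ge0.
pose E z := A z * \sum_(T <- Defs.patch M z) sqnorm (tri T)° d.
pose D z i := Theta v z i 0 - Theta w z i 0.
have DE T z : T \in M -> z \in vertices T -> \sum_(i < 2) D z i ^+ 2 <= E z.
  move=> TM zT; apply: le_trans (sqr_average_le z mO ms sid).
  rewrite le_eqVlt; apply/orP; left; apply/eqP; apply: eq_bigr => i _; congr (_ ^+ 2).
  rewrite /D (Vv T TM z zT) (Vw T TM z zT) -sumrB big_seq [RHS]big_seq; apply: eq_bigr => T'.
  rewrite mem_filter => /andP[_ TM']; rewrite -mulrBr; congr (_ * _).
  have [y [r sh]] := mesh_shape ms TM'; have [_ _ _ _ TO] := sh.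
  have s1 : square_integrable mu (tri T')° (fun=> 1).
    apply: (@square_integrable_bounded _ _ _ mu _ _ 1) => //; first exact: measure_tri_interior sh.
    by move=> x _; rewrite normr1.
  have ii (f : vfield R) : field_si Omega f -> integrableR mu (tri T')° (fun x => f x i 0).
    move=> sf; have := integrableRM (mT _ T') (field_siS (mT _ T') mO TO sf i 0) s1.
    by under eq_fun do rewrite mulr1.
  have mTT := mT R T'; rewrite -RintegralB//; [|exact: ii|exact: ii].
  by apply: eq_Rintegral => x _; rewrite /d !mxE.
have step T : T \in M -> sqnorm (tri T)° (fun x => Theta v x - Theta w x)
    <= \sum_(z <- vertices T) fine (mu (tri T)°) * E z.
  move=> TM; have [y [r sh]] := mesh_shape ms TM.
  have Too := measure_tri_interior sh.
  have DT i : exists c g, forall x, tri T x -> D x i = affine c g (0, 0) x.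
    have [p [c1 [a1 [b1 h1]]] e1] := Yv T TM i; have [q [c2 [a2 [b2 h2]]] e2] := Yw T TM i.
    exists (c1 - c2), (a1 - a2, b1 - b2) => x Tx.
    by rewrite /D e1// e2// h1 h2 /affine /=; ring.
  have [c0 [g0 D0]] := DT 0; have [c1 [g1 D1]] := DT 1.
  have dE x : tri T x -> dot (Theta v x - Theta w x) (Theta v x - Theta w x)
      = affine c0 g0 (0, 0) x ^+ 2 + affine c1 g1 (0, 0) x ^+ 2.
    by move=> Tx; rewrite dotc2E -!expr2 !mxE -(D0 x Tx) -(D1 x Tx).
  have bd x : tri T x -> dot (Theta v x - Theta w x) (Theta v x - Theta w x)
      <= \sum_(z <- vertices T) E z.
    (* At a point of the triangle the affine difference is a convex combination of its vertex
       values, and [convex_sqr_le] applies. *)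
    move=> Tx; apply: (@le_trans _ _ (\sum_(z <- vertices T) \sum_(i < 2) D z i ^+ 2)); last first.
      by rewrite big_seq [leRHS]big_seq; apply: ler_sum => z; exact: DE TM.
    rewrite dE//; move: Tx D0 D1 {DT dE}; case: (T) => [[a b] c] [ta [tb [tc [h1 h2 h3 h4 ->]]]] D0 D1.
    have [Ta Tb Tc] := tri_vertex a b c.
    rewrite /vertices /= !big_cons big_nil addr0 !sum2 !D0// !D1//.
    have cv g k : (affine k g (0, 0) (ta *: a + tb *: b + tc *: c)) ^+ 2
      <= (affine k g (0, 0) a) ^+ 2 + (affine k g (0, 0) b) ^+ 2 + (affine k g (0, 0) c) ^+ 2.
      rewrite (_ : affine k g (0, 0) (_ + _) = ta * affine k g (0, 0) a
         + tb * affine k g (0, 0) b + tc * affine k g (0, 0) c); first exact: convex_sqr_le.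
      by rewrite /affine /= (_ : tc = 1 - ta - tb); [rewrite /GRing.scale /=; ring|lra].
    have := cv g0 c0; have := cv g1 c1; lra.
  rewrite -mulr_sumr mulrC.
  have ma c g : measurable_fun (tri T)° (affine c g (0, 0)).
    exact: (measurable_funTS (continuous_measurable2 (@continuous_affine _ _ _ _))).
  apply: (@Rintegral_le_bound _ (tri T)°) => //.
  - by rewrite fineK// ge0_fin_numE.
  - apply: (@eq_measurable_fun _ _ _ _ _ (fun x => affine c0 g0 (0, 0) x ^+ 2 + affine c1 g1 (0, 0) x ^+ 2)).
      by move=> x /set_mem/interior_subset/dE ->.
    by apply: measurable_funD; exact: measurable_funX.
  - by move=> x /interior_subset Tx; rewrite dot_ge0 bd.
  - by apply: sumr_ge0 => z _; apply: mulr_ge0 => //; apply: sumr_ge0 => ? _; exact: sqnorm_ge0.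
apply: (@le_trans _ _ (\sum_(T <- M) \sum_(z <- vertices T) fine (mu (tri T)°) * E z)).
  by rewrite big_seq [leRHS]big_seq; apply: ler_sum => T; exact: step.
pose s T := sqnorm (tri T)° d.
have s0 T : 0 <= s T by exact: sqnorm_ge0.
have m0 T : 0 <= fine (mu (tri T)°) by exact: fine_ge0.
apply: (@le_trans _ _ (3 * \sum_(T <- M) s T)); last first.
  by apply: ler_wpM2l => //; exact: sum_sqnorm_le ms sid.
(* Regroups the contributions by the triangle [T'] over which the error is integrated. *)
have -> : \sum_(T <- M) \sum_(z <- vertices T) fine (mu (tri T)°) * E z =
    \sum_(T' <- M) s T' * \sum_(T <- M) \sum_(z <- vertices T | z \in tri T') fine (mu (tri T)°) * A z.
  under [RHS]eq_bigr do rewrite mulr_sumr.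
  rewrite exchange_big /=; apply: eq_bigr => T _.
  under [RHS]eq_bigr do rewrite mulr_sumr big_mkcond /=.
  rewrite exchange_big /=; apply: eq_bigr => z _.
  rewrite /E /Defs.patch big_filter -big_mkcond /= mulrA mulr_sumr.
  by apply: eq_bigr => T' _; rewrite -/(s T') mulrC.
rewrite mulr_sumr big_seq [leRHS]big_seq; apply: ler_sum => T' TM'.
rewrite [leRHS]mulrC; apply: ler_wpM2l => //.
(* By conformity a vertex of [T] lying in [T'] is a vertex of [T'], so the inner sum may range over
   the three vertices of [T']. *)
apply: (@le_trans _ _ (\sum_(T <- M) \sum_(z <- vertices T' | z \in tri T) fine (mu (tri T)°) * A z)).
  rewrite big_seq [leRHS]big_seq; apply: ler_sum => T TM.
  rewrite [leRHS]big_mkcond /=.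
  apply: (@le_trans _ _ (\sum_(z <- vertices T | z \in tri T') if z \in tri T then fine (mu (tri T)°) * A z else 0)).
    rewrite big_seq_cond [leRHS]big_seq_cond; apply: ler_sum => z /andP[zT _].
    rewrite mem_set//; move: zT; case: (T) => [[a b] c]; have [ha hb hc] := tri_vertex a b c.
    by rewrite !inE => /or3P[] /eqP->.
  apply: sum_subset_le.
  - exact: vertices_uniq (mesh_nondegenerate ms TM).
  - move=> z zT /set_mem zT'; have [->//|TT'] := eqVneq T' T.
    rewrite eq_sym in TT'.
    exact: (conforming_vertex (mesh_nondegenerate ms TM) (mesh_nondegenerate ms TM')
      (mesh_conforming ms TM TM' TT') zT zT').
  - by move=> z; case: ifP => // _; apply: mulr_ge0.
under eq_bigr do rewrite big_mkcond.
rewrite exchange_big /=.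
rewrite (_ : 3 = \sum_(z <- vertices T') 1 :> R); last first.
  by rewrite /vertices /= !big_cons big_nil addr0; ring.
apply: ler_sum => z _.
rewrite -big_mkcond /= -big_filter -/(Defs.patch M z) -mulr_suml.
have := patch_area z ms; rewrite /A; set B := area _ => hB.
have [->|Bn0] := eqVneq B 0; first by rewrite invr0 mulr0 ler01.
have B0 : 0 < B by rewrite lt_neqAle eq_sym Bn0 fine_ge0.
by rewrite ler_pdivrMr// mul1r.
Qed.

End Averages.

(** * Global estimate *)

Section Counting.
Context {R : realType}.
Implicit Types (Omega : set (plane_m R)) (T : triangle R) (e : edge R) (M : seq (triangle R)).

(** Three distinct triangles on one edge would have pairwise opposite inner normals, making a unit
    vector equal to its opposite. *)
Lemma neighbour_unique Omega M kappa N T T1 T2 e : mesh Omega M kappa N ->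
  T \in M -> T1 \in M -> T2 \in M -> T1 != T -> T2 != T ->
  has_edge T e -> has_edge T1 e -> has_edge T2 e -> T1 = T2.
Proof.
move=> ms TM TM1 TM2 n1 n2 eT eT1 eT2; apply/eqP/negPn/negP => n12.
have dis := mesh_disjoint ms.
have [W [TE D0 _]] := has_edgeP (mesh_nondegenerate ms TM) eT.
have [W1 [TE1 D1 _]] := has_edgeP (mesh_nondegenerate ms TM1) eT1.
have [W2 [TE2 D2 _]] := has_edgeP (mesh_nondegenerate ms TM2) eT2.
have [z [r [r0 zr _ _ _]]] := mesh_shape ms TM.
have [z1 [r1 [r10 zr1 _ _ _]]] := mesh_shape ms TM1.
have [z2 [r2 [r20 zr2 _ _ _]]] := mesh_shape ms TM2.
rewrite eq_sym in n1; rewrite eq_sym in n2.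
have d1 := dis _ _ TM TM1 n1; have d2 := dis _ _ TM TM2 n2; have d12 := dis _ _ TM1 TM2 n12.
rewrite TE TE1 in d1; rewrite TE TE2 in d2; rewrite TE1 TE2 in d12.
rewrite TE in zr; rewrite TE1 in zr1; rewrite TE2 in zr2.
have h1 := inner_normal_opp D0 D1 r0 zr r10 zr1 d1.
have h2 := inner_normal_opp D0 D2 r0 zr r20 zr2 d2.
have h12 := inner_normal_opp D1 D2 r10 zr1 r20 zr2 d12.
have := inner_normal_unit D0; move: h12; rewrite h1 h2 opprK.
case: (inner_normal _ _ _) => a b [ha hb] /=; nra.
Qed.

Lemma same_edge_sym e e' : same_edge e e' = same_edge e' e.
Proof.
case: e => a b; case: e' => a' b'; rewrite /same_edge /= !xpair_eqE.
by rewrite (eq_sym a) (eq_sym b) (eq_sym a b') (eq_sym b a') [(b' == _) && _]andbC.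
Qed.

(** A triangle [T'] is reached through its three edges, from at most one neighbour each; the crude
    factor 3 for the edges of that neighbour which may match gives 9. *)
Lemma sum_neighbour_le Omega M kappa N (f : triangle R -> R) : mesh Omega M kappa N ->
  (forall T, 0 <= f T) ->
  \sum_(T <- M) \sum_(e <- edges T | interior_edge M T e) f (head T (neighbours M T e))
  <= 9 * \sum_(T <- M) f T.
Proof.
move=> ms f0.
apply: (@le_trans _ _ (\sum_(T <- M) \sum_(e <- edges T) \sum_(T' <- M)
   if (T' != T) && has_edge T' e then f T' else 0)).
  apply: ler_sum => T _; rewrite big_mkcond /=; apply: ler_sum => e _.
  rewrite -big_mkcond /= -big_filter -/(neighbours M T e) /interior_edge.
  (* An empty list contributes nothing, so the default value of [head] never occurs; otherwise the
     head is one term of the full sum. *)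
  case: (neighbours M T e) => [|T' s] /=; first by rewrite big_nil.
  by rewrite big_cons lerDl; exact: sumr_ge0.
under eq_bigr do rewrite exchange_big /=.
rewrite exchange_big /= mulr_sumr big_seq [leRHS]big_seq; apply: ler_sum => T' TM'.
apply: (@le_trans _ _ (\sum_(e' <- edges T') \sum_(T <- M)
   if (T != T') && has_edge T e' then 3 * f T' else 0)).
  rewrite exchange_big /=; apply: ler_sum => T _.
  apply: (@le_trans _ _ (\sum_(e <- edges T) \sum_(e' <- edges T')
      if (T != T') && same_edge e e' then f T' else 0)).
    apply: ler_sum => e _; rewrite eq_sym; case: eqVneq => _ /=.
      by rewrite big1.
    case: ifP => [/hasP[e' e'T ee']|_]; last by apply: sumr_ge0 => e' _; case: ifP.
    rewrite (big_rem e' e'T) /= ee' lerDl; apply: sumr_ge0 => e'' _; by case: ifP.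
  rewrite exchange_big /=; apply: ler_sum => e' _; case: eqVneq => _ /=.
    by rewrite big1.
  case: ifP => eT.
    rewrite /edges !big_cons big_nil addr0.
    have b e : (if same_edge e e' then f T' else 0) <= f T' by case: ifP.
    have := b (T.1.1, T.1.2); have := b (T.1.2, T.2); have := b (T.2, T.1.1); lra.
  rewrite big_seq big1// => e eTe; case: ifP => // ee; move: eT.
  by rewrite /has_edge => /hasPn/(_ _ eTe); rewrite same_edge_sym ee.
have one e' : e' \in edges T' ->
    \sum_(T <- M) (if (T != T') && has_edge T e' then 3 * f T' else 0) <= 3 * f T'.
  move=> eT'; have hT' : has_edge T' e' by apply/hasP; exists e' => //; rewrite /same_edge eqxx.
  have f3 : 0 <= 3 * f T' by exact: mulr_ge0.
  rewrite -big_mkcond -big_filter /=.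
  set s := [seq _ <- _ | _]; have su : uniq s by rewrite filter_uniq// (mesh_uniq ms).
  have sP T : T \in s -> [/\ T != T', has_edge T e' & T \in M].
    by rewrite mem_filter => /andP[/andP[]].
  case: s su sP => [|T1 [|T2 s]] su sP.
  - by rewrite big_nil.
  - by rewrite big_seq1.
  - have [m1 e1 M1] := sP T1 (mem_head _ _).
    have [|m2 e2 M2] := sP T2; first by rewrite !inE eqxx orbT.
    have E := neighbour_unique ms TM' M1 M2 m1 m2 hT' e1 e2.
    by move: su; rewrite E /= inE eqxx.
rewrite (_ : 9 * f T' = \sum_(e' <- edges T') 3 * f T'); last first.
  by rewrite /edges !big_cons big_nil; ring.
by rewrite big_seq [leRHS]big_seq; apply: ler_sum => e'; exact: one.
Qed.

End Counting.

(** * Summation of the local bounds *)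

Section Efficiency.
Context {R : realType}.
Implicit Types (Omega : set (plane_m R)) (T : triangle R) (e : edge R)
  (M : seq (triangle R)) (sigma : tfield R) (u : vfield R).
Local Notation mu := (mu2 R).

Lemma sqnorm_sum3 Omega n (A B D G : plane_m R -> 'M[R]_(2, n)) : measurable Omega ->
  field_si Omega A -> field_si Omega B -> field_si Omega D -> field_si Omega G ->
  sqnorm Omega (fun x => A x - G x)
  <= 3 * (sqnorm Omega (fun x => A x - B x) + sqnorm Omega (fun x => B x - D x)
          + sqnorm Omega (fun x => D x - G x)).
Proof.
move=> mO sA sB sD sG; rewrite /sqnorm.
have iAB := dot_integrable mO (field_siB mO sA sB).
have iBD := dot_integrable mO (field_siB mO sB sD).
have iDG := dot_integrable mO (field_siB mO sD sG).
have iAG := dot_integrable mO (field_siB mO sA sG).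
have iS := integrableRD mO (integrableRD mO iAB iBD) iDG.
rewrite -RintegralD// -RintegralD//; last exact: integrableRD.
rewrite -RintegralZl//.
apply: le_Rintegral => //; first exact: (integrableRZ 3 mO iS).
move=> x _; rewrite /dot -!big_split /= mulr_sumr; apply: ler_sum => i _.
rewrite -!big_split /= mulr_sumr; apply: ler_sum => j _; rewrite !mxE.
set a := A x i j; set b := B x i j; set d := D x i j; set g := G x i j.
have := sqr_ge0 ((a - b) - (b - d)); have := sqr_ge0 ((b - d) - (d - g)).
have := sqr_ge0 ((a - b) - (d - g)); nra.
Qed.

Lemma field_si_rpart Omega (k : R) sigma : measurable Omega -> field_si Omega sigma ->
  field_si Omega (fun x => k *: rpart (sigma x)).
Proof.
move=> mO st i j; rewrite (_ : (fun x => _) = fun x => k * (2^-1 * (sigma x i j + sigma x j i))).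
  apply: square_integrableZ => //; apply: square_integrableZ => //.
  exact: square_integrableD.
by apply/funext => x; rewrite mxE rpartE [_ / 2]mulrC.
Qed.

Lemma sqnorm_rpart_le Omega (k : R) sigma sigma' : measurable Omega ->
  field_si Omega sigma -> field_si Omega sigma' ->
  sqnorm Omega (fun x => k *: rpart (sigma x) - k *: rpart (sigma' x))
  <= k ^+ 2 * sqnorm Omega (fun x => sigma x - sigma' x).
Proof.
move=> mO s1 s2; have iB := dot_integrable mO (field_siB mO s1 s2).
rewrite /sqnorm -RintegralZl//.
apply: le_Rintegral => //.
- exact: dot_integrable mO (field_siB mO (field_si_rpart k mO s1) (field_si_rpart k mO s2)).
- exact: (integrableRZ (k ^+ 2) mO iB).
move=> x _; apply: (@le_trans _ _ (k ^+ 2 * dot (rpart (sigma x - sigma' x)) (rpart (sigma x - sigma' x)))).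
  have e i j : (k *: rpart (sigma x) - k *: rpart (sigma' x)) i j = k * rpart (sigma x - sigma' x) i j.
    by rewrite [LHS]mxE [X in _ + X]mxE [X in X + _]mxE [X in _ - X]mxE !rpartE !mxE; field.
  rewrite le_eqVlt; apply/orP; left; apply/eqP.
  by rewrite !dot2E !e; ring.
by apply: ler_wpM2l; [exact: sqr_ge0|exact: rpart_dot_le].
Qed.

(** Both families of edge elements consist of elementwise affine fields, which is how the two values
    of [ell] are treated together. *)
Lemma NED_affine Omega M ell sigma T : NEDh Omega M ell sigma -> T \in M ->
  exists c g, affine_on (tri T)° sigma c g.
Proof.
move=> [_ h] TM.
have ex (i j : 'I_2) : exists k : R * (R * R), forall x, (tri T)° x ->
    sigma x i j = affine k.1 k.2 (0, 0) x.
  have [q Nq hq] := h T TM i.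
  have qE x : (tri T)° x -> sigma x i j = q x 0 j.
    by move=> Tx; rewrite -hq// mxE.
  move: Nq; rewrite /NED; case: ifP => _.
    (* The rotation part is [b * x.2] in column 0, with gradient [(0, b)], and [- b * x.1] in column
       1, with gradient [(- b, 0)]. *)
    move=> [a [b ab]]; exists (a 0 j, (b * - (j == 1)%:R, b * (j == 0)%:R)) => x Tx.
    rewrite qE// ab !mxE /affine /=; case: (ord2 j) => -> /=; ring.
  move=> /(_ j)[a [b [d hd]]]; exists (a, (b, d)) => x Tx.
  by rewrite qE// hd /affine /=; ring.
pose f i := projT1 (choice (ex i)); have hf i := projT2 (choice (ex i)).
exists (fun i j => (f i j).1), (fun i j => (f i j).2) => x Tx i j; exact: hf.
Qed.

Lemma affine_on_rpart D (k : R) sigma c g : affine_on D sigma c g ->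
  exists c' g', affine_on D (fun x => k *: rpart (sigma x)) c' g'.
Proof.
move=> h; exists (fun i j => k * ((c i j + c j i) / 2)),
  (fun i j => (k * (((g i j).1 + (g j i).1) / 2), k * (((g i j).2 + (g j i).2) / 2))) => x Dx i j.
by rewrite mxE rpartE !h// /affine /=; field.
Qed.

(** The constant is chosen before the domain, the mesh and both solutions: it depends on [mu0],
    [kappa] and [N] only, hence is uniform in the mesh size. *)
Lemma estimator_le (mu0 kappa N : R) : 0 < mu0 -> 0 < kappa -> 0 < N ->
  exists2 C : R, 0 < C &
  forall Omega M ell (Theta : vfield R -> vfield R) (lam : R) sigma u sigmah uh,
  open (Omega : set (plane R)) -> 0 < fine (mu Omega) -> Omega `<=` box 0 N ->
  (closure (Omega : set (plane R)))° `<=` Omega -> mesh Omega M kappa N ->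
  {in M, forall T, tri T `<=` closure (Omega : set (plane R))} ->
  postprocessing Omega M Theta ->
  eigensolution Omega mu0 (H0 Omega) (Q Omega) lam sigma u ->
  H0h Omega M ell sigmah -> Qh Omega M uh ->
  eta_sqr Omega mu0 M Theta sigmah uh
  <= C * (L2norm Omega (fun x => u x - uh x) ^+ 2
          + L2norm Omega (fun x => sigma x - sigmah x) ^+ 2
          + L2norm Omega (fun x => Theta u x - u x) ^+ 2).
Proof.
move=> mu0_gt0 ka0 N0.
have [C1 C10 h1] := @element_residual R kappa N ka0 N0.
have [C2 C20 h2] := @element_div R kappa N ka0.
have [C3 C30 h3] := @edge_interior R kappa N ka0.
have [C4 C40 h4] := @edge_boundary R kappa N ka0.
(* Total coefficient of the error of [S]: [12 * C3] is three edges of the element itself plus 9 from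
   [sum_neighbour_le], and [3 * C4] three boundary edges. *)
pose C0 := C1 + C2 + 12 * C3 + 3 * C4.
have C00 : 0 < C0 by rewrite /C0; lra.
have m2 : 0 <= mu0^-1 ^+ 2 by exact: sqr_ge0.
(* Here [12 = 3 * (3 + 1)]: the three-term splitting of the averaging term, stability with constant
   3, and the error of [u] itself. The last factor passes from [S - F] to [sigma - sigmah]. *)
exists (12 + C1 + C0 * mu0^-1 ^+ 2).
  by have := mulr_ge0 (ltW C00) m2; lra.
move=> Omega M ell Theta lam sigma u sigmah uh oO O0 ON icO ms TO pp eig [NEDsh _] [Quh uhP].
have [[Lsh _] _] := NEDsh.
have [[[Ls _] _] Qu _ _ _] := eig.
have mO : @measurable _ (plane_m R) Omega := open_measurable2 oO.
have Ooo : (mu Omega < +oo)%E.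
  by apply: le_lt_trans (leb2_sub_box mO (ltW N0) ON) (ltry _).
have sis : field_si Omega sigma by move=> i j; exact: Ls.
have sish : field_si Omega sigmah by move=> i j; exact: Lsh.
have siu : field_si Omega u by move=> i j; exact: Qu.
have siuh : field_si Omega uh by move=> i j; exact: Quh.
have siTu : field_si Omega (Theta u) by have [[[L _] _] _] := pp u Qu; move=> i j; exact: L.
have siTuh : field_si Omega (Theta uh) by have [[[L _] _] _] := pp uh Quh; move=> i j; exact: L.
pose S x := mu0^-1 *: rpart (sigma x); pose F x := mu0^-1 *: rpart (sigmah x).
have siS : field_si Omega S by exact: field_si_rpart.
have siF : field_si Omega F by exact: field_si_rpart.
have wp i : weak_pair Omega (fun j x => S x i j) (fun x => u x i 0).
  rewrite (_ : (fun j x => S x i j) = fun j x => mu0^-1 * rpart (sigma x) i j).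
    exact: eigen_weak_pair mO O0 ON Ooo eig i.
  by apply/funext => j; apply/funext => x; rewrite mxE.
pose ef T := sqnorm (tri T)° (fun x => S x - F x).
pose eu T := sqnorm (tri T)° (fun x => u x - uh x).
pose et T := sqnorm (tri T)° (fun x => Theta uh x - Theta u x).
pose ho T := sqnorm (tri T)° (fun x => Theta u x - u x).
have ef0 T : 0 <= ef T by exact: sqnorm_ge0.
have mT := measurable_tri_interior.
have local T : T \in M -> etaT_sqr Omega mu0 M Theta sigmah uh T
    <= 3 * (et T + ho T + eu T) + C1 * (ef T + eu T) + C2 * ef T
       + (3 * C3 * ef T
          + C3 * \sum_(e <- edges T | interior_edge M T e) ef (head T (neighbours M T e)))
       + 3 * C4 * ef T.
  move=> TM; have [z [r sh]] := mesh_shape ms TM; have [_ _ _ _ TOi] := sh.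
  have nd := mesh_nondegenerate ms TM.
  have [cs [gs sA]] := NED_affine NEDsh TM.
  have [c [g FA]] := affine_on_rpart mu0^-1 sA.
  rewrite /etaT_sqr -/(F _).
  apply: lerD; first apply: lerD; first apply: lerD; first apply: lerD.
  - rewrite L2norm_sqr; apply: sqnorm_sum3 => //; exact: field_siS (mT _ T) mO TOi _.
  - have [a ha] : exists a : 'I_2 -> R, forall x, (tri T)° x -> forall i, uh x i 0 = a i.
      have ex i : exists k, forall x, (tri T)° x -> uh x i 0 = k.
        by have [p [k hk] hp] := uhP T TM i; exists k => x Tx; rewrite hp.
      by exists (projT1 (choice ex)) => x Tx i; exact: (projT2 (choice ex)).
    exact: (h1 Omega S u F uh T z r c g a mO Ooo wp sh FA ha).
  - by have [] := h2 Omega S u F T z r c g mO Ooo wp sh FA.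
  - apply: (@le_trans _ _ (\sum_(e <- edges T | interior_edge M T e)
        C3 * (ef T + ef (head T (neighbours M T e))))).
      rewrite big_seq_cond [leRHS]big_seq_cond; apply: ler_sum => e /andP[eT].
      rewrite /interior_edge /normal_jump.
      have : {subset neighbours M T e <= neighbours M T e} by [].
      case: {-2}(neighbours M T e) => // T' s /(_ T' (mem_head _ _)) /= + _.
      rewrite mem_filter => /andP[/andP[n1 eT'] TM'].
      have [z' [r' sh']] := mesh_shape ms TM'.
      have [cs' [gs' sA']] := NED_affine NEDsh TM'.
      have [c' [g' FA']] := affine_on_rpart mu0^-1 sA'.
      apply: (h3 Omega S u F T z r c g T' z' r' c' g' e mO Ooo icO (TO T TM) (TO T' TM') wp
        sh FA sh' FA' nd (mesh_nondegenerate ms TM') _ _ eT').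
        by apply: (mesh_disjoint ms TM TM'); rewrite eq_sym.
      by apply/hasP; exists e => //; rewrite /same_edge eqxx.
    under eq_bigr do rewrite mulrDr.
    rewrite big_split /= -[X in _ + X <= _]mulr_sumr lerD2r.
    apply: (@le_trans _ _ (\sum_(e <- edges T) C3 * ef T)).
      rewrite big_mkcond /=; apply: ler_sum => e _; case: ifP => // _.
      by apply: mulr_ge0 => //; exact: ltW.
    by rewrite /edges !big_cons big_nil le_eqVlt; apply/orP; left; apply/eqP; ring.
  - apply: (@le_trans _ _ (\sum_(e <- edges T) C4 * ef T)).
      rewrite big_mkcond /= big_seq [leRHS]big_seq; apply: ler_sum => e eT.
      case: ifP => [/asboolP be|_]; last by apply: mulr_ge0 => //; exact: ltW.
      apply: (h4 Omega S u F T z r c g e mO Ooo wp sh FA nd).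
        by apply/hasP; exists e => //; rewrite /same_edge eqxx.
      (* The open set [Omega] is its own interior, hence disjoint from its boundary. *)
      apply/seteqP; split=> // x [/be[_ nOx] Ox]; apply: nOx.
      by move: oO; rewrite openE => /(_ x Ox).
    by rewrite /edges !big_cons big_nil le_eqVlt; apply/orP; left; apply/eqP; ring.
apply: (@le_trans _ _ (\sum_(T <- M) (3 * (et T + ho T + eu T) + C1 * (ef T + eu T) + C2 * ef T
       + (3 * C3 * ef T
          + C3 * \sum_(e <- edges T | interior_edge M T e) ef (head T (neighbours M T e)))
       + 3 * C4 * ef T))).
  by rewrite /eta_sqr big_seq [leRHS]big_seq; apply: ler_sum => T; exact: local.
rewrite !big_split /= -!mulr_sumr !big_split /=.
have hnb := sum_neighbour_le ms ef0.
have het := postprocessing_le mO ms pp Quh Qu.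
have hho := sum_sqnorm_le mO ms (field_siB mO siTu siu).
have heu := sum_sqnorm_le mO ms (field_siB mO siu siuh).
have hef := sum_sqnorm_le mO ms (field_siB mO siS siF).
have hrp := sqnorm_rpart_le mu0^-1 mO sis sish.
rewrite !L2norm_sqr -/(sqnorm Omega (fun x => u x - uh x))
  -/(sqnorm Omega (fun x => sigma x - sigmah x)) -/(sqnorm Omega (fun x => Theta u x - u x)).
have sym : sqnorm Omega (fun x => uh x - u x) = sqnorm Omega (fun x => u x - uh x).
  by apply: eq_Rintegral => x _; rewrite -[LHS]/(dot _ _) !dotc2E !mxE; ring.
rewrite sym in het.
have sU := sqnorm_ge0 Omega (fun x => u x - uh x).
have sS := sqnorm_ge0 Omega (fun x => sigma x - sigmah x).
have sH := sqnorm_ge0 Omega (fun x => Theta u x - u x).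
have sf := le_trans hef hrp.
pose X1 := \sum_(T <- M) et T; pose X2 := \sum_(T <- M) ho T; pose X3 := \sum_(T <- M) eu T.
pose X4 := \sum_(T <- M) ef T.
pose X5 := \sum_(T <- M) \sum_(e <- edges T | interior_edge M T e) ef (head T (neighbours M T e)).
move: hnb het hho heu sf sU sS sH.
set U := sqnorm _ (fun x => u x - _); set V := sqnorm _ (fun x => sigma x - _).
set H := sqnorm _ (fun x => Theta u x - _).
rewrite -/X1 -/X2 -/X3 -/X4 -/X5.
change (X5 <= 9 * X4 -> X1 <= 3 * U -> X2 <= H -> X3 <= U -> X4 <= mu0^-1 ^+ 2 * V ->
  0 <= U -> 0 <= V -> 0 <= H ->
  3 * (X1 + X2 + X3) + C1 * (X4 + X3) + C2 * X4 + (3 * C3 * X4 + C3 * X5) + 3 * C4 * X4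
  <= (12 + C1 + C0 * mu0^-1 ^+ 2) * (U + V + H)).
move: X1 X2 X3 X4 X5 U V H => X1 X2 X3 X4 X5 U V H q1 q2 q3 q4 q5 U0 V0 H0.
have b1 : C3 * X5 <= C3 * (9 * X4) by rewrite ler_pM2l.
have b2 : C0 * X4 <= C0 * (mu0^-1 ^+ 2 * V) by rewrite ler_pM2l.
have b3 : C1 * X3 <= C1 * U by rewrite ler_pM2l.
have b4 : 0 <= (C0 * mu0^-1 ^+ 2) * (U + H).
  by apply: mulr_ge0; [apply: mulr_ge0 => //; exact: ltW|exact: addr_ge0].
have b5 : 0 <= C1 * (V + H) by apply: mulr_ge0; [exact: ltW|exact: addr_ge0].
move: b1 b2; rewrite /C0 in b4 *; move: (mu0^-1 ^+ 2) b4 {m2 hrp q5} => k b4 b1 b2; lra.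
Qed.

End Efficiency.

Lemma open_area_gt0 (R : realType) (Omega : set (plane_m R)) (N : R) :
  open (Omega : set (plane R)) -> Omega !=set0 -> Omega `<=` box 0 N ->
  0 < fine (mu2 R Omega).
Proof.
move=> oO [x Ox] ON; have mO : @measurable _ (plane_m R) Omega := open_measurable2 oO.
have N0 : 0 <= N by have /box0P[/(le_trans (normr_ge0 _))] := ON x Ox.
have Ooo : (mu2 R Omega < +oo)%E by apply: le_lt_trans (leb2_sub_box mO N0 ON) (ltry _).
have : nbhs x Omega by exact: open_nbhs_nbhs.
move=> /nbhs_ball_sub[r r0 rO].
have bO : box x (r / 2) `<=` Omega.
  by move=> y /boxP[h1 h2]; apply: rO; lra.
have r2 : 0 < r / 2 by rewrite divr_gt0.
apply: (@lt_le_trans _ _ (fine (mu2 R (box x (r / 2))))).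
  by rewrite leb2_box ?ltW//= mulr_gt0// exprn_gt0.
apply: fine_le.
- by rewrite leb2_box ?ltW.
- by rewrite ge0_fin_numE.
- by apply: le_measure; rewrite ?inE//; exact: measurable_box.
Qed.

Unset Implicit Arguments.

Theorem theorem5p14 (R : realType) (Omega : set (plane R)) (mu : R)
    (hs : set R) (Th : R -> seq (triangle R)) (ell : nat)
    (Theta : R -> vfield R -> vfield R)
    (lam : R) (sigma : tfield R) (u : vfield R) :
  polygonal_lipschitz_domain Omega ->
  0 < mu ->
  regular_family Omega hs Th ->
  (ell = 1 \/ ell = 2)%N ->
  (forall h, hs h -> postprocessing Omega (Th h) (Theta h)) ->
  simple_eigenvalue Omega mu lam ->
  eigensolution Omega mu (H0 Omega) (Q Omega) lam sigma u ->
  L2norm Omega u = 1 ->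
  exists2 C : R, 0 < C &
    forall (lamh : R -> R) (sigmah : R -> tfield R) (uh : R -> vfield R),
    (forall h, hs h ->
       eigensolution Omega mu (H0h Omega (Th h) ell) (Qh Omega (Th h))
         (lamh h) (sigmah h) (uh h) /\
       L2norm Omega (uh h) = 1) ->
    lamh h @[h --> within hs (nbhs 0)] --> lam ->
    forall h, hs h ->
      eta_sqr Omega mu (Th h) (Theta h) (sigmah h) (uh h)
      <= C * (L2norm Omega (fun x => u x - uh h x) ^+ 2
              + L2norm Omega (fun x => sigma x - sigmah h x) ^+ 2
              + L2norm Omega (fun x => Theta h u x - u x) ^+ 2).
Proof.
move=> [oO O0 _ bO [lip _]] mu_gt0 [_ _ tri_h [kappa hk]] _ pp _ eig _.
have [N N0 hN] := bounded_sub_box bO.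
(* The regularity constant comes without a sign; enlarging it keeps the diameter bound and makes it
   positive. *)
have ka0 : 0 < `|kappa| + 1 by have := normr_ge0 kappa; lra.
have [C C0 hC] := estimator_le mu_gt0 ka0 N0.
exists C => // lamh sigmah uh eigh _ h hsh.
have [[un nd cf cover] _] := tri_h h hsh; have [[sh Quh _ _ _] _] := eigh h hsh.
have TO : {in Th h, forall T, tri T `<=` closure Omega}.
  by move=> T TM x Tx; rewrite -cover; exists T.
have ON : Omega `<=` box 0 N by move=> x Ox; apply: hN; exact: subset_closure.
have icO := interior_closure_lipschitz oO lip.
apply: (hC Omega (Th h) ell (Theta h) lam sigma u (sigmah h) (uh h) oO
  (open_area_gt0 oO O0 ON) ON icO _ TO (pp h hsh) eig sh Quh).
split=> // T TM; have [z [r [r0 zr dk]]] := hk h hsh T TM; exists z, r; split=> //.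
- apply: le_trans dk _; apply: ler_wpM2r; first exact: ltW.
  by have := ler_norm kappa; lra.
- by move=> x Tx; apply: hN; exact: TO Tx.
- by move=> x Tx; apply: icO; move: Tx; apply: interiorS; exact: TO.
Qed.
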